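(* Let $X$ be a finite connected CW complex of dimension $d\ge1$, and fix $z_0\in Z_{d-1}(X;\mathbb Z)$. Let $\gamma\colon\mathbb R\to\breve{\mathcal M}_X$ be a smooth $1$-periodic map into the space of good parameters. Then the low temperature, adiabatic limit of the average current $$\lim_{\beta\to\infty}Q^B_\beta,\qquad Q^B_\beta:=\lim_{\tau_D\to\infty}Q_{\tau_D,\beta},$$ is well-defined (the limits exist) and lies in the fractional lattice $$H_d(X;\mathbb Z[\tfrac1\delta])\subset H_d(X;\mathbb R),\qquad \delta:=\prod_{L,T}a_L\theta_T,$$ where $L$ ranges over all spanning co-trees of $X$ (in dimension $d-1$) and $T$ over all spanning trees of $X$ (in dimension $d$).
   Context: **Chains.** $X_k$ is the set of (oriented) $k$-cells of $X$, $X^{(k)}$ its $k$-skeleton; $C_k(X;A)$ is the cellular chain module with boundary $\partial$; $Z_k$ are cycles. Since $\dim X=d$, $H_d(X;A)=Z_d(X;A)$. $\partial^*$ is the adjoint of $\partial$ for the inner products in which the cells are orthonormal. $\beta_k(Y)$ is the $k$-th Betti number. **Parameters.** $\mathcal M_X$ is the real vector space of pairs $(E,W)$ of functions $E\colon X_{d-1}\to\mathbb R$, $W\colon X_d\to\mathbb R$. $\breve{\mathcal M}_X\subset\mathcal M_X$ (good parameters) is the set of $(E,W)$ with $E$ one-to-one or $W$ one-to-one. $e^{\beta E}$, $e^{\beta W}$ are the diagonal operators $j\mapsto e^{\beta E_j}j$ and $\alpha\mapsto e^{\beta W_\alpha}\alpha$. Write $\gamma(t)=(E(t),W(t))$. **Average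 current.** For $\beta>0$ and $\tau_D$ sufficiently large (depending on $\beta,\gamma$), the dynamical equation $\dot q=-\tau_D\,\partial e^{-\beta W(t)}\partial^*e^{\beta E(t)}q$ has a unique $1$-periodic solution $\rho=\rho_{\tau_D,\beta}$ with values in real $(d-1)$-cycles representing $[z_0]\in H_{d-1}(X;\mathbb R)$. The average current is $$Q_{\tau_D,\beta}=\int_0^1\tau_D\,e^{-\beta W(t)}\partial^*e^{\beta E(t)}\rho(t)\,dt,$$ which is a $d$-cycle, i.e. an element of $H_d(X;\mathbb R)$. **Spanning trees.** A spanning tree of $X$ is a subcomplex $T$ with $X^{(d-1)}\subset T\subset X$, $H_d(T;\mathbb Z)=0$ and $\beta_{d-1}(T)=\beta_{d-1}(X)$; $\theta_T$ is the order of the torsion subgroup of $H_{d-1}(T;\mathbb Z)$. **Spanning co-trees.** A spanning co-tree of $X$ is a subcomplex $L$ with $X^{(d-2)}\subset L\subset X^{(d-1)}$ such that the inclusion induces an isomorphism $H_{d-1}(L;\mathbb Q)\to H_{d-1}(X;\mathbb Q)$ and $\beta_{d-2}(L)=\beta_{d-2}(X)$; $a_L$ is the order of the finite group $H_{d-1}(X,L;\mathbb Z)$. *)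

(* Defs.v *)
From HB Require Import structures.
From mathcomp Require Import finmap.
From mathcomp Require Import all_boot all_order all_algebra.
From mathcomp Require Import all_classical all_reals all_analysis.
Import Order.TTheory GRing.Theory Num.Theory.
Import numFieldNormedType.Exports.

Set Implicit Arguments.
Unset Strict Implicit.
Unset Printing Implicit Defensive.

Local Open Scope classical_set_scope.
Local Open Scope ring_scope.

(* Normalized cubical singular chains.  A map from the cube [0,1]^k is encoded *)
(* as a map on R^k that factors through the retraction [clamp] onto the cube,  *)
(* so that Leibniz equality is equality of maps on the cube.  Chains of all    *)
(* degrees live in a single type; a chain is a list of weighted cubes.         *)
Section CubicalChains.
Variables (R : realType) (T : topologicalType).

Definition clamp k (x : 'rV[R]_k) : 'rV[R]_k :=
  \row_i Num.min 1 (Num.max 0 (x 0 i)).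

Definition cube k : set 'rV[R]_k := [set x | forall i, 0 <= x 0 i <= 1].
Definition open_cube k : set 'rV[R]_k := [set x | forall i, 0 < x 0 i < 1].

Definition scube := {k : nat & 'rV[R]_k -> T}.

Definition singular (A : set T) (s : scube) :=
  [/\ continuous (tagged s),
      forall x, tagged s (clamp x) = tagged s x
    & range (tagged s) `<=` A].

Definition degenerate (s : scube) :=
  exists i : 'I_(tag s), forall x y : 'rV[R]_(tag s),
    (forall j, j != i -> x 0 j = y 0 j) -> tagged s x = tagged s y.

Definition schain := seq (int * scube).

Definition coef (c : schain) (s : scube) : int :=
  \sum_(p <- c | `[< p.2 = s >]) p.1.

Definition sadd (c c' : schain) : schain := c ++ c'.

(* equality modulo degenerate cubes *)
Definition schain_eq (c c' : schain) :=
  forall s, ~ degenerate s -> coef c s = coef c' s.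

Definition insert_coord k (i : 'I_k.+1) (e : R) (x : 'rV[R]_k) : 'rV[R]_k.+1 :=
  \row_j (if unlift i j is Some j' then x 0 j' else e).

Definition face k (i : 'I_k.+1) (e : R) (f : 'rV[R]_k.+1 -> T) : scube :=
  existT (fun m => 'rV[R]_m -> T) k (fun x => f (insert_coord i e x)).

Definition cube_bd k : ('rV[R]_k -> T) -> schain :=
  match k return ('rV[R]_k -> T) -> schain with
  | 0 => fun=> [::]
  | k'.+1 => fun f =>
      flatten [seq [:: ((-1) ^+ i, face i 1 f); (- (-1) ^+ i, face i 0 f)]
              | i : 'I_k'.+1 <- enum 'I_k'.+1]
  end.

Definition schain_bd (c : schain) : schain :=
  flatten [seq [seq (p.1 * q.1, q.2) | q <- cube_bd (tagged p.2)] | p <- c].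

Definition schain_in (A : set T) (c : schain) :=
  all (fun p => `[< singular A p.2 >]) c.

End CubicalChains.
Arguments cube {R} k.
Arguments open_cube {R} k.

(* Finite CW complexes.  Cells of all dimensions are indexed together, and a   *)
(* cell is given by its characteristic map, whose domain is a cube; it also    *)
(* orients the cell.  As there are finitely many cells, closure finiteness and *)
(* the weak topology are automatic.                                            *)
Record cw_complex (R : realType) := CWComplex {
  space :> topologicalType;
  ncell : nat;
  char : 'I_ncell -> scube R space;
  cdim a := tag (char a);
  ocell a : set space := tagged (char a) @` open_cube (tag (char a));
  space_hausdorff : hausdorff_space space;
  char_singular : forall a, singular setT (char a);
  char_inj : forall a,
    set_inj (open_cube (tag (char a))) (tagged (char a));
  ocell_partition : forall x : space, exists! a, ocell a x;
  char_frontier : forall a,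
    tagged (char a) @` (cube (tag (char a)) `\` open_cube (tag (char a))) `<=`
      \bigcup_(b in [set b | (cdim b < cdim a)%N]) ocell b
}.
Arguments cdim {R X} : rename.
Arguments ocell {R X} : rename.
Arguments char {R} X : rename.
Arguments ncell {R} X : rename.
Arguments space {R} X : rename.

Section Subcomplexes.
Variables (R : realType) (X : cw_complex R).

Definition cell := 'I_(ncell X).

Definition no_cell : {set cell} := finset.set0.
Definition all_cells : {set cell} := finset.setT.

Definition realization (Y : {set cell}) : set X :=
  \bigcup_(a in [set` Y]) ocell a.

Definition subcomplex (Y : {set cell}) := closed (realization Y).

Definition skeleton (k : int) : {set cell} := [set a | (cdim a)%:Z <= k].

Definition has_dim (d : nat) :=
  (forall a : cell, (cdim a <= d)%N) /\ exists a : cell, cdim a = d.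

(* The cellular boundary H_k(X^k, X^(k-1)) -> H_(k-1)(X^(k-1), X^(k-2)) in the *)
(* bases of the characteristic maps; [D b a] is the incidence number of the    *)
(* cell a with the cell b.  Such a D exists, is unique, and squares to zero by *)
(* the standard theory of cellular homology; the last property is recorded     *)
(* here for use, and excludes no complex.                                      *)
Definition cellular_boundary (D : 'M[int]_(ncell X)) :=
  [/\ forall a b : cell, D b a != 0 -> cdim a = (cdim b).+1,
      forall a : cell, exists u v : schain R X,
        [/\ schain_in (realization (skeleton ((cdim a)%:Z - 1))) u,
            schain_in (realization (skeleton ((cdim a)%:Z - 2))) v
          & schain_eq (schain_bd [:: (1, char X a)])
              (sadd [seq (D b a, char X b) | b : cell <- enum 'I_(ncell X)]
                    (sadd (schain_bd u) v))]
    & D *m D = 0].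

End Subcomplexes.
Arguments cell {R} X.
Arguments no_cell {R X}.
Arguments all_cells {R X}.
Arguments skeleton {R} X k.

Record cellular_complex (R : realType) := CellularComplex {
  cw :> cw_complex R;
  incidence : 'M[int]_(ncell cw);
  incidenceP : cellular_boundary incidence
}.

(* Cellular chains of all degrees form one space of column vectors indexed by  *)
(* the cells; degrees are integers, so that degrees -1 and -2 are empty.       *)
Section CellularChains.
Variables (R : realType) (X : cellular_complex R).

Definition bd (A : pzRingType) : 'M[A]_(ncell X) :=
  map_mx intr (incidence X).

Section Homology.
Variable A : pzRingType.
Implicit Types (Y L : {set cell X}) (k : int).

Definition chains Y k : set 'cV[A]_(ncell X) :=
  [set c | forall a, c a 0 != 0 -> a \in Y /\ (cdim a)%:Z = k].

(* relative to L; the absolute notions are those for L = no_cell *)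
Definition cycles Y L k : set 'cV[A]_(ncell X) :=
  [set z | chains Y k z /\ chains L (k - 1) (bd A *m z)].

Definition boundaries Y L k : set 'cV[A]_(ncell X) :=
  [set z | chains Y k z /\
           exists2 w, chains Y (k + 1) w & chains L k (z - bd A *m w)].

Definition hclass Y L k z : set 'cV[A]_(ncell X) :=
  [set z' | cycles Y L k z' /\ boundaries Y L k (z' - z)].

Definition homology Y L k : set (set 'cV[A]_(ncell X)) :=
  hclass Y L k @` cycles Y L k.

Definition torsion Y L k : set (set 'cV[A]_(ncell X)) :=
  [set hclass Y L k z | z in
    [set z | cycles Y L k z /\
             exists2 n, (0 < n)%N & boundaries Y L k (z *+ n)]].

(* the map induced by the inclusion of a subcomplex in Y *)
Definition incl_homology Y k (c : set 'cV[A]_(ncell X)) :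
    set 'cV[A]_(ncell X) :=
  \bigcup_(z in c) hclass Y no_cell k z.

End Homology.
Arguments chains A Y k : clear implicits.
Arguments cycles A Y L k : clear implicits.
Arguments boundaries A Y L k : clear implicits.
Arguments hclass A Y L k z : clear implicits.
Arguments homology A Y L k : clear implicits.
Arguments torsion A Y L k : clear implicits.
Arguments incl_homology A Y k c : clear implicits.

Definition chain_space (Y : {set cell X}) (k : int) :
    {vspace 'cV[rat]_(ncell X)} :=
  <<[seq delta_mx a 0%R | a : cell X <- enum Y & ((cdim a)%:Z == k)%R]>>%VS.

Definition betti (Y : {set cell X}) (k : int) : nat :=
  (\dim (lker (linfun (mulmx (bd rat))) :&: chain_space Y k)
   - \dim (linfun (mulmx (bd rat)) @: chain_space Y (k + 1)))%N.

Definition spanning_tree (d : int) (T : {set cell X}) :=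
  [/\ subcomplex T,
      skeleton X (d - 1) \subset T,
      homology int T no_cell d = [set hclass int T no_cell d 0]
    & betti T (d - 1) = betti all_cells (d - 1)].

Definition tree_torsion (d : int) (T : {set cell X}) : nat :=
  #|` fset_set (torsion int T no_cell (d - 1)) |.

Definition spanning_cotree (d : int) (L : {set cell X}) :=
  [/\ subcomplex L,
      (skeleton X (d - 2) \subset L) && (L \subset skeleton X (d - 1)),
      set_bij (homology rat L no_cell (d - 1)) (homology rat all_cells no_cell (d - 1))
        (incl_homology rat all_cells (d - 1))
    & betti L (d - 2) = betti all_cells (d - 2)].

Definition cotree_index (d : int) (L : {set cell X}) : nat :=
  #|` fset_set (homology int all_cells L (d - 1)) |.

Definition delta (d : int) : nat :=
  \prod_(L : {set cell X} | `[< spanning_cotree d L >])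
    \prod_(T : {set cell X} | `[< spanning_tree d T >])
      (cotree_index d L * tree_torsion d T).

(* H_d(X; Z[1/m]) inside H_d(X; R) = Z_d(X; R), where d is the dimension of X *)
Definition fractional_lattice (d : int) (m : nat) : set 'cV[R]_(ncell X) :=
  [set q | cycles R all_cells no_cell d q /\
           forall a, exists (p : int) (n : nat), q a 0 = p%:~R / m%:R ^+ n].

End CellularChains.
Arguments bd {R} X A.
Arguments cycles {R X} A Y L k.
Arguments hclass {R X} A Y L k z.
Arguments delta {R} X d.

Section AverageCurrent.
Variables (R : realType) (X : cellular_complex R) (d : int).

Definition cells (k : int) := {a : cell X | (cdim a)%:Z == k}.

Definition params : Type := (cells (d - 1) -> R) * (cells d -> R).

Definition good (p : params) := injective p.1 \/ injective p.2.

Definition smooth (f : R -> R) := forall n t, derivable (derive1n n f) t 1.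

Definition smooth_params (g : R -> params) :=
  (forall j, smooth (fun t => (g t).1 j)) /\
  (forall a, smooth (fun t => (g t).2 a)).

(* the diagonal operator j |-> e^(s f_j) j on k-chains, and 0 on other degrees *)
Definition expop k (s : R) (f : cells k -> R) : 'M[R]_(ncell X) :=
  diag_mx (\row_a (if insub a is Some j then expR (s * f j) else 0)).

Variables (g : R -> params) (z0 : 'cV[int]_(ncell X)).

(* the matrix of bd^* is the transpose, the cells being orthonormal *)
Definition current (tau beta : R) (rho : R -> 'cV[R]_(ncell X)) (t : R) :
    'cV[R]_(ncell X) :=
  tau *: (expop (- beta) (g t).2 *m ((bd X R)^T *m
            (expop beta (g t).1 *m rho t))).

Definition periodic_solution (tau beta : R) (rho : R -> 'cV[R]_(ncell X)) :=
  [/\ forall t : R, is_derive t (1 : R) rho (- (bd X R *m current tau beta rho t)),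
      forall t, rho (t + 1) = rho t,
      forall t, cycles R all_cells no_cell (d - 1) (rho t)
    & forall t, hclass R all_cells no_cell (d - 1) (rho t) =
                hclass R all_cells no_cell (d - 1) (map_mx intr z0)].

(* meaningful when there is exactly one periodic solution *)
Definition avg_current (tau beta : R) : 'cV[R]_(ncell X) :=
  let rho := xget (fun=> 0) [set rho | periodic_solution tau beta rho] in
  \col_a (\int[lebesgue_measure]_(t in `[0, 1]) current tau beta rho t a 0).

Definition adiabatic_current (beta : R) : 'cV[R]_(ncell X) :=
  lim (avg_current tau beta @[tau --> +oo]).

End AverageCurrent.

(* Main.v *)
Require Import Defs.
From HB Require Import structures.
From mathcomp Require Import finmap.
From mathcomp Require Import all_boot all_order all_algebra.
From mathcomp Require Import all_classical all_reals all_analysis.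
From mathcomp Require Import ring lra zify.
Import Order.TTheory GRing.Theory Num.Theory.
Import numFieldNormedType.Exports.

Set Implicit Arguments.
Unset Strict Implicit.
Unset Printing Implicit Defensive.

Local Open Scope classical_set_scope.
Local Open Scope ring_scope.

(* The periodic solution exists because, after the change of variable
   y = e^(beta E / 2) rho and the addition of a term living on the orthogonal
   complement of the boundaries, the equation is y' = - A(t) y + f(t) with A
   coercive: such a system has a unique periodic solution, of size at most
   sup |f| / h, h being the coercivity constant.  As h grows like tau, rho
   converges uniformly to the Boltzmann distribution rho^B(t), the point of
   z0 + im B orthogonal to im B for the weights e^(beta E).  Here B is the
   boundary on d-chains.

   Let Psi(t) = 1 - (projection onto ker B orthogonal for the weights
   e^(beta W)) and let s be a section of B on its image.  The current at time t
   is - Psi s rho', so by parts its integral tends to - int Psi s (rho^B)'.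

   At low temperature both weighted projections are controlled in the same way.
   For any weights they are bounded by a common constant.  If the weights are
   e^(beta f) with f one-to-one, they are exponentially close to the projection
   along the coordinate subspace of the non-leading coordinates for the order
   of f; for ker B these coordinates form a spanning tree, for im B a spanning
   co-tree.  Where E is one-to-one, (rho^B)' is then exponentially small, and
   where W is one-to-one, Psi is exponentially close to a constant.  With K(t)
   the limit of Psi s if W(t) is one-to-one and 0 otherwise, the increments of
   - int Psi s (rho^B)' + K (rho^B - z0) over short intervals converge to
   lattice elements; by additivity so does the increment over a period, where
   the boundary terms cancel.

   Denominators: the torsion of H_(d-1)(T) and the group H_(d-1)(X, L) are
   killed by their orders. *)

(** * Projections along coordinate subspaces *)

(* [P] projects onto the column space of [M] along the span of the coordinate
   vectors indexed by [S]; the last clause says that the coordinates outside [S]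
   are exactly the leading ones for the order given by [k]. *)
Record leading_projection (F : fieldType) n m (M : 'M[F]_(n, m))
    (k : 'I_n -> nat) (S : {set 'I_n}) (P : 'M[F]_n) : Prop := {
  lp_image : exists C, P = M *m C;
  lp_id : P *m M = M;
  lp_coord0 : forall i j, j \in S -> P i j = 0;
  lp_coord1 : forall i j, i \notin S -> P i j = (i == j)%:R;
  lp_lead : forall a, a \notin S -> exists2 y : 'cV_m, (M *m y) a 0 = 1 &
    forall i, (M *m y) i 0 != 0 -> i = a \/ (k i < k a)%N }.

Section Echelon.
Variables (F : fieldType) (n m : nat) (M : 'M[F]_(n, m)) (J : {set 'I_n}).
Variable k : 'I_n -> nat.
Hypothesis MJ : forall i j, i \notin J -> M i j = 0.
Hypothesis kinj : {in J &, injective k}.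

Let lead a := exists2 y : 'cV[F]_m, (M *m y) a 0 = 1 &
  forall i, (M *m y) i 0 != 0 -> i = a \/ (k i < k a)%N.

Let S := [set a | `[< ~ lead a >]]%SET.

Let notinS a : a \notin S -> lead a.
Proof. by rewrite inE => /asboolPn/contrapT. Qed.

Let MyJ (y : 'cV[F]_m) i : (M *m y) i 0 != 0 -> i \in J.
Proof.
apply: contraR => iJ; rewrite mxE big1// => j _.
by rewrite MJ// mul0r.
Qed.

Let vanish (y : 'cV[F]_m) :
  (forall i, i \notin S -> (M *m y) i 0 = 0) -> M *m y = 0.
Proof.
move=> y0; apply/eqP/negPn/negP => /eqP My.
have [i0 i0n] : exists i, (M *m y) i 0 != 0.
  apply/not_existsP => h; apply: My; apply/matrixP => i j.
  by rewrite ord1 [RHS]mxE; apply/eqP/negPn/negP/h.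
have [a an amax] := @arg_maxnP _ i0 (fun i => (M *m y) i 0 != 0) k i0n.
have : lead a.
  exists (((M *m y) a 0)^-1 *: y); rewrite -scalemxAr mxE ?mulVf//.
  move=> i; rewrite mxE mulf_eq0 negb_or => /andP[_ in0].
  have := amax i in0; rewrite /= leq_eqVlt; case/orP=> [/eqP kia|]; last by right.
  by left; apply: kinj kia; [exact: MyJ in0|exact: MyJ an].
have [|aS] := boolP (a \in S); first by rewrite inE => /asboolP.
by rewrite y0 ?eqxx in an.
Qed.

Let D (x : 'cV[F]_n) :=
  exists y : 'cV[F]_m, forall i, i \notin S -> x i 0 = (M *m y) i 0.

Let D_lin a x y : D x -> D y -> D (a *: x + y).
Proof.
move=> [u hu] [v hv]; exists (a *: u + v) => i iS.
by rewrite mulmxDr -scalemxAr !mxE hu// hv// !mxE.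
Qed.

Let D0 : D 0.
Proof. by exists 0 => i _; rewrite mulmx0. Qed.

Let D_delta N a : (k a < N)%N -> D (delta_mx a 0).
Proof.
elim: N a => // N IH a kN.
have [aS|aS] := boolP (a \in S).
  exists 0 => i iS; rewrite mulmx0 !mxE andbT; case: eqP => // ia.
  by rewrite ia aS in iS.
have [y ya yi] := notinS aS.
rewrite (_ : delta_mx a 0 = 1 *: (delta_mx a 0 - M *m y) + M *m y); last first.
  by rewrite scale1r subrK.
apply: D_lin; last by exists y.
rewrite (matrix_sum_delta (_ - _)).
elim/big_ind : _ => //.
  by move=> x z Dx Dz; rewrite -[x]scale1r; exact: D_lin.
move=> i _; rewrite big_ord1.
rewrite [ord0]ord1; set c := (X in X *: _).
rewrite -[_ *: _]addr0; have [->|c0] := eqVneq c 0.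
  by rewrite scale0r addr0.
apply: D_lin D0.
have cE : c = (i == a)%:R - (M *m y) i 0 by rewrite /c [LHS]mxE [X in X + _ = _]mxE [X in _ + X = _]mxE andbT.
move: c0; rewrite cE; case: (eqVneq i a) => [->|ia]; first by rewrite ya subrr eqxx.
rewrite sub0r oppr_eq0 => /yi[/eqP|]; first by rewrite (negPf ia).
by move=> /leq_trans; move=> /(_ N) kia; apply: IH; exact: kia.
Qed.

Lemma leading_projectionP : exists S P, leading_projection M k S P.
Proof.
have /choice[y hy] : forall a, D (delta_mx a 0) by move=> a; exact: D_delta.
pose C := \matrix_(i < m, j < n) y j i 0.
have hC j i : (M *m C) i j = (M *m y j) i 0.
  by rewrite !mxE; apply: eq_bigr => l _; rewrite !mxE.
have P1 i j : i \notin S -> (M *m C) i j = (i == j)%:R.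
  by move=> iS; rewrite hC -hy// mxE andbT.
exists S, (M *m C); split => //.
- by exists C.
- apply/matrixP => i j; apply/eqP; rewrite -subr_eq0; apply/eqP.
  have : M *m ((C *m M - 1%:M) *m delta_mx j (0 : 'I_1)) = 0.
    apply: vanish => a aS.
    rewrite !mulmxA mulmxBr mulmx1 mulmxBl mxE [X in _ + X]mxE mulmxA.
    rewrite -!colE !mxE (bigD1 a)//= big1 ?addr0.
      by rewrite P1// eqxx mul1r subrr.
    by move=> l la; rewrite P1// eq_sym (negPf la) mul0r.
  move=> /matrixP/(_ i 0).
  by rewrite !mulmxA mulmxBr mulmx1 mulmxA -colE !mxE.
- move=> i j jS; rewrite hC vanish ?mxE//.
  move=> a aS; rewrite -hy// mxE andbT; case: eqP => // aj.
  by rewrite aj jS in aS.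
Qed.

End Echelon.

(** * Weighted orthogonal projections *)

Section MatrixNorm.
Variable R : realType.

Lemma mx_entry_le m n (A : 'M[R]_(m, n)) i j : `|A i j| <= `|A|.
Proof.
rewrite [leRHS]/Num.Def.normr/= mx_normrE.
exact: (le_bigmax _ (fun ij => `|A ij.1 ij.2|) (i, j)).
Qed.

Lemma mx_norm_le m n (A : 'M[R]_(m, n)) c :
  0 <= c -> (forall i j, `|A i j| <= c) -> `|A| <= c.
Proof.
move=> c0 Ac; rewrite [leLHS]/Num.Def.normr/= mx_normrE.
by apply: bigmax_le => // -[i j] _; exact: Ac.
Qed.

Lemma mulmx_norm m n p (A : 'M[R]_(m, n)) (B : 'M[R]_(n, p)) :
  `|A *m B| <= n%:R * `|A| * `|B|.
Proof.
apply: mx_norm_le => [|i j]; first by rewrite !mulr_ge0.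
rewrite mxE (le_trans (ler_norm_sum _ _ _))//.
apply: (@le_trans _ _ (\sum_(l < n) `|A| * `|B|)).
  by apply: ler_sum => l _; rewrite normrM ler_pM// mx_entry_le.
by rewrite sumr_const card_ord -[leLHS]mulr_natl mulrA.
Qed.

End MatrixNorm.

Section WeightedProjection.
Variable R : realType.

Definition dgmx n (w : 'I_n -> R) : 'M[R]_n := diag_mx (\row_i w i).

Lemma dgmx_tr n (w : 'I_n -> R) : (dgmx w)^T = dgmx w.
Proof. exact: tr_diag_mx. Qed.

Lemma dgmxEl n p (w : 'I_n -> R) (A : 'M[R]_(n, p)) i j :
  (dgmx w *m A) i j = w i * A i j.
Proof. by rewrite mul_diag_mx !mxE. Qed.

Lemma dgmxEr n p (w : 'I_n -> R) (A : 'M[R]_(p, n)) i j :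
  (A *m dgmx w) i j = A i j * w j.
Proof. by rewrite mul_mx_diag !mxE. Qed.

Definition wproj n m (M : 'M[R]_(n, m)) (w : 'I_n -> R) : 'M[R]_n :=
  M *m pinvmx (M^T *m dgmx w *m M) *m M^T *m dgmx w.

Variables (n m : nat) (M : 'M[R]_(n, m)).
Implicit Types w : 'I_n -> R.

Lemma weighted_gram_eq0 w p (B : 'M[R]_(n, p)) : (forall i, 0 < w i) ->
  B^T *m dgmx w *m B = 0 -> B = 0.
Proof.
move=> w0 /matrixP B0; apply/matrixP => i j; rewrite mxE.
have /eqP := B0 j j; rewrite !mxE.
under eq_bigr do rewrite dgmxEr mxE mulrAC.
rewrite psumr_eq0 => [/allP/(_ i)|l _]; last first.
  by rewrite mulr_ge0 ?(ltW (w0 _))// -expr2 sqr_ge0.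
by rewrite mem_index_enum => /(_ isT)/=; rewrite !mulf_eq0 (gt_eqF (w0 i)) orbF orbb => /eqP.
Qed.

Lemma wproj_image w : exists C, wproj M w = M *m C.
Proof. by rewrite /wproj; set p := pinvmx _; exists (p *m M^T *m dgmx w); rewrite !mulmxA. Qed.

Section Weight.
Variable w : 'I_n -> R.
Hypothesis w0 : forall i, 0 < w i.
Let G := M^T *m dgmx w *m M.

Let MG : M *m pinvmx G *m G = M.
Proof.
apply: mulmxKpV; rewrite submxE; apply/eqP.
apply: (@weighted_gram_eq0 w) => //.
rewrite trmx_mul -!mulmxA [M^T *m _]mulmxA (mulmxA (_ *m _) M) -/G.
by rewrite mulmx_coker mulmx0.
Qed.

Lemma wproj_id : wproj M w *m M = M.
Proof.
rewrite /wproj -/G -[RHS]MG; set p := pinvmx G.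
by rewrite -!mulmxA [M^T *m (_ *m _)]mulmxA.
Qed.

Lemma wproj_orth : M^T *m dgmx w *m (1%:M - wproj M w) = 0.
Proof.
have GT : G^T = G by rewrite /G !trmx_mul trmxK dgmx_tr mulmxA.
have GM : G *m (M *m pinvmx G)^T = M^T by rewrite -{1}GT -trmx_mul MG.
have GpG : G *m pinvmx G *m G = G by rewrite mulmxKpV.
rewrite mulmxBr mulmx1 /wproj -/G; move: GM GpG; set p := pinvmx G => GM GpG.
have -> : M^T *m dgmx w *m (M *m p *m M^T *m dgmx w) = G *m p *m M^T *m dgmx w.
  by rewrite /G !mulmxA.
by rewrite -{2}GM mulmxA GpG GM subrr.
Qed.

End Weight.

Lemma wproj_sub w w' : (forall i, 0 < w i) -> (forall i, 0 < w' i) ->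
  wproj M w' - wproj M w =
  wproj M w' *m dgmx (fun i => 1 - w i / w' i) *m (1%:M - wproj M w).
Proof.
move=> w0 w'0.
have -> : dgmx (fun i => 1 - w i / w' i) = 1%:M - dgmx (fun i => w i / w' i).
  by apply/matrixP => i j; rewrite !mxE; case: eqP => _; rewrite ?mulr1n// !mulr0n subr0.
rewrite [wproj M w' *m (1%:M - _)]mulmxBr mulmx1 mulmxBl.
have -> : wproj M w' *m dgmx (fun i => w i / w' i) =
    M *m pinvmx (M^T *m dgmx w' *m M) *m (M^T *m dgmx w).
  rewrite /wproj; move: (pinvmx _) => p; rewrite -!mulmxA; congr (_ *m (_ *m (_ *m _))).
  by apply/matrixP => i j; rewrite dgmxEl !mxE; case: eqP => _; rewrite ?mulr0n ?mulr0// !mulr1n mulrC divfK ?gt_eqF.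
move: (pinvmx _) => p.
have -> : M *m p *m (M^T *m dgmx w) *m (1%:M - wproj M w) = 0.
  by rewrite -(mulmxA (M *m p)) wproj_orth// mulmx0.
rewrite subr0 mulmxBr mulmx1; have [C ->] := wproj_image w.
by rewrite mulmxA wproj_id.
Qed.

End WeightedProjection.

Section UniformBound.
Variable R : realType.

Lemma lipschitz_continuous (V : normedModType R) (f : V -> R) (K : R) :
  (forall x y, `|f x - f y| <= K * `|x - y|) -> continuous f.
Proof.
move=> fK x; apply/cvgrPdist_le => e e0.
have K1 : 0 < `|K| + 1 by rewrite ltr_wpDl.
near=> y; rewrite (le_trans (fK _ _))//.
apply: (@le_trans _ _ ((`|K| + 1) * `|x - y|)).
  by rewrite ler_wpM2r// (le_trans (ler_norm K))// lerDl.
rewrite mulrC -ler_pdivlMr//; near: y.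
by apply: cvgr_dist_le => //; rewrite divr_gt0.
Unshelve. all: by end_near. Qed.

Variables (n m : nat) (M : 'M[R]_(n, m)).

(* [None] prescribes zero *)
Definition has_sign (o : option bool) : set R :=
  match o with
  | None => [set x | x = 0]
  | Some b => if b then [set x | 0 <= x] else [set x | x <= 0]
  end.

Definition sign_cone (s : {ffun 'I_n -> option bool}) : set 'rV[R]_n :=
  [set c | forall i, has_sign (s i) (c 0 i)].

Definition sign_pattern (c : 'rV[R]_n) : {ffun 'I_n -> option bool} :=
  [ffun i => if c 0 i == 0 then None else Some (0 < c 0 i)].

Lemma sign_patternP c : sign_cone (sign_pattern c) c.
Proof.
by move=> i; rewrite ffunE; case: eqVneq => // _; case: ltP => // /ltW.
Qed.

Lemma closed_sign_cone s : closed (sign_cone s).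
Proof.
have -> : sign_cone s = \bigcap_(i in setT) [set c : 'rV[R]_n | has_sign (s i) (c 0 i)].
  by apply/seteqP; split => [c h i _|c h i]; [exact: h|exact: (h i)].
apply: closed_bigI => i _; have ci := @coord_continuous R 1 n 0 i.
apply: (@preimage_closed _ _ _ (has_sign (s i)) (in1W ci)).
by case: (s i) => [[]|]; [exact: closed_ge|exact: closed_le|exact: closed_eq].
Qed.

Lemma sign_coneZ s a c : 0 <= a -> sign_cone s c -> sign_cone s (a *: c).
Proof.
move=> a0 sc i; have := sc i; case: (s i) => [[]|] /=; rewrite mxE.
- exact: mulr_ge0.
- exact: mulr_ge0_le0.
- by move=> ->; rewrite mulr0.
Qed.

Lemma sign_cone_dichotomy (Q : 'M[R]_n) s :
  (exists2 C, 0 <= C & forall c, sign_cone s c -> `|c| <= C * `|c *m Q|) \/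
  (exists c, [/\ sign_cone s c, c != 0 & c *m Q = 0]).
Proof.
pose A := [set c | sign_cone s c /\ `|c| = 1].
have Ac : compact A.
  apply: bounded_closed_compact.
    by exists 1; split => // x x1 c [_ c1] /=; rewrite c1; exact: ltW.
  apply: closedI; first exact: closed_sign_cone.
  apply: (@preimage_closed _ _ (fun c : 'rV[R]_n => `|c|) [set x | x = 1]).
    by move=> x _; exact: norm_continuous.
  exact: closed_eq.
have nz c : c != 0 -> sign_cone s c -> A (`|c|^-1 *: c).
  move=> c0 sc; split; first by apply: sign_coneZ => //; rewrite invr_ge0.
  by rewrite normrZ normfV normr_id mulVf// normr_eq0.
have [A0|A0] := pselect (A !=set0); last first.
  left; exists 0 => // c sc; rewrite mul0r normr_le0.
  by apply/negPn/negP => c0; apply: A0; eexists; exact: nz sc.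
have cont : {within A, continuous (fun c : 'rV[R]_n => `|c *m Q|)}.
  apply: continuous_subspaceT; apply: (@lipschitz_continuous _ _ (n%:R * `|Q|)).
  move=> x y; rewrite (le_trans (ler_dist_dist _ _))//.
  by rewrite -mulmxBl (le_trans (mulmx_norm _ _))// mulrAC.
have [c] := EVT_min_rV A0 Ac cont.
rewrite inE => -[sc c1] cmin.
have [cQ0|cQ0] := eqVneq (c *m Q) 0.
  by right; exists c; split => //; rewrite -normr_eq0 c1 oner_eq0.
have cQ : 0 < `|c *m Q| by rewrite normr_gt0.
left; exists (`|c *m Q|^-1); first by rewrite invr_ge0.
move=> d sd; have [->|d0] := eqVneq d 0.
  by rewrite normr0 mulr_ge0// invr_ge0.
have := cmin (`|d|^-1 *: d); rewrite inE => /(_ (nz _ d0 sd)).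
rewrite -scalemxAl normrZ normfV normr_id.
by rewrite ler_pdivlMl ?normr_gt0// mulrC -ler_pdivlMl.
Qed.

(* If [c] is w-orthogonal to the column space [U] of [M], no nonzero element
   of [U] has the sign pattern of [c]; so compactness bounds [c] by its class
   modulo [U], uniformly in the weights. *)
Lemma wproj_bounded : exists2 C, 0 <= C &
  forall w, (forall i, 0 < w i) -> `|1%:M - wproj M w| <= C.
Proof.
pose Q := cokermx M^T.
have /choice[f hf] : forall s, exists C, 0 <= C /\
    ((forall c, sign_cone s c -> `|c| <= C * `|c *m Q|) \/
    (exists c, [/\ sign_cone s c, c != 0 & c *m Q = 0])).
  move=> s; have [[C C0 h]|h] := sign_cone_dichotomy Q s.
    by exists C; split => //; left.
  by exists 0; split => //; right.
pose C := \sum_s f s.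
have C0 : 0 <= C by apply: sumr_ge0 => s _; have [] := hf s.
exists (C * (n%:R * `|Q|)); first by rewrite !mulr_ge0.
move=> w w0; apply: mx_norm_le => [|i j]; first by rewrite !mulr_ge0.
pose c : 'rV[R]_n := row j (1%:M - wproj M w)^T.
rewrite (_ : (1%:M - wproj M w) i j = c 0 i); last by rewrite !mxE.
apply: le_trans (mx_entry_le _ _ _) _.
have cQ : c *m Q = row j Q.
  rewrite /c -row_mul linearB/= trmx1 mulmxBl mul1mx.
  have [D ->] := wproj_image M w.
  by rewrite trmx_mul -mulmxA mulmx_coker mulmx0 subr0.
have [_ [h|[u [su u0 uQ]]]] := hf (sign_pattern c); last first.
  exfalso; move/eqP: u0; apply.
  have /submxP[y uE] : (u <= M^T)%MS by rewrite submxE uQ.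
  have : u *m dgmx w *m c^T = 0.
    have := wproj_orth M w0 => /(congr1 (mulmx y)).
    rewrite !mulmxA -uE mulmx0 => /(congr1 (col j)).
    by rewrite colE -mulmxA -colE [RHS]raddf0 /c tr_row trmxK.
  move=> /matrixP/(_ 0 0); rewrite !mxE.
  under eq_bigr do rewrite dgmxEr mxE.
  move=> /eqP; have ge0 l : 0 <= u 0 l * w l * c 0 l.
    have := su l; rewrite ffunE; case: eqVneq => [->|]; first by rewrite mulr0.
    rewrite neq_lt => /orP[c0|c0]; rewrite ?c0 ?(lt_gtF c0) => ul.
      by rewrite mulr_le0// ?(ltW c0)// mulr_le0_ge0// ltW.
    by rewrite !mulr_ge0// ltW.
  rewrite psumr_eq0// => /allP h; apply/rowP => l; rewrite mxE.
  have := h l; rewrite mem_index_enum => /(_ isT) /=.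
  rewrite !mulf_eq0 (gt_eqF (w0 l)) orbF => /orP[/eqP//|cl0].
  by have := su l; rewrite ffunE cl0.
apply: le_trans (h _ (sign_patternP c)) _; rewrite cQ ler_pM//.
- by have [] := hf (sign_pattern c).
- rewrite /C (bigD1 (sign_pattern c))//= lerDl.
  by apply: sumr_ge0 => s _; have [] := hf s.
- apply: mx_norm_le => [|a b]; first by rewrite mulr_ge0.
  rewrite mxE (le_trans (mx_entry_le Q _ _))// ler_peMl// ler1n.
  exact: leq_ltn_trans (ltn_ord j).
Qed.

End UniformBound.

Lemma cvg_sumr (R : numFieldType) (V : normedModType R) (I T : Type)
    (r : seq I) (Q : pred I) (F : set_system T) (f : I -> T -> V) (l : I -> V) :
  Filter F -> (forall i, Q i -> f i x @[x --> F] --> l i) ->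
  \sum_(i <- r | Q i) f i x @[x --> F] --> \sum_(i <- r | Q i) l i.
Proof.
move=> FF fl; elim: r => [|i r IH].
  by rewrite big_nil; under eq_cvg do rewrite big_nil; exact: cvg_cst.
rewrite big_cons; under eq_cvg do rewrite big_cons.
by case: ifPn => // Qi; apply: cvgD => //; exact: fl.
Qed.

Section Asymptotics.
Variables (R : realType) (n m : nat) (M : 'M[R]_(n, m)).

Lemma wproj_leading (J S : {set 'I_n}) (k : 'I_n -> nat) (P : 'M[R]_n) :
  (forall i j, i \notin J -> M i j = 0) -> leading_projection M k S P ->
  exists2 C, 0 <= C & forall w eta, (forall i, 0 < w i) -> 0 <= eta ->
    {in J &, forall i a, (k i < k a)%N -> w i <= eta * w a} ->
    `|wproj M w - P| <= C * eta.
Proof.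
move=> MJ [_ PM P0 P1 lead].
have [K K0 wK] := wproj_bounded M.
have /choice[y hy] : forall a, exists y : 'cV[R]_m, a \notin S ->
    (M *m y) a 0 = 1 /\ forall i, (M *m y) i 0 != 0 -> i = a \/ (k i < k a)%N.
  move=> a; have [aS|/lead[y ya yi]] := boolP (a \in S); last by exists y.
  by exists 0.
have MyJ (z : 'cV[R]_m) i : (M *m z) i 0 != 0 -> i \in J.
  by apply: contraR => iJ; rewrite mxE big1// => j _; rewrite MJ// mul0r.
pose Y := \sum_a `|M *m y a|.
have Y0 : 0 <= Y by exact: sumr_ge0.
exists (n%:R * `|P| * (n%:R * (Y * K))); first by rewrite !mulr_ge0.
move=> w eta w0 eta0 gap.
have -> : wproj M w - P = - (P *m (1%:M - wproj M w)).
  by rewrite mulmxBr mulmx1 opprB; have [C ->] := wproj_image M w; rewrite mulmxA PM.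
have [c cE] : exists c, c = 1%:M - wproj M w by exists (1%:M - wproj M w).
rewrite -cE normrN.
have cK i j : `|c i j| <= K by rewrite (le_trans (mx_entry_le _ _ _))// cE wK.
have cS a j : a \notin S -> `|c a j| <= n%:R * (Y * K) * eta.
  move=> aS; have [ya yi] := hy _ aS.
  have : (M *m y a)^T *m dgmx w *m c = 0.
    by rewrite trmx_mul -!mulmxA [M^T *m _]mulmxA cE wproj_orth// mulmx0.
  move=> /matrixP/(_ 0 j); rewrite !mxE (bigD1 a)//= dgmxEr mxE ya mul1r.
  move=> /eqP; rewrite addr_eq0 => /eqP/(congr1 Num.norm).
  rewrite normrN normrM gtr0_norm// => wc.
  rewrite -(ler_pM2l (w0 a)) wc (le_trans (ler_norm_sum _ _ _))//.
  apply: (@le_trans _ _ (\sum_(i < n | i != a) w a * (Y * K * eta))).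
    apply: ler_sum => i ia; rewrite dgmxEr mxE.
    have [->|My] := eqVneq ((M *m y a) i 0) 0.
      rewrite !mul0r normr0 !mulr_ge0//; exact: ltW.
    have [/eqP|kia] := yi _ My; first by rewrite (negPf ia).
    have wi : w i <= eta * w a.
      by apply: gap => //; [exact: MyJ My|apply: (MyJ (y a)); rewrite ya oner_neq0].
    rewrite !normrM (gtr0_norm (w0 i)).
    rewrite (_ : w a * _ = Y * (eta * w a) * K); last by ring.
    rewrite ler_pM ?mulr_ge0 ?(ltW (w0 _))// ler_pM ?(ltW (w0 _))//.
    rewrite (le_trans (mx_entry_le _ _ _))// /Y (bigD1 a)//= lerDl.
    exact: sumr_ge0.
  rewrite sumr_const -[leLHS]mulr_natl.
  rewrite [leRHS](_ : _ = n%:R * (w a * (Y * K * eta))); last by ring.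
  rewrite ler_wpM2r ?mulr_ge0 ?(ltW (w0 _))// ler_nat.
  by rewrite (leq_trans (max_card _))// card_ord.
apply: mx_norm_le => [|i j]; first by rewrite !mulr_ge0.
rewrite mxE (le_trans (ler_norm_sum _ _ _))//.
apply: (@le_trans _ _ (\sum_(a < n) `|P| * (n%:R * (Y * K) * eta))).
  apply: ler_sum => a _; rewrite normrM; have [aS|aS] := boolP (a \in S).
    by rewrite P0// normr0 mul0r !mulr_ge0.
  by rewrite ler_pM// ?mx_entry_le// cS.
by rewrite sumr_const card_ord -[leLHS]mulr_natl !mulrA.
Qed.

Lemma dgmx_exp_gt0 (beta : R) (f : 'I_n -> R) i : 0 < expR (beta * f i).
Proof. exact: expR_gt0. Qed.

Variables (beta : R) (f df : R -> 'I_n -> R).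
Hypothesis f_df : forall i t, is_derive t (1 : R) (f^~ i) (df t i).
Let P t := wproj M (fun i => expR (beta * f t i)).

Let D t s i := 1 - expR (beta * f t i) / expR (beta * f s i).

Let D_derive t i : is_derive t (1 : R) (D t ^~ i) (beta * df t i).
Proof.
have -> : D t ^~ i = fun s => 1 - expR (beta * f t i) * expR ((- beta) * f s i).
  by apply/funext => s; rewrite /D mulNr expRN.
have h1 : is_derive t (1 : R) (fun s => - beta * f s i) (- beta * df t i).
  exact: (@is_deriveZ _ _ _ _ _ _ _ _ (f_df i t)).
have h2 := @is_derive1_comp _ expR _ t _ _ (is_derive_expR _) h1.
have h3 := @is_deriveZ _ _ _ _ (expR (beta * f t i)) _ _ _ h2.
have h4 := @is_deriveB _ _ _ _ _ t 1 _ _ (is_derive_cst (1 : R) t 1) h3.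
apply: (@is_derive_eq _ _ _ _ _ _ _ _ h4).
rewrite /GRing.scale /= sub0r mulrA -expRD mulNr subrr expR0.
by rewrite mul1r mulNr opprK.
Qed.

Let P_sub t s i j : P s i j - P t i j =
  \sum_a \sum_b P s i b * dgmx (D t s) b a * (1%:M - P t) a j.
Proof.
have := wproj_sub M (dgmx_exp_gt0 beta (f t)) (dgmx_exp_gt0 beta (f s)).
move=> /matrixP/(_ i j); rewrite mxE [X in _ + X]mxE => ->.
by rewrite mxE; apply: eq_bigr => a _; rewrite mxE mulr_suml.
Qed.

Let P_sub' t s i j : P s i j - P t i j =
  \sum_a P s i a * D t s a * (1%:M - P t) a j.
Proof.
rewrite P_sub; apply: eq_bigr => a _; rewrite -mulr_suml; congr (_ * _).
rewrite (bigD1 a)//= big1 ?addr0; first by rewrite !mxE eqxx mulr1n.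
by move=> b ba; rewrite !mxE (negPf ba) mulr0n mulr0.
Qed.

Let P_cont t i j : {for t, continuous (fun s => P s i j)}.
Proof.
have [K K0 wK] := wproj_bounded M.
have PK s : `|P s| <= 1 + K.
  rewrite (_ : P s = 1%:M - (1%:M - P s)); last by rewrite opprB addrC subrK.
  rewrite (le_trans (ler_normB _ _))// lerD ?wK ?dgmx_exp_gt0//.
    by apply: mx_norm_le => // a b; rewrite mxE; case: eqP; rewrite ?normr1 ?normr0.
  by move=> a; exact: dgmx_exp_gt0.
apply/subr_cvg0.
have h0 : \sum_a (1 + K) * `|D t t a| * `|(1%:M - P t) a j| = 0.
  by rewrite big1// => a _; rewrite /D divff ?subrr ?normr0 ?mulr0 ?mul0r// gt_eqF ?expR_gt0.
have h : \sum_a (1 + K) * `|D t s a| * `|(1%:M - P t) a j| @[s --> t] --> (0 : R).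
  rewrite -[X in _ --> X]h0.
  apply: cvg_sumr => a _; apply: cvgMr_tmp; apply: cvgMl_tmp; apply: cvg_norm.
  suff : {for t, continuous (D t ^~ a)} by [].
  apply: differentiable_continuous; apply/derivable1_diffP.
  exact: (@ex_derive _ _ _ _ _ _ _ (D_derive t a)).
apply/cvgr0Pnorm_le => e e0.
have /cvgr0Pnorm_le/(_ _ e0) := h; apply: filterS => s; apply: le_trans.
rewrite P_sub' (le_trans (ler_norm_sum _ _ _))// (le_trans _ (ler_norm _))//.
apply: ler_sum => a _; rewrite !normrM ler_wpM2r// ler_wpM2r//.
by rewrite (le_trans (mx_entry_le _ _ _)).
Qed.

Lemma wproj_exp_derive t i j :
  is_derive t (1 : R) (fun s => P s i j)
    (beta * (P t *m dgmx (df t) *m (1%:M - P t)) i j).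
Proof.
have /choice[g hg] a := (is_derive1_caratheodory _ _ _).1 (D_derive t a).
apply/is_derive1_caratheodory.
exists (fun s => \sum_a P s i a * g a s * (1%:M - P t) a j); split.
- move=> s; rewrite P_sub' mulr_suml; apply: eq_bigr => a _.
  have [gE _ _] := hg a; rewrite -(subr0 (D t s a)).
  have Dt0 : D t t a = 0 by rewrite /D divff ?subrr// gt_eqF ?expR_gt0.
  by rewrite -[X in _ - X]Dt0 gE; ring.
- rewrite /prop_for /continuous_at /=; apply: cvg_sumr => a _.
  apply: cvgMr_tmp; apply: cvgM; first exact: P_cont.
  by have [_ ? _] := hg a.
- rewrite mxE mulr_sumr; apply: eq_bigr => a _.
  by have [_ _ ->] := hg a; rewrite dgmxEr; ring.
Qed.

End Asymptotics.

(** * One-variable calculus *)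

Section RealDerivatives.
Variable R : realType.
Implicit Types (f g : R -> R) (t a b : R).

Lemma is_derive_add f g t a b : is_derive t (1 : R) f a -> is_derive t (1 : R) g b ->
  is_derive t (1 : R) (fun s => f s + g s) (a + b).
Proof. by move=> fa gb; exact: is_deriveD. Qed.

Lemma is_derive_opp f t a : is_derive t (1 : R) f a ->
  is_derive t (1 : R) (fun s => - f s) (- a).
Proof. by move=> fa; exact: is_deriveN. Qed.

Lemma is_derive_sub f g t a b : is_derive t (1 : R) f a -> is_derive t (1 : R) g b ->
  is_derive t (1 : R) (fun s => f s - g s) (a - b).
Proof. by move=> fa gb; exact: is_deriveB. Qed.

Lemma is_derive_mul f g t a b : is_derive t (1 : R) f a -> is_derive t (1 : R) g b ->
  is_derive t (1 : R) (fun s => f s * g s) (f t * b + a * g t).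
Proof.
move=> fa gb; have h := is_deriveM fa gb; apply: is_derive_eq h _.
by rewrite /GRing.scale /= (mulrC (g t)).
Qed.

Lemma is_derive_mull f (c : R) t a : is_derive t (1 : R) f a ->
  is_derive t (1 : R) (fun s => c * f s) (c * a).
Proof. by move=> fa; exact: is_deriveZ. Qed.

Lemma is_derive_bigsum (I : Type) (r : seq I) (h : I -> R -> R) (dh : I -> R) t :
  (forall i, is_derive t (1 : R) (h i) (dh i)) ->
  is_derive t (1 : R) (fun s => \sum_(i <- r) h i s) (\sum_(i <- r) dh i).
Proof.
move=> hd; elim: r => [|i r IH].
  rewrite big_nil (_ : (fun s => _) = cst 0); first exact: is_derive_cst.
  by apply/funext => s; rewrite big_nil.
rewrite big_cons (_ : (fun s => _) = fun s => h i s + \sum_(j <- r) h j s).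
  exact: is_derive_add.
by apply/funext => s; rewrite big_cons.
Qed.

Lemma is_derive_expRM (c : R) f t a : is_derive t (1 : R) f a ->
  is_derive t (1 : R) (fun s => expR (c * f s)) (c * a * expR (c * f t)).
Proof.
move=> fa; rewrite mulrC.
exact: (@is_derive1_comp _ expR _ t _ _ (is_derive_expR _) (is_derive_mull c fa)).
Qed.

Lemma is_derive_continuous f t a : is_derive t (1 : R) f a -> {for t, continuous f}.
Proof.
move=> fa; apply: differentiable_continuous; apply/derivable1_diffP.
exact: (@ex_derive _ _ _ _ _ _ _ fa).
Qed.

Lemma is_derive_mean f (df : R -> R) a b : a <= b ->
  (forall t, is_derive t (1 : R) f (df t)) ->
  exists2 c, a <= c <= b & f b - f a = df c * (b - a).
Proof.
move=> ab fdf; have [|c] := @MVT_segment R f df a b ab (fun x _ => fdf x).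
  by apply: continuous_subspaceT => x; exact: is_derive_continuous (fdf x).
by rewrite in_itv/= => cab ->; exists c.
Qed.

Lemma is_derive_lipschitz f (df : R -> R) a b c : a <= b ->
  (forall t, is_derive t (1 : R) f (df t)) ->
  (forall t, a <= t <= b -> `|df t| <= c) -> `|f b - f a| <= c * (b - a).
Proof.
move=> ab fdf dfc; have [t /dfc tc ->] := is_derive_mean ab fdf.
by rewrite normrM (ger0_norm (_ : 0 <= b - a)) ?subr_ge0// ler_wpM2r// subr_ge0.
Qed.

Lemma is_derive_homo f (df : R -> R) a b : a <= b ->
  (forall t, is_derive t (1 : R) f (df t)) ->
  (forall t, df t <= 0) -> f b <= f a.
Proof.
move=> ab fdf df0; rewrite -subr_le0; have [t _ ->] := is_derive_mean ab fdf.
by rewrite mulr_le0_ge0// subr_ge0.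
Qed.

Lemma primitive_from0 g : continuous g -> (forall t, t <= 0 -> g t = 0) ->
  exists G : R -> R, forall t, is_derive t (1 : R) G (g t).
Proof.
move=> cg g0; pose G t : R := \int[lebesgue_measure]_(s in `[-1, t]) g s.
exists G => t; have [t1|t1] := ltP (-1) t.
  have [||||dG <-] := @continuous_FTC1_closed R g (-1) t (t + 1).
  - by rewrite ltrDl.
  - apply: continuous_compact_integrable; first exact: segment_compact.
    exact: continuous_subspaceT.
  - exact: t1.
  - exact: cg.
  by rewrite derive1E; apply: derivableP.
have t0 : t < 0 by rewrite (le_lt_trans t1)// oppr_lt0.
rewrite g0 ?ltW//; apply: (@near_eq_is_derive _ _ _ (cst 0)); rewrite ?oner_neq0//.
near=> s; rewrite /G (@eq_Rintegral _ _ _ _ _ (cst 0)); first by rewrite Rintegral_cst//= mul0r.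
move=> x; rewrite inE /= in_itv/= => /andP[_ xs]; apply: g0.
rewrite (le_trans xs)// ltW//; near: s; exact: lt_nbhsl.
Unshelve. all: by end_near. Qed.

Lemma continuous_primitive g : continuous g ->
  exists G : R -> R, forall t, is_derive t (1 : R) G (g t).
Proof.
move=> cg.
have cmax : continuous (fun t : R => Num.max t 0).
  by move=> t; apply: continuous_max; [exact: cvg_id|exact: cvg_cst].
have [||G1 G1d] := @primitive_from0 (fun t => g (Num.max t 0) - g 0).
- move=> t; apply: continuousB; last exact: cvg_cst.
  by apply: continuous_comp; [exact: cmax|exact: cg].
- by move=> t t0; rewrite max_r// subrr.
have [||G2 G2d] := @primitive_from0 (fun t => g (- Num.max t 0) - g 0).
- move=> t; apply: continuousB; last exact: cvg_cst.
  apply: continuous_comp; last exact: cg.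
  by apply: continuousN; exact: cmax.
- by move=> t t0; rewrite max_r// oppr0 subrr.
exists (fun t => G1 t - G2 (- t) + g 0 * t) => t.
have dN : is_derive t (1 : R) (fun s => G2 (- s)) ((g (- Num.max (- t) 0) - g 0) * -1).
  by apply: (@is_derive1_comp _ G2 -%R); exact: is_deriveNid.
have h := is_derive_add (is_derive_sub (G1d t) dN)
  (is_derive_mull (g 0) (is_derive_id t (1 : R))).
apply: is_derive_eq h _; rewrite mulrN1 opprK mulr1.
have /orP[t0|t0] := le_total 0 t.
  rewrite (max_l t0) (max_r (_ : - t <= 0)) ?oppr_le0// oppr0; ring.
rewrite (max_r t0) (max_l (_ : 0 <= - t)) ?oppr_ge0// opprK; ring.
Qed.

Lemma integral01_primitive g G : continuous g ->
  (forall t, is_derive t (1 : R) G (g t)) ->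
  \int[lebesgue_measure]_(t in `[0, 1]) g t = G 1 - G 0.
Proof.
move=> cg dG; rewrite /Rintegral (@continuous_FTC2 _ g G)//.
- exact: continuous_subspaceT.
- split.
  + by move=> x _; exact: (@ex_derive _ _ _ _ _ _ _ (dG x)).
  + exact/cvg_at_right_filter/is_derive_continuous.
  + exact/cvg_at_left_filter/is_derive_continuous.
- by move=> x _; rewrite derive1E; exact: (@derive_val _ _ _ _ _ _ _ (dG x)).
Qed.

Lemma periodic_le (g dg : R -> R) k c : 0 < k ->
  (forall t, g (t + 1) = g t) -> (forall t, is_derive t (1 : R) g (dg t)) ->
  (forall t, dg t <= - k * g t + c) -> forall t, g t <= c / k.
Proof.
move=> k0 gper gd gle t.
pose h s := expR (k * s) * (g s - c / k).
have hd s := is_derive_mul (is_derive_expRM k (is_derive_id s (1 : R)))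
  (is_derive_sub (gd s) (is_derive_cst (c / k) s (1 : R))).
have : h (t + 1) <= h t.
  apply: is_derive_homo hd _; first by rewrite lerDl.
  move=> s /=; rewrite (_ : _ + _ = expR (k * s) * (dg s - (- k * g s + c))).
    by rewrite pmulr_rle0 ?expR_gt0// subr_le0.
  by field; rewrite gt_eqF.
rewrite /h gper [k * (_ + _)]mulrDr mulr1 expRD -mulrA ler_pM2l ?expR_gt0//.
rewrite -subr_le0 -{2}[g t - _]mul1r -mulrBl pmulr_rle0 ?subr_le0//.
by rewrite subr_gt0 expR_gt1.
Qed.

Lemma periodic_int g : (forall t, g (t + 1) = g t) ->
  forall t (n : int), g (t + n%:~R) = g t.
Proof.
move=> gper; have gn t (n : nat) : g (t + n%:R) = g t.
  by elim: n t => [|n IH] t; rewrite ?addr0// -natr1 addrA gper IH.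
move=> t [n|n]; first exact: gn.
by rewrite NegzE mulrNz -(gn _ n.+1) subrK.
Qed.

Lemma periodic_bounded g : continuous g -> (forall t, g (t + 1) = g t) ->
  exists2 c, 0 <= c & forall t, `|g t| <= c.
Proof.
move=> cg gper.
have [|c _ gc] := @EVT_max R (fun t => `|g t|) 0 1 ler01.
  by apply: continuous_subspaceT => t; apply: continuous_comp; [exact: cg|exact: norm_continuous].
exists `|g c| => // t; rewrite -(periodic_int gper t (- Num.floor t)).
apply: gc; rewrite in_itv/= mulrNz subr_ge0 ge_floor/= lerBlDr addrC.
by rewrite -[1]/(1%:~R) -intrD ltW// floorD1_gt.
Qed.

End RealDerivatives.

(** * Vector-valued functions *)

Section Dot.
Variables (R : realType) (n : nat).
Implicit Types x y : 'cV[R]_n.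

Definition dot x y : R := \sum_i x i 0 * y i 0.

Lemma dotC x y : dot x y = dot y x.
Proof. by apply: eq_bigr => i _; rewrite mulrC. Qed.

Lemma dotDr x y z : dot x (y + z) = dot x y + dot x z.
Proof. by rewrite -big_split; apply: eq_bigr => i _; rewrite mxE mulrDr. Qed.

Lemma dotZr a x y : dot x (a *: y) = a * dot x y.
Proof. by rewrite mulr_sumr; apply: eq_bigr => i _; rewrite mxE mulrCA. Qed.

Lemma dotNr x y : dot x (- y) = - dot x y.
Proof. by rewrite -scaleN1r dotZr mulN1r. Qed.

Lemma dotBr x y z : dot x (y - z) = dot x y - dot x z.
Proof. by rewrite dotDr dotNr. Qed.

Lemma dotDl x y z : dot (x + y) z = dot x z + dot y z.
Proof. by rewrite dotC dotDr !(dotC z). Qed.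

Lemma dotZl a x y : dot (a *: x) y = a * dot x y.
Proof. by rewrite dotC dotZr dotC. Qed.

Lemma dotNl x y : dot (- x) y = - dot x y.
Proof. by rewrite dotC dotNr dotC. Qed.

Lemma dotBl x y z : dot (x - y) z = dot x z - dot y z.
Proof. by rewrite dotDl dotNl. Qed.

Lemma dot_ge0 x : 0 <= dot x x.
Proof. by apply: sumr_ge0 => i _; rewrite -expr2 sqr_ge0. Qed.

Lemma dot_coord x i : x i 0 ^+ 2 <= dot x x.
Proof.
rewrite /dot (bigD1 i)//= -expr2 lerDl.
by apply: sumr_ge0 => j _; rewrite -expr2 sqr_ge0.
Qed.

Lemma dot_le_norm x : dot x x <= n%:R * `|x| ^+ 2.
Proof.
apply: (@le_trans _ _ (\sum_(i < n) `|x| ^+ 2)).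
  apply: ler_sum => i _; rewrite -expr2 -real_normK ?num_real//.
  by rewrite lerXn2r ?nnegrE// mx_entry_le.
by rewrite sumr_const card_ord -[leLHS]mulr_natl.
Qed.

Lemma norm_le_dot x c : 0 <= c -> dot x x <= c ^+ 2 -> `|x| <= c.
Proof.
move=> c0 xc; apply: mx_norm_le => // i j; rewrite ord1.
rewrite -(ler_pXn2r (_ : 0 < 2)%N) ?nnegrE//.
by rewrite real_normK ?num_real// (le_trans (dot_coord _ _)).
Qed.

Lemma norm_sq_le_dot x : `|x| ^+ 2 <= dot x x.
Proof.
have h : `|x| <= Num.sqrt (dot x x).
  by apply: norm_le_dot; rewrite ?sqrtr_ge0// sqr_sqrtr// dot_ge0.
by rewrite -[leRHS]sqr_sqrtr ?dot_ge0// lerXn2r ?nnegrE// sqrtr_ge0.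
Qed.

Lemma dot_amgm k x y : 0 < k -> 2 * dot x y <= k * dot x x + dot y y / k.
Proof.
move=> k0; have := dot_ge0 (k *: x - y).
rewrite !(dotBl, dotBr, dotZl, dotZr) (dotC y x) => h.
rewrite -subr_ge0 (_ : _ - _ = (k * (k * dot x x) - k * dot x y - (k * dot x y - dot y y)) / k).
  by rewrite divr_ge0// ltW.
by field; rewrite gt_eqF.
Qed.

End Dot.

Lemma dot_mull (R : realType) n m (A : 'M[R]_(n, m)) (x : 'cV[R]_m) (y : 'cV[R]_n) :
  dot (A *m x) y = dot x (A^T *m y).
Proof.
rewrite /dot.
under eq_bigr do rewrite mxE mulr_suml.
rewrite exchange_big/=; apply: eq_bigr => j _.
by rewrite mxE mulr_sumr; apply: eq_bigr => i _; rewrite mxE; ring.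
Qed.

Lemma dot_mulmx_le (R : realType) n m (A : 'M[R]_(n, m)) (x : 'cV[R]_m) :
  dot (A *m x) (A *m x) <= n%:R * (m%:R * `|A|) ^+ 2 * dot x x.
Proof.
rewrite (le_trans (dot_le_norm _))// -mulrA ler_wpM2l//.
rewrite (le_trans (_ : _ <= (m%:R * `|A| * `|x|) ^+ 2))//.
  by rewrite lerXn2r ?nnegrE ?mulr_ge0// mulmx_norm.
by rewrite exprMn ler_wpM2l ?sqr_ge0// norm_sq_le_dot.
Qed.

Definition vder (R : realType) m n (f : R -> 'M[R]_(m, n)) (t : R) (d : 'M[R]_(m, n)) :=
  forall i j, is_derive t (1 : R) (fun s => f s i j) (d i j).

Lemma vderP (R : realType) m n (f : R -> 'M[R]_(m, n)) (t : R) (d : 'M[R]_(m, n)) :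
  vder f t d <-> is_derive t (1 : R) f d.
Proof.
split=> [fd|[df fd] i j].
  have df : derivable f t 1.
    by apply/derivable_mxP => i j; exact: (@ex_derive _ _ _ _ _ _ _ (fd i j)).
  apply: DeriveDef => //; rewrite derive_mx//; apply/matrixP => i j.
  by rewrite mxE; exact: (@derive_val _ _ _ _ _ _ _ (fd i j)).
have dfij : derivable (fun s => f s i j) t 1 by move/derivable_mxP : df; exact.
by apply: DeriveDef => //; rewrite -fd derive_mx// mxE.
Qed.

Lemma vder_add (R : realType) m n (f g : R -> 'M[R]_(m, n)) t d e :
  vder f t d -> vder g t e -> vder (fun s => f s + g s) t (d + e).
Proof.
move=> fd ge i j; rewrite mxE.
under [fun s => _]eq_fun do rewrite mxE.
exact: is_derive_add.
Qed.

Lemma vder_opp (R : realType) m n (f : R -> 'M[R]_(m, n)) t d :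
  vder f t d -> vder (fun s => - f s) t (- d).
Proof.
move=> fd i j; rewrite mxE.
under [fun s => _]eq_fun do rewrite mxE.
exact: is_derive_opp.
Qed.

Lemma vder_sub (R : realType) m n (f g : R -> 'M[R]_(m, n)) t d e :
  vder f t d -> vder g t e -> vder (fun s => f s - g s) t (d - e).
Proof. by move=> fd ge; apply: vder_add => //; exact: vder_opp. Qed.

Lemma vder_cst (R : realType) m n (c : 'M[R]_(m, n)) (t : R) : vder (fun=> c) t 0.
Proof. by move=> i j; rewrite mxE; exact: is_derive_cst. Qed.

Lemma vder_mul (R : realType) m n p (f : R -> 'M[R]_(m, n)) (g : R -> 'M[R]_(n, p)) t d e :
  vder f t d -> vder g t e ->
  vder (fun s => f s *m g s) t (f t *m e + d *m g t).
Proof.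
move=> fd ge i j; rewrite mxE [X in X + _]mxE [X in _ + X]mxE -big_split/=.
under [fun s => _]eq_fun do rewrite mxE.
by apply: is_derive_bigsum => l; exact: is_derive_mul.
Qed.

Lemma vder_mull (R : realType) m n p (A : 'M[R]_(m, n)) (g : R -> 'M[R]_(n, p)) t e :
  vder g t e -> vder (fun s => A *m g s) t (A *m e).
Proof.
by move=> ge; have := vder_mul (vder_cst A t) ge; rewrite mul0mx addr0.
Qed.

Lemma vder_mulr (R : realType) m n p (A : 'M[R]_(n, p)) (g : R -> 'M[R]_(m, n)) t e :
  vder g t e -> vder (fun s => g s *m A) t (e *m A).
Proof.
by move=> ge; have := vder_mul ge (vder_cst A t); rewrite mulmx0 add0r.
Qed.

Lemma is_derive_dot (R : realType) n (f g : R -> 'cV[R]_n) t d e :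
  vder f t d -> vder g t e ->
  is_derive t (1 : R) (fun s => dot (f s) (g s)) (dot (f t) e + dot d (g t)).
Proof.
move=> fd ge; rewrite /dot -big_split/=; apply: is_derive_bigsum => i.
exact: is_derive_mul.
Qed.

Definition vcont (R : realType) m n (f : R -> 'M[R]_(m, n)) :=
  forall i j, continuous (fun s => f s i j).

Lemma vder_vcont (R : realType) m n (f : R -> 'M[R]_(m, n)) d :
  (forall t, vder f t (d t)) -> vcont f.
Proof. by move=> fd i j t; apply: is_derive_continuous; exact: fd. Qed.

Lemma vcont_cst (R : realType) m n (c : 'M[R]_(m, n)) : vcont (fun=> c : 'M[R]_(m, n)).
Proof. by move=> i j t; exact: cvg_cst. Qed.

Lemma vcont_add (R : realType) m n (f g : R -> 'M[R]_(m, n)) :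
  vcont f -> vcont g -> vcont (fun s => f s + g s).
Proof.
move=> cf cg i j; under [fun s => _]eq_fun do rewrite mxE.
by move=> t; apply: continuousD; [exact: cf|exact: cg].
Qed.

Lemma vcont_opp (R : realType) m n (f : R -> 'M[R]_(m, n)) :
  vcont f -> vcont (fun s => - f s).
Proof.
move=> cf i j; under [fun s => _]eq_fun do rewrite mxE.
by move=> t; apply: continuousN; exact: cf.
Qed.

Lemma vcont_sub (R : realType) m n (f g : R -> 'M[R]_(m, n)) :
  vcont f -> vcont g -> vcont (fun s => f s - g s).
Proof. by move=> cf cg; apply: vcont_add => //; exact: vcont_opp. Qed.

Lemma vcont_mul (R : realType) m n p (f : R -> 'M[R]_(m, n)) (g : R -> 'M[R]_(n, p)) :
  vcont f -> vcont g -> vcont (fun s => f s *m g s).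
Proof.
move=> cf cg i j; under [fun s => _]eq_fun do rewrite mxE.
move=> t; apply: cvg_sumr => l _; apply: cvgM; [exact: cf|exact: cg].
Qed.

Lemma vcont_scale (R : realType) m n (c : R) (f : R -> 'M[R]_(m, n)) :
  vcont f -> vcont (fun s => c *: f s).
Proof.
move=> cf i j; under [fun s => _]eq_fun do rewrite mxE.
by move=> t; apply: cvgMl_tmp; exact: cf.
Qed.

Lemma vcont_dgmx (R : realType) n (f : R -> 'I_n -> R) :
  (forall i, continuous (f^~ i)) -> vcont (fun s => dgmx (f s)).
Proof.
move=> cf i j t; have [<-|ij] := eqVneq i j.
  by under [fun s => _]eq_fun do rewrite !mxE eqxx mulr1n; exact: cf.
by under [fun s => _]eq_fun do rewrite !mxE (negPf ij) mulr0n; exact: cvg_cst.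
Qed.

Lemma vcont_bounded (R : realType) m n (f : R -> 'M[R]_(m, n)) :
  vcont f -> (forall t, f (t + 1) = f t) ->
  exists2 c, 0 <= c & forall t, `|f t| <= c.
Proof.
move=> cf fper.
have /choice[b hb] : forall ij : 'I_m * 'I_n, exists c, 0 <= c /\ forall t, `|f t ij.1 ij.2| <= c.
  move=> [i j]; have [|c c0 h] := @periodic_bounded _ (fun s => f s i j) (cf i j).
    by move=> t; rewrite fper.
  by exists c.
exists (\sum_ij b ij); first by apply: sumr_ge0 => ij _; have [] := hb ij.
move=> t; apply: mx_norm_le => [|i j]; first by apply: sumr_ge0 => ij _; have [] := hb ij.
have [_ /(_ t)/le_trans] := hb (i, j); apply.
by rewrite (bigD1 (i, j))//= lerDl sumr_ge0// => ij _; have [] := hb ij.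
Qed.

(** * Periodic solutions of coercive linear systems *)

Section PeriodicSystems.
Variable R : realType.

Lemma geometric_limit (T : Type) (u : nat -> T -> R) (c q : R) : 0 <= q -> q < 1 ->
  (forall k t, `|u k.+1 t - u k t| <= c * q ^+ k) ->
  exists v : T -> R, forall k t, `|v t - u k t| <= c * q ^+ k / (1 - q).
Proof.
move=> q0 q1 uc; have q10 : 0 < 1 - q by rewrite subr_gt0.
pose e k := c * q ^+ k / (1 - q).
have eS k : e k.+1 = e k - c * q ^+ k.
  by rewrite /e exprS; field; rewrite gt_eqF.
have loS k t : u k t - e k <= u k.+1 t - e k.+1.
  have := uc k t; rewrite eS ler_norml => /andP[+ _]; lra.
have hiS k t : u k.+1 t + e k.+1 <= u k t + e k.
  have := uc k t; rewrite eS ler_norml => /andP[_]; lra.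
have lo t j k : (j <= k)%N -> u j t - e j <= u k t - e k.
  by apply: (homo_leq (f := fun k => u k t - e k) (r := <=%R)) => //; exact: le_trans.
have hi t j k : (j <= k)%N -> u k t + e k <= u j t + e j.
  by apply: (homo_leq (f := fun k => u k t + e k) (r := fun x y => y <= x)) => // x y z xy yz; exact: le_trans yz xy.
have ege k (t : T) : 0 <= e k.
  have := uc k t => /(le_trans (normr_ge0 _)) h.
  by rewrite divr_ge0// ltW.
have lohi t j k : u j t - e j <= u k t + e k.
  have := lo t j (maxn j k) (leq_maxl _ _); have := hi t k (maxn j k) (leq_maxr _ _).
  by have := ege (maxn j k) t; lra.
exists (fun t => sup [set u k t - e k | k in setT]) => k t.
have hs : has_sup [set u k t - e k | k in setT].
  by split; [exists (u 0%N t - e 0%N), 0%N|exists (u 0%N t + e 0%N) => _ [j _ <-]].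
have lo' : u k t - e k <= sup [set u k t - e k | k in setT].
  by apply: ub_le_sup; [exact: hs.2|exists k].
have hi' : sup [set u k t - e k | k in setT] <= u k t + e k.
  by apply: ge_sup; [exact: hs.1|move=> _ [j _ <-]].
by rewrite -/(e k) ler_norml; apply/andP; split; lra.
Qed.

Lemma geometric_small (c q e : R) : 0 <= q -> q < 1 -> 0 < e ->
  exists k, c * q ^+ k < e.
Proof.
move=> q0 q1 e0.
have : c * q ^+ k @[k --> \oo] --> c * 0.
  by apply: cvgMl_tmp; apply: cvg_expr; rewrite ger0_norm.
rewrite mulr0 => /cvgr0Pnorm_lt/(_ _ e0)[N _ /(_ N (leqnn N))] /= h.
by exists N; rewrite (le_lt_trans (ler_norm _)).
Qed.

Lemma periodic_scalar_solution (lambda : R) (f : R -> R) : 0 < lambda ->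
  continuous f -> (forall t, f (t + 1) = f t) ->
  exists u : R -> R, (forall t, is_derive t (1 : R) u (- lambda * u t + f t)) /\
    forall t, u (t + 1) = u t.
Proof.
move=> l0 cf fper.
have [|G dG] := @continuous_primitive R (fun s => expR (lambda * s) * f s).
  move=> t; apply: cvgM; last exact: cf.
  exact: (is_derive_continuous (is_derive_expRM lambda (is_derive_id t 1))).
pose c := (G 1 - G 0) / (expR lambda - 1) - G 0.
pose u t := expR (- lambda * t) * (c + G t).
have du t : is_derive t (1 : R) u (- lambda * u t + f t).
  have h := is_derive_mul (is_derive_expRM (- lambda) (is_derive_id t (1 : R)))
    (is_derive_add (is_derive_cst c t (1 : R)) (dG t)).
  apply: is_derive_eq h _; rewrite /u /= add0r mulr1 mulrA -expRD mulNr addNr expR0.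
  ring.
exists u; split=> // t.
pose d s := expR (lambda * s) * (u (s + 1) - u s).
have dd s : is_derive s (1 : R) d 0.
  have h1 : is_derive s (1 : R) (fun s => u (s + 1)) ((- lambda * u (s + 1) + f (s + 1)) * 1).
    apply: (@is_derive1_comp _ u (fun s => s + 1)).
    apply: is_derive_eq (is_derive_add (is_derive_id s (1 : R)) (is_derive_cst (1 : R) s 1)) _.
    by rewrite addr0.
  have h := is_derive_mul (is_derive_expRM lambda (is_derive_id s (1 : R)))
     (is_derive_sub h1 (du s)).
  by apply: is_derive_eq h _; rewrite fper /=; ring.
have el1 : expR lambda - 1 != 0 by rewrite subr_eq0 gt_eqF// expR_gt1.
have d0 : d 0 = 0.
  rewrite /d mulr0 expR0 mul1r add0r /u mulr1 mulr0 expR0 mul1r expRN /c.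
  have e0 : expR lambda != 0 by rewrite gt_eqF// expR_gt0.
  by field; rewrite el1 e0.
have := @is_derive_0_is_cst R d t 0 dd; rewrite d0 /d => /eqP.
by rewrite mulf_eq0 gt_eqF ?expR_gt0//= subr_eq0 => /eqP.
Qed.

Variable n : nat.
Implicit Types (A : R -> 'M[R]_n) (f y : R -> 'cV[R]_n).

Lemma periodic_shift_solution (lambda : R) f : 0 < lambda ->
  vcont f -> (forall t, f (t + 1) = f t) ->
  exists u : R -> 'cV[R]_n, (forall t, vder u t (- lambda *: u t + f t)) /\
    forall t, u (t + 1) = u t.
Proof.
move=> l0 cf fper.
have /choice[u hu] : forall i, exists u : R -> R,
    (forall t, is_derive t (1 : R) u (- lambda * u t + f t i 0)) /\
    forall t, u (t + 1) = u t.
  move=> i; apply: (@periodic_scalar_solution lambda (fun t => f t i 0)) => //.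
  by move=> t; rewrite fper.
exists (fun t => \col_i u i t); split=> t.
  move=> i j; rewrite ord1 !mxE.
  under [fun s => _]eq_fun do rewrite mxE.
  by have [] := hu i.
by apply/colP => i; rewrite !mxE; have [] := hu i.
Qed.

Lemma coercive_bound A f y (h F : R) : 0 < h ->
  (forall t x, h * dot x x <= dot x (A t *m x)) ->
  (forall t, dot (f t) (f t) <= F) ->
  (forall t, y (t + 1) = y t) ->
  (forall t, vder y t (- (A t *m y t) + f t)) ->
  forall t, dot (y t) (y t) <= F / h ^+ 2.
Proof.
move=> h0 Ah fF yper yd t.
rewrite expr2 invfM mulrA.
apply: (@periodic_le _ (fun t => dot (y t) (y t)) _ _ _ h0 _ (fun t => is_derive_dot (yd t) (yd t))).
  by move=> s; rewrite yper.
move=> s; rewrite [X in _ + X]dotC -mulr2n -mulr_natl dotDr dotNr.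
have := Ah s (y s); have := dot_amgm (y s) (f s) h0.
have : dot (f s) (f s) / h <= F / h by rewrite ler_pM2r ?invr_gt0.
lra.
Qed.

Lemma shift_bound (lambda : R) (f g : R -> 'cV[R]_n) (u v : R -> 'cV[R]_n) (F : R) : 0 < lambda ->
  (forall t, vder u t (- lambda *: u t + f t)) -> (forall t, u (t + 1) = u t) ->
  (forall t, vder v t (- lambda *: v t + g t)) -> (forall t, v (t + 1) = v t) ->
  (forall t, dot (f t - g t) (f t - g t) <= F) ->
  forall t, dot (u t - v t) (u t - v t) <= F / lambda ^+ 2.
Proof.
move=> l0 ud uper vd vper fF.
apply: (@coercive_bound (fun=> lambda%:M) (fun t => f t - g t) (fun t => u t - v t)) => //.
- by move=> t x; rewrite mul_scalar_mx dotZr.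
- by move=> t; rewrite uper vper.
move=> t; have := vder_sub (ud t) (vd t).
rewrite mul_scalar_mx scalerBr opprB !scaleNr.
rewrite (_ : - _ + _ - _ = lambda *: v t - lambda *: u t + (f t - g t))//.
by rewrite opprD opprK addrACA addrC [RHS]addrC; congr (_ + _); rewrite addrC.
Qed.

(* With [y' + lambda y = (lambda - A) y + f] for [lambda] large, the solution
   operator of the left-hand side turns this into a fixed point problem for a
   contraction, by coercivity. *)
Theorem coercive_periodic_solution A f (h : R) : 0 < h ->
  (forall t x, h * dot x x <= dot x (A t *m x)) ->
  vcont A -> vcont f ->
  (forall t, A (t + 1) = A t) -> (forall t, f (t + 1) = f t) ->
  exists y, (forall t, y (t + 1) = y t) /\
    forall t, vder y t (- (A t *m y t) + f t).
Proof.
move=> h0 Ah cA cf Aper fper.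
have [a a0 Aa] := vcont_bounded cA Aper.
pose b := n%:R * (n%:R * a) ^+ 2.
have Ab t x : dot (A t *m x) (A t *m x) <= b * dot x x.
  rewrite (le_trans (dot_mulmx_le _ _))// ler_wpM2r ?dot_ge0// ler_wpM2l//.
  by rewrite lerXn2r ?nnegrE ?mulr_ge0// ler_wpM2l.
have b0 : 0 <= b by rewrite mulr_ge0// sqr_ge0.
pose lambda := h + b / h.
have l0 : 0 < lambda by rewrite ltr_pwDl// divr_ge0// ltW.
pose kappa := 1 - h / lambda.
have hl : h <= lambda by rewrite lerDl divr_ge0// ltW.
have kappa0 : 0 <= kappa by rewrite subr_ge0 ler_pdivrMr// mul1r.
have kappa1 : kappa < 1 by rewrite gtrBl divr_gt0.
have contr t x : dot (lambda *: x - A t *m x) (lambda *: x - A t *m x) / lambda ^+ 2 <=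
    kappa * dot x x.
  rewrite ler_pdivrMr ?exprn_gt0// !(dotBl, dotBr, dotZl, dotZr) (dotC (A t *m x)).
  rewrite [leRHS](_ : _ = (lambda ^+ 2 - h * lambda) * dot x x); last first.
    by rewrite /kappa; field; rewrite gt_eqF.
  have := Ab t x; have := Ah t x; set p := dot x x; set q := dot x _; set r := dot _ (A t *m x).
  move=> hpq rbp.
  have p0 : 0 <= p by exact: dot_ge0.
  have : lambda * (h * p) <= lambda * q by rewrite ler_pM2l.
  have : b * p <= lambda * h * p.
    rewrite ler_wpM2r// /lambda mulrDl divfK ?gt_eqF// lerDr.
    by rewrite mulr_ge0// ltW.
  by move: hpq rbp; clear; nra.
have /choice[T hT] : forall v : {y : R -> 'cV[R]_n | vcont y /\ forall t, y (t + 1) = y t},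
    exists u : {y : R -> 'cV[R]_n | vcont y /\ forall t, y (t + 1) = y t},
    forall t, vder (sval u) t (- lambda *: sval u t + (lambda *: sval v t - A t *m sval v t + f t)).
  move=> [v [vc vper]] /=.
  have [|t|u [ud uper]] := @periodic_shift_solution lambda
      (fun t => lambda *: v t - A t *m v t + f t) l0.
  - by apply: vcont_add => //; apply: vcont_sub; [exact: vcont_scale|exact: vcont_mul].
  - by rewrite vper fper Aper.
  by exists (exist _ u (conj (vder_vcont ud) uper)).
have v0 : vcont (fun _ : R => 0 : 'cV[R]_n) /\ forall t : R, (0 : 'cV[R]_n) = 0.
  by split => //; exact: vcont_cst.
pose u k := sval (iter k T (exist _ _ v0)).
have uc k : vcont (u k) by have [] := svalP (iter k T (exist _ _ v0)).
have uper k : forall t, u k (t + 1) = u k t.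
  by have [] := svalP (iter k T (exist _ _ v0)).
have ud k t : vder (u k.+1) t (- lambda *: u k.+1 t + (lambda *: u k t - A t *m u k t + f t)).
  exact: hT.
have step (x y : R -> 'cV[R]_n) (F : R) :
    (forall t, dot (x t - y t) (x t - y t) <= F) -> forall t,
    dot ((lambda *: x t - A t *m x t + f t) - (lambda *: y t - A t *m y t + f t))
        ((lambda *: x t - A t *m x t + f t) - (lambda *: y t - A t *m y t + f t)) <=
    kappa * F * lambda ^+ 2.
  move=> xy t; set z := (_ - _).
  have -> : z = lambda *: (x t - y t) - A t *m (x t - y t).
    rewrite /z scalerBr mulmxBr opprD addrACA subrr addr0 !opprD !opprK.
    by rewrite addrACA.
  rewrite -ler_pdivrMr ?exprn_gt0// (le_trans (contr _ _))//.
  by rewrite ler_wpM2l.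
have [c c0 uc0] := vcont_bounded (uc 1%N) (uper 1%N).
pose C := n%:R * c ^+ 2.
have C0 : 0 <= C by rewrite mulr_ge0// sqr_ge0.
have geo k : forall t, dot (u k.+1 t - u k t) (u k.+1 t - u k t) <= C * kappa ^+ k.
  elim: k => [|k IH] t.
    rewrite expr0 mulr1 subr0 (le_trans (dot_le_norm _))// ler_wpM2l//.
    by rewrite lerXn2r ?nnegrE.
  rewrite (le_trans (shift_bound l0 (ud k.+1) (uper _) (ud k) (uper _) (step _ _ _ IH) t))//.
  by rewrite mulfK ?expf_neq0 ?gt_eqF// exprS mulrCA.
pose q := Num.sqrt kappa.
have q0 : 0 <= q by exact: sqrtr_ge0.
have qq : q ^+ 2 = kappa by exact: sqr_sqrtr.
have q1 : q < 1 by rewrite -[ltRHS]sqrtr1 ltr_sqrt.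
have geo' k t : forall i, `|u k.+1 t i 0 - u k t i 0| <= Num.sqrt C * q ^+ k.
  move=> i; rewrite -(ler_pXn2r (_ : 0 < 2)%N) ?nnegrE ?mulr_ge0 ?sqrtr_ge0 ?exprn_ge0//.
  rewrite exprMn sqr_sqrtr// -exprM mulnC exprM qq real_normK ?num_real//.
  rewrite (le_trans _ (geo k t))//; apply: le_trans (dot_coord _ i).
  by rewrite !mxE.
have [v hv] := @geometric_limit (R * 'I_n) (fun k p => u k p.1 p.2 0) _ _ q0 q1
  (fun k p => geo' k p.1 p.2).
pose y t : 'cV[R]_n := \col_i v (t, i).
pose e k := Num.sqrt C * q ^+ k / (1 - q).
have e0 k : 0 <= e k.
  by rewrite !mulr_ge0 ?sqrtr_ge0 ?exprn_ge0// invr_ge0 subr_ge0 ltW.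
have small (d : R) : 0 < d -> exists k, e k < d.
  move=> d0; have [k hk] := @geometric_small (Num.sqrt C / (1 - q)) q d q0 q1 d0.
  by exists k; rewrite /e mulrAC.
have yu k t : `|y t - u k t| <= e k.
  apply: mx_norm_le => // i j; rewrite ord1 !mxE; exact: (hv k (t, i)).
have yper t : y (t + 1) = y t.
  apply/eqP; rewrite -subr_eq0 -normr_le0; apply/ler_addgt0Pl => d d0; rewrite addr0.
  have [k hk] := small (d / 2) (divr_gt0 d0 (ltr0Sn _ _)).
  rewrite (_ : _ - _ = (y (t + 1) - u k (t + 1)) - (y t - u k t)); last first.
    by rewrite uper opprB addrA subrK.
  rewrite (le_trans (ler_normB _ _))// (splitr d) lerD//;
    by rewrite (le_trans (yu k _))// ltW.
have yc : vcont y.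
  move=> i j t; rewrite ord1; apply/cvgrPdist_le => d d0.
  have [k hk] := small (d / 3) (divr_gt0 d0 (ltr0Sn _ _)).
  have hc := uc k i 0 t.
  have /cvgrPdist_le/(_ (d / 3) (divr_gt0 d0 (ltr0Sn _ _))) := hc.
  apply: filterS => s hs.
  have h1 := le_trans (mx_entry_le (y t - u k t) i 0) (yu k t).
  have h2 := le_trans (mx_entry_le (y s - u k s) i 0) (yu k s).
  have mxB (x z : 'cV[R]_n) l : (x - z) l 0 = x l 0 - z l 0 by rewrite !mxE.
  move: h1 h2; rewrite !mxB.
  move: hs hk; rewrite !ler_norml => /andP[? ?] ? /andP[? ?] /andP[? ?].
  by apply/andP; split; lra.
have [|t|w [wd wper]] := @periodic_shift_solution lambda
    (fun t => lambda *: y t - A t *m y t + f t) l0.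
- by apply: vcont_add => //; apply: vcont_sub; [exact: vcont_scale|exact: vcont_mul].
- by rewrite yper fper Aper.
have wy t : w t = y t.
  apply/eqP; rewrite -subr_eq0 -normr_le0; apply/ler_addgt0Pl => d d0; rewrite addr0.
  pose E : R := Num.sqrt n%:R + 1.
  have E0 : 0 < E by rewrite ltr_wpDl ?sqrtr_ge0.
  have En : (n%:R : R) <= E ^+ 2.
    rewrite -{1}[n%:R : R]sqr_sqrtr// lerXn2r ?nnegrE ?sqrtr_ge0 ?(ltW E0)//.
    by rewrite lerDl.
  have [k hk] := small (d / (2 * E)) (divr_gt0 d0 (mulr_gt0 (ltr0Sn _ _) E0)).
  rewrite (_ : _ - _ = (w t - u k.+1 t) - (y t - u k.+1 t)); last by rewrite opprB addrA subrK.
  have ek : E * e k <= d / 2.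
    by move: hk; rewrite ltr_pdivlMr ?mulr_gt0// => /ltW; lra.
  have E1 : 1 <= E by rewrite lerDr sqrtr_ge0.
  rewrite (le_trans (ler_normB _ _))// (splitr d) lerD//.
    rewrite (le_trans _ ek)//; apply: norm_le_dot; first by rewrite mulr_ge0// ltW.
    have hE s : dot (y s - u k s) (y s - u k s) <= E ^+ 2 * e k ^+ 2.
      rewrite (le_trans (dot_le_norm _))// ler_pM ?sqr_ge0//.
      by rewrite lerXn2r ?nnegrE.
    rewrite (le_trans (shift_bound l0 wd wper (ud k) (uper _) (step _ _ _ hE) t))//.
    rewrite mulfK ?expf_neq0 ?gt_eqF// [leRHS]exprMn ler_piMl// ?(ltW kappa1)//.
    by rewrite mulr_ge0// sqr_ge0.
  rewrite (le_trans (yu k.+1 t))// (le_trans _ ek)//.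
  rewrite (le_trans (_ : _ <= e k))//; last by rewrite ler_peMl.
  rewrite /e exprS -!mulrA ler_wpM2l ?sqrtr_ge0// ler_piMl// ?(ltW q1)//.
  by rewrite mulr_ge0 ?exprn_ge0// invr_ge0 subr_ge0 ltW.
have wyE : w = y by apply/funext.
exists y; split=> // t; have := wd t; rewrite wyE addrA addrA scaleNr addNr add0r.
by [].
Qed.

End PeriodicSystems.

(** * The adiabatic limit *)

Section DgmxCalculus.
Variable R : realType.

Lemma dgmxM n (f g : 'I_n -> R) : dgmx f *m dgmx g = dgmx (fun i => f i * g i).
Proof.
apply/matrixP => i j; rewrite dgmxEl !mxE.
by case: eqP => [->|_]; rewrite ?mulr1n// !mulr0n mulr0.
Qed.

Lemma dgmx1 n : dgmx (fun=> 1 : R) = 1%:M :> 'M[R]_n.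
Proof. by apply/matrixP => i j; rewrite !mxE. Qed.

Lemma dgmx_norm n (f : 'I_n -> R) c : 0 <= c -> (forall i, `|f i| <= c) -> `|dgmx f| <= c.
Proof.
move=> c0 fc; apply: mx_norm_le => // i j; rewrite !mxE.
by case: eqP => _; rewrite ?mulr1n// mulr0n normr0.
Qed.

Lemma dot_dgmx_ge n (f : 'I_n -> R) c (x : 'cV[R]_n) : (forall i, c <= f i) ->
  c * dot x x <= dot x (dgmx f *m x).
Proof.
move=> fc; rewrite /dot mulr_sumr; apply: ler_sum => i _.
by rewrite dgmxEl [leRHS]mulrCA ler_wpM2r// -expr2 sqr_ge0.
Qed.

Lemma vder_dgmx n (f : R -> 'I_n -> R) t d :
  (forall i, is_derive t (1 : R) (f^~ i) (d i)) -> vder (fun s => dgmx (f s)) t (dgmx d).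
Proof.
move=> fd i j; have [<-|ij] := eqVneq i j.
  under [fun s => _]eq_fun do rewrite !mxE eqxx mulr1n.
  by rewrite !mxE eqxx mulr1n; exact: fd.
under [fun s => _]eq_fun do rewrite !mxE (negPf ij) mulr0n.
by rewrite !mxE (negPf ij) mulr0n; exact: is_derive_cst.
Qed.

Lemma vder_dgmx_exp n (c : R) (f df : R -> 'I_n -> R) t :
  (forall i t, is_derive t (1 : R) (f^~ i) (df t i)) ->
  vder (fun s => dgmx (fun i => expR (c * f s i))) t
    (c *: (dgmx (df t) *m dgmx (fun i => expR (c * f t i)))).
Proof.
move=> fd; rewrite dgmxM (_ : _ *: _ = dgmx (fun i => c * df t i * expR (c * f t i))).
  by apply: vder_dgmx => i; exact: is_derive_expRM.
apply/matrixP => i j; rewrite !mxE.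
by case: eqP => _; rewrite ?mulr1n ?mulrA// !mulr0n mulr0.
Qed.

End DgmxCalculus.

Section Coercivity.
Variables (R : realType) (n m : nat) (B : 'M[R]_(n, m)).

Definition coker_proj : 'M[R]_n := 1%:M - wproj B (fun=> 1).
Local Notation Z := coker_proj.

Let one_gt0 n' : forall i : 'I_n', 0 < (fun=> 1 : R) i.
Proof. by []. Qed.

Lemma coker_projB : Z *m B = 0.
Proof. by rewrite mulmxBl mul1mx wproj_id ?subrr. Qed.

Lemma coker_proj_tr : Z^T = Z.
Proof.
have : B^T *m Z = 0 by have := wproj_orth B (@one_gt0 n); rewrite dgmx1 mulmx1.
rewrite /Z mulmxBr mulmx1 => /eqP; rewrite subr_eq0 => /eqP.
move: (wproj_image B (fun=> 1)); move: (wproj B _) => P [C PC] BP.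
have PB : P^T *m B = B by rewrite -[RHS]trmxK BP trmx_mul trmxK.
have PP : P^T *m P = P by rewrite {2}PC mulmxA PB.
by rewrite linearB/= trmx1 -[in LHS]PP trmx_mul trmxK PP.
Qed.

Lemma coker_proj_idem : Z *m Z = Z.
Proof. by rewrite {2}/Z mulmxBr mulmx1; have [C ->] := wproj_image B (fun=> 1); rewrite mulmxA coker_projB mul0mx subr0. Qed.

Lemma coker_proj_image (x : 'cV[R]_n) : Z *m x = 0 <-> exists w, x = B *m w.
Proof.
split=> [|[w ->]]; last by rewrite mulmxA coker_projB mul0mx.
rewrite mulmxBl mul1mx => /eqP; rewrite subr_eq0 => /eqP ->.
by have [C ->] := wproj_image B (fun=> 1); exists (C *m x); rewrite mulmxA.
Qed.

(* For [S] positive diagonal, [|y|^2 = <S y, S^-1 y>] is split along the image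
   of [B] and its orthogonal complement. *)
Lemma regularized_coercive (b : R) : 0 < b -> exists2 h, 0 < h &
  forall (sg : 'I_n -> R) (x : 'I_m -> R) (y : 'cV[R]_n),
  (forall i, b^-1 <= sg i <= b) -> (forall i, b^-1 <= x i) ->
  h * dot y y <= dot y ((dgmx sg *m B *m dgmx x *m B^T *m dgmx sg +
     dgmx (fun i => (sg i)^-1) *m Z *m dgmx (fun i => (sg i)^-1)) *m y).
Proof.
move=> b0; have [C CE] := wproj_image B (fun=> 1).
pose c1 := m%:R * (n%:R * (n%:R * `|C| * b)) ^+ 2 + 1 : R.
pose c2 := n%:R * (n%:R * b) ^+ 2 + 1 : R.
have c10 : 0 < c1 by rewrite ltr_wpDl// mulr_ge0// sqr_ge0.
have c20 : 0 < c2 by rewrite ltr_wpDl// mulr_ge0// sqr_ge0.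
pose h := Num.min ((2 * c1)^-1 * b^-1) (2 * c2)^-1.
exists h; first by rewrite lt_min !mulr_gt0 ?invr_gt0 ?mulr_gt0.
move=> sg x y hsg hx.
have sg0 i : 0 < sg i by have /andP[+ _] := hsg i; apply: lt_le_trans; rewrite invr_gt0.
pose S := dgmx sg; pose T := dgmx (fun i => (sg i)^-1).
have ST : S *m T = 1%:M.
  by rewrite dgmxM -dgmx1; congr dgmx; apply/funext => i; rewrite divff ?gt_eqF.
have Sb : `|S| <= b.
  apply: dgmx_norm; first exact: ltW.
  by move=> i; rewrite gtr0_norm//; have /andP[] := hsg i.
have Tb : `|T| <= b.
  apply: dgmx_norm; first exact: ltW.
  move=> i; rewrite normfV gtr0_norm// -[leRHS]invrK lef_pV2 ?posrE ?invr_gt0//.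
  by have /andP[] := hsg i.
pose p := B^T *m (S *m y); pose q := Z *m (T *m y).
have -> : dot y ((S *m B *m dgmx x *m B^T *m S + T *m Z *m T) *m y) =
    dot p (dgmx x *m p) + dot q q.
  rewrite mulmxDl dotDr; congr (_ + _).
    by rewrite /p dot_mull trmxK dot_mull dgmx_tr !mulmxA.
  rewrite /q dot_mull coker_proj_tr dot_mull dgmx_tr.
  by rewrite !mulmxA -[T *m Z *m Z]mulmxA coker_proj_idem.
have yy : dot y y = dot p (C *m T *m y) + dot (S *m y) q.
  have -> : dot y y = dot (S *m y) (T *m y).
    by rewrite dot_mull dgmx_tr mulmxA ST mul1mx.
  rewrite -[in LHS](mul1mx (T *m y)) (_ : 1%:M = B *m C + Z); last first.
    by rewrite -CE addrC subrK.
  rewrite mulmxDl dotDr; congr (_ + _).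
  by rewrite /p [RHS]dot_mull trmxK !mulmxA.
have i1 : 2 * dot p (C *m T *m y) <= dot y y / 2 + 2 * c1 * dot p p.
  have := @dot_amgm _ _ (2 * c1) p (C *m T *m y); rewrite mulr_gt0// => /(_ isT) h1.
  have h2 : dot (C *m T *m y) (C *m T *m y) <= c1 * dot y y.
    rewrite (le_trans (dot_mulmx_le _ _))// ler_wpM2r ?dot_ge0//.
    rewrite /c1 /c2 -[leLHS]addr0 lerD// ler_wpM2l//.
    rewrite lerXn2r ?nnegrE ?mulr_ge0 ?(ltW b0)// ler_wpM2l//.
    rewrite (le_trans (mulmx_norm _ _))// ler_wpM2l ?mulr_ge0//.
  have : dot (C *m T *m y) (C *m T *m y) / (2 * c1) <= dot y y / 2.
    rewrite ler_pdivrMr ?mulr_gt0// (_ : _ / 2 * (2 * c1) = c1 * dot y y)//.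
    by field.
  by lra.
have i2 : 2 * dot (S *m y) q <= dot y y / 2 + 2 * c2 * dot q q.
  have := @dot_amgm _ _ (2 * c2) q (S *m y); rewrite mulr_gt0// => /(_ isT) h1.
  have h2 : dot (S *m y) (S *m y) <= c2 * dot y y.
    rewrite (le_trans (dot_mulmx_le _ _))// ler_wpM2r ?dot_ge0//.
    rewrite /c1 /c2 -[leLHS]addr0 lerD// ler_wpM2l//.
    by rewrite lerXn2r ?nnegrE ?mulr_ge0 ?(ltW b0)// ler_wpM2l.
  have : dot (S *m y) (S *m y) / (2 * c2) <= dot y y / 2.
    rewrite ler_pdivrMr ?mulr_gt0// (_ : _ / 2 * (2 * c2) = c2 * dot y y)//.
    by field.
  by rewrite dotC; lra.
have px : b^-1 * dot p p <= dot p (dgmx x *m p) by exact: dot_dgmx_ge.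
have yle : dot y y <= 2 * c1 * dot p p + 2 * c2 * dot q q.
  by move: i1 i2; rewrite -{3}[dot y y]mul1r; lra.
have h0 : 0 <= h by rewrite ltW// lt_min !mulr_gt0 ?invr_gt0 ?mulr_gt0.
apply: le_trans (ler_wpM2l h0 yle) _; rewrite mulrDr lerD//.
  apply: le_trans px; rewrite mulrA ler_wpM2r ?dot_ge0//.
  rewrite (le_trans (ler_wpM2r _ (_ : h <= (2 * c1)^-1 * b^-1)))//.
  - by rewrite mulr_ge0// ltW.
  - by rewrite ge_min lexx.
  - by rewrite mulrAC mulVf ?mul1r// gt_eqF// mulr_gt0.
rewrite mulrA ler_piMl ?dot_ge0//.
rewrite (le_trans (ler_wpM2r _ (_ : h <= (2 * c2)^-1)))//.
- by rewrite mulr_ge0// ltW.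
- by rewrite ge_min lexx orbT.
- by rewrite mulVf// gt_eqF// mulr_gt0.
Qed.

End Coercivity.

Section Adiabatic.
Variables (R : realType) (n m p : nat).
Variables (B : 'M[R]_(n, m)) (MK : 'M[R]_(m, p)) (s : 'M[R]_(m, n)) (d2 : 'I_m -> R).
Hypothesis Bd2 : B *m dgmx d2 = B.
Hypothesis BsB : B *m s *m B = B.
Hypothesis BMK : B *m MK = 0.
Hypothesis sBMK : exists C, (1%:M - s *m B) *m dgmx d2 = MK *m C.

Variables (E dE : R -> 'I_n -> R) (W dW : R -> 'I_m -> R).
Hypothesis E_der : forall i t, is_derive t (1 : R) (E^~ i) (dE t i).
Hypothesis W_der : forall i t, is_derive t (1 : R) (W^~ i) (dW t i).
Hypothesis dE_cont : forall i, continuous (dE^~ i).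
Hypothesis dW_cont : forall i, continuous (dW^~ i).
Hypothesis E_per : forall t, E (t + 1) = E t.
Hypothesis W_per : forall t, W (t + 1) = W t.
Hypothesis dE_per : forall t, dE (t + 1) = dE t.
Hypothesis dW_per : forall t, dW (t + 1) = dW t.
Variables (beta : R) (z0 : 'cV[R]_n).
Hypothesis beta0 : 0 < beta.

Definition expmx k (c : R) (f : 'I_k -> R) : 'M[R]_k := dgmx (fun i => expR (c * f i)).

Definition flux (tau : R) (rho : R -> 'cV[R]_n) (t : R) : 'cV[R]_m :=
  tau *: (expmx (- beta) (W t) *m (B^T *m (expmx beta (E t) *m rho t))).

Definition flux_solution tau (rho : R -> 'cV[R]_n) :=
  [/\ forall t, vder rho t (- (B *m flux tau rho t)),
      forall t, rho (t + 1) = rho t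
    & forall t, exists w, rho t - z0 = B *m w].

(* [(1%:M - Pi t) *m z0] is the Boltzmann distribution; [MK] spans the kernel of
   [B] inside the coordinates selected by [d2]. *)
Definition Pi t : 'M[R]_n := wproj B (fun i => expR (beta * E t i)).
Definition Psi t : 'M[R]_m := 1%:M - wproj MK (fun i => expR (beta * W t i)).
Definition dPi t : 'M[R]_n := beta *: (Pi t *m dgmx (dE t) *m (1%:M - Pi t)).
Definition dPsi t : 'M[R]_m :=
  - (beta *: ((1%:M - Psi t) *m dgmx (dW t) *m Psi t)).

Let Z := coker_proj B.
Let S t := expmx (beta / 2) (E t).
Let T t := expmx (- (beta / 2)) (E t).
Let rhoB t : 'cV[R]_n := (1%:M - Pi t) *m z0.

Lemma expmxD k c c' (f : 'I_k -> R) : expmx c f *m expmx c' f = expmx (c + c') f.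
Proof. by rewrite dgmxM; congr dgmx; apply/funext => i; rewrite mulrDl expRD. Qed.

Lemma expmx0 k (f : 'I_k -> R) : expmx 0 f = 1%:M.
Proof. by rewrite -dgmx1; congr dgmx; apply/funext => i; rewrite mul0r expR0. Qed.

Lemma vder_Pi t : vder Pi t (dPi t).
Proof. by move=> i j; rewrite mxE; exact: (wproj_exp_derive B beta E_der). Qed.

Lemma vder_Psi t : vder Psi t (dPsi t).
Proof.
rewrite -[dPsi t]add0r; apply: vder_add; first exact: vder_cst.
apply: vder_opp => i j; rewrite mxE /Psi opprB addrC subrK.
exact: (wproj_exp_derive MK beta W_der).
Qed.

Let ST t : S t *m T t = 1%:M.
Proof. by rewrite expmxD subrr expmx0. Qed.

Let TS t : T t *m S t = 1%:M.
Proof. by rewrite expmxD addNr expmx0. Qed.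

Let SS t : S t *m S t = expmx beta (E t).
Proof. by rewrite expmxD -splitr. Qed.

Let rhoB_orth t : B^T *m (expmx beta (E t) *m rhoB t) = 0.
Proof. by rewrite /rhoB !mulmxA wproj_orth ?mul0mx// => i; exact: expR_gt0. Qed.

Let rhoB_image t : Z *m (rhoB t - z0) = 0.
Proof.
apply/coker_proj_image; have [C CE] := wproj_image B (fun i => expR (beta * E t i)).
by exists (- (C *m z0)); rewrite mulmxN mulmxA -CE /rhoB mulmxBl mul1mx addrC addKr.
Qed.

Let bounds : exists2 b, 0 < b &
  [/\ forall t i, b^-1 <= expR (beta / 2 * E t i) <= b,
      forall t i, b^-1 <= expR (- beta * W t i),
      forall t i, b^-1 <= expR (- beta * E t i)
    & forall t i, `|dE t i| <= b].
Proof.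
have per_bound k (f : R -> 'I_k -> R) : (forall i, continuous (f^~ i)) ->
    (forall t, f (t + 1) = f t) -> exists2 b, 0 <= b & forall t i, `|f t i| <= b.
  move=> cf fper; have [|t|b b0 fb] := @vcont_bounded R k 1 (fun t => \col_i f t i).
  - by move=> i j; under [fun s => _]eq_fun do rewrite mxE; exact: cf.
  - by rewrite fper.
  by exists b => // t i; have := le_trans (mx_entry_le _ i 0) (fb t); rewrite mxE.
have [e e0 Ee] := per_bound _ E (fun i t => is_derive_continuous (E_der i t)) E_per.
have [w w0 Ww] := per_bound _ W (fun i t => is_derive_continuous (W_der i t)) W_per.
have [d d0 dEd] := per_bound _ dE dE_cont dE_per.
pose c := beta * (e + w) + d.
have c0 : 0 <= c by rewrite addr_ge0// mulr_ge0 ?addr_ge0// ltW.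
have cb : c <= expR c by rewrite (le_trans _ (expR_ge1Dx _))// lerDr.
have be : 0 <= beta * e by rewrite mulr_ge0// ltW.
have bw : 0 <= beta * w by rewrite mulr_ge0// ltW.
have bE t i : `|beta * E t i| <= beta * e by rewrite normrM gtr0_norm// ler_pM2l.
have bW t i : `|beta * W t i| <= beta * w by rewrite normrM gtr0_norm// ler_pM2l.
exists (expR c); first exact: expR_gt0.
rewrite /c mulrDr in cb *; split=> t i.
- rewrite -expRN !ler_expR mulrAC; have := bE t i; rewrite ler_norml => /andP[? ?].
  by apply/andP; split; lra.
- rewrite -expRN ler_expR mulNr; have := bW t i; rewrite ler_norml => /andP[? ?].
  by lra.
- rewrite -expRN ler_expR mulNr; have := bE t i; rewrite ler_norml => /andP[? ?].
  by lra.
- by rewrite (le_trans (dEd t i))// (le_trans _ cb)// lerDr addr_ge0.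
Qed.

Let A tau t := tau *: (S t *m B *m expmx (- beta) (W t) *m B^T *m S t + T t *m Z *m T t)
  - dgmx (fun i => beta / 2 * dE t i).

Let A_coercive : exists2 h, 0 < h & exists2 tau0, 0 < tau0 &
  forall tau, tau0 <= tau -> forall t y, tau * h * dot y y <= dot y (A tau t *m y).
Proof.
have [b b0 [Eb Wb _ dEb]] := bounds.
have [h h0 hP] := regularized_coercive B b0.
exists (h / 2); first by rewrite divr_gt0.
pose c := beta / 2 * b.
have c0 : 0 < c by rewrite mulr_gt0// divr_gt0.
exists (2 * c / h); first by rewrite divr_gt0// mulr_gt0.
move=> tau; rewrite ler_pdivrMr// => tau0 t y.
have tau_gt0 : 0 < tau by rewrite -(pmulr_lgt0 _ h0) (lt_le_trans _ tau0)// mulr_gt0.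
rewrite mulmxBl dotBr -scalemxAl dotZr.
have := hP (fun i => expR (beta / 2 * E t i)) (fun i => expR (- beta * W t i)) y (Eb t) (Wb t).
have -> : dgmx (fun i => (expR (beta / 2 * E t i))^-1) = T t.
  by congr dgmx; apply/funext => i; rewrite mulNr expRN.
rewrite -/(expmx _ _) -/(expmx _ _) -/(S t) => hy.
have : tau * (h * dot y y) <= tau * dot y
  ((S t *m B *m expmx (- beta) (W t) *m B^T *m S t + T t *m Z *m T t) *m y) by rewrite ler_pM2l.
have : dot y (dgmx (fun i => beta / 2 * dE t i) *m y) <= c * dot y y.
  rewrite /dot mulr_sumr; apply: ler_sum => i _; rewrite dgmxEl mulrCA ler_wpM2r//.
    by rewrite -expr2 sqr_ge0.
  by rewrite ler_pM2l ?divr_gt0// (le_trans (ler_norm _)).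
have : 2 * c * dot y y <= tau * h * dot y y by rewrite ler_wpM2r ?dot_ge0.
by move: (dot y _) (dot y y) => u v w; lra.
Qed.

(* The change of variable [y = e^(beta E / 2) rho] symmetrizes the equation. *)
Let vder_S tau (rho : R -> 'cV[R]_n) f t :
  vder rho t (- (B *m flux tau rho t) - tau *: (expmx (- beta) (E t) *m Z *m rho t) + f) ->
  vder (fun t => S t *m rho t) t (- (A tau t *m (S t *m rho t)) + S t *m f).
Proof.
move=> rd; have := vder_mul (vder_dgmx_exp (beta / 2) t E_der) rd.
rewrite -/(expmx _ _) -/(S t); congr vder.
have ds : dgmx (fun i => beta / 2 * dE t i) = (beta / 2) *: dgmx (dE t).
  by apply/matrixP => i j; rewrite !mxE mulrnAr.
have ST' : S t *m expmx (- beta) (E t) = T t.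
  by rewrite expmxD (_ : beta / 2 + - beta = - (beta / 2))//; lra.
have e1 : S t *m (B *m flux tau rho t) =
    tau *: (S t *m B *m expmx (- beta) (W t) *m B^T *m S t *m (S t *m rho t)).
  by rewrite /flux -SS -!scalemxAr !mulmxA.
have e2 : S t *m (tau *: (expmx (- beta) (E t) *m Z *m rho t)) =
    tau *: (T t *m Z *m T t *m (S t *m rho t)).
  rewrite -scalemxAr !mulmxA ST'; congr (_ *: _).
  by rewrite -[T t *m Z *m T t *m S t]mulmxA TS mulmx1.
rewrite mulmxDr mulmxBr mulmxN e1 e2 /A ds mulmxBl -!scalemxAl mulmxDl scalerDr.
rewrite -(mulmxA (dgmx (dE t))); move: (tau *: _) (tau *: _) (S t *m f) => u v w.
by rewrite opprB opprD addrAC [_ + (- v - u)]addrC.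
Qed.

Let Z_rho tau (rho : R -> 'cV[R]_n) : 0 < tau ->
  (forall t, rho (t + 1) = rho t) ->
  (forall t, vder rho t (- (B *m flux tau rho t)
     - tau *: (expmx (- beta) (E t) *m Z *m (rho t - z0)))) ->
  forall t, Z *m (rho t - z0) = 0.
Proof.
move=> tau0 rper rd t; have [b b0 [_ _ Eb _]] := bounds.
pose u t := Z *m (rho t - z0).
have ud r : vder u r (- (tau *: (Z *m (expmx (- beta) (E r) *m u r)))).
  have := vder_mull Z (vder_sub (rd r) (vder_cst z0 r)).
  rewrite subr0 mulmxBr mulmxN (mulmxA Z B) coker_projB mul0mx oppr0 sub0r.
  by rewrite -scalemxAr -!mulmxA.
have Zu r : Z *m u r = u r by rewrite /u mulmxA coker_proj_idem.
have : dot (u t) (u t) <= 0 / (2 * tau * b^-1).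
  apply: (periodic_le _ _ (fun t => is_derive_dot (ud t) (ud t))).
  - by rewrite !mulr_gt0// invr_gt0.
  - by move=> r; rewrite /u rper.
  - move=> r; rewrite [X in _ + X]dotC -mulr2n -mulr_natl dotNr dotZr.
    rewrite -[dot _ (Z *m _)]dotC dot_mull coker_proj_tr Zu.
    have : b^-1 * dot (u r) (u r) <= dot (u r) (expmx (- beta) (E r) *m u r).
      exact: dot_dgmx_ge (Eb r).
    rewrite -(ler_pM2l tau0) dotC addr0.
    by move: (dot _ _) (dot _ _) => v w; lra.
rewrite mul0r => h; apply/eqP; rewrite -normr_le0; apply: norm_le_dot => //.
by rewrite expr0n.
Qed.

Theorem flux_solution_adiabatic : exists2 tau0, 0 < tau0 & exists2 K, 0 <= K &
  forall tau, tau0 <= tau ->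
  (exists rho, flux_solution tau rho) /\
  forall rho, flux_solution tau rho ->
   (forall rho', flux_solution tau rho' -> rho' = rho) /\
   forall t, `|rho t - rhoB t| <= K / tau.
Proof.
have [h h0 [tau0 tau00 Ah]] := A_coercive.
have [b b0 [Eb _ _ dEb]] := bounds.
have S_cont : vcont S.
  exact: (@vder_vcont _ _ _ _ _ (fun t => vder_dgmx_exp (beta / 2) t E_der)).
have T_cont : vcont T.
  exact: (@vder_vcont _ _ _ _ _ (fun t => vder_dgmx_exp (- (beta / 2)) t E_der)).
have X_cont : vcont (fun t => expmx (- beta) (W t)).
  exact: (@vder_vcont _ _ _ _ _ (fun t => vder_dgmx_exp (- beta) t W_der)).
have A_cont tau : vcont (A tau).
  apply: vcont_sub; last first.
    by apply: vcont_dgmx => i t; apply: cvgMl_tmp; exact: dE_cont.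
  apply: vcont_scale; apply: vcont_add; do ?[apply: vcont_mul => //];
    exact: vcont_cst.
have A_per tau t : A tau (t + 1) = A tau t.
  by rewrite /A /S /T E_per W_per dE_per.
have dPi_cont : vcont dPi.
  apply: vcont_scale; apply: vcont_mul; first apply: vcont_mul.
  - exact: vder_vcont vder_Pi.
  - exact: vcont_dgmx.
  - by apply: vcont_sub; [exact: vcont_cst|exact: vder_vcont vder_Pi].
have Pi_per t : Pi (t + 1) = Pi t by rewrite /Pi E_per.
have dPi_per t : dPi (t + 1) = dPi t by rewrite /dPi Pi_per dE_per.
have [c c0 hc] : exists2 c, 0 <= c & forall t, `|S t *m (dPi t *m z0)| <= c.
  apply: vcont_bounded; first by apply: vcont_mul => //; apply: vcont_mul => //; exact: vcont_cst.
  by move=> t; rewrite /S E_per dPi_per.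
have [d d0 hd] : exists2 c, 0 <= c & forall t, `|T t| <= c.
  by apply: vcont_bounded => // t; rewrite /T E_per.
have solE tau rho : flux_solution tau rho -> forall t, Z *m (rho t - z0) = 0.
  by move=> [_ _ h1] t; apply/coker_proj_image.
pose F := n%:R * c ^+ 2.
have F0 : 0 <= F by rewrite mulr_ge0// sqr_ge0.
exists tau0 => //; exists (n%:R * d * (Num.sqrt F / h)).
  by rewrite !mulr_ge0 ?sqrtr_ge0// invr_ge0 ltW.
move=> tau htau; have tau_gt0 : 0 < tau by exact: lt_le_trans tau00 htau.
have Acoer := Ah _ htau; have th0 : 0 < tau * h by rewrite mulr_gt0.
split.
  have [||//|t|y [yper yd]] := @coercive_periodic_solution R n (A tau)
    (fun t => tau *: (T t *m (Z *m z0))) _ th0 Acoer.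
  - exact: A_cont.
  - by apply: vcont_scale; apply: vcont_mul => //; exact: vcont_cst.
  - by rewrite /T E_per.
  pose rho t := T t *m y t.
  have yE t : y t = S t *m rho t by rewrite mulmxA ST mul1mx.
  have rper t : rho (t + 1) = rho t by rewrite /rho /T E_per yper.
  have rd t : vder rho t (- (B *m flux tau rho t)
     - tau *: (expmx (- beta) (E t) *m Z *m (rho t - z0))).
    have := vder_mul (vder_dgmx_exp (- (beta / 2)) t E_der) (yd t).
    rewrite -/(expmx _ _) -/(T t); congr vder.
    have ds : dgmx (fun i => beta / 2 * dE t i) = (beta / 2) *: dgmx (dE t).
      by apply/matrixP => i j; rewrite !mxE mulrnAr.
    have TT : T t *m T t = expmx (- beta) (E t).
      by rewrite expmxD -opprD -splitr.
    have TdE : T t *m dgmx (dE t) = dgmx (dE t) *m T t.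
      by rewrite !dgmxM; congr dgmx; apply/funext => i; rewrite mulrC.
    have e1 : T t *m (tau *: (S t *m B *m expmx (- beta) (W t) *m B^T *m S t *m y t)) =
        B *m flux tau rho t.
      rewrite /flux yE -!scalemxAr -SS; congr (_ *: _).
      by rewrite -!mulmxA (mulmxA (T t) (S t)) TS mul1mx.
    have e2 : T t *m (tau *: (T t *m Z *m T t *m y t)) =
        tau *: (expmx (- beta) (E t) *m Z *m rho t).
      by rewrite -scalemxAr -TT -!mulmxA.
    have e3 : T t *m ((beta / 2) *: (dgmx (dE t) *m y t)) =
        (beta / 2) *: (dgmx (dE t) *m T t *m y t).
      by rewrite -scalemxAr mulmxA TdE.
    have e4 : T t *m (tau *: (T t *m (Z *m z0))) =
        tau *: (expmx (- beta) (E t) *m Z *m z0).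
      by rewrite -scalemxAr -TT !mulmxA.
    rewrite [_ *m (rho t - z0)]mulmxBr scalerBr mulmxDr /A ds mulmxBl -!scalemxAl mulmxDl scalerDr.
    rewrite [T t *m - _]mulmxN [T t *m (_ + _ - _)]mulmxBr [T t *m (_ *: _ + _ *: _)]mulmxDr.
    rewrite e1 e2 e3 e4 scaleNr.
    move: (_ *m flux _ _ _) ((beta / 2) *: _) => u x; move: (tau *: _) (tau *: _) => v w.
    rewrite !opprB addrAC [x - _ - x]addrAC subrr add0r opprD addrA [RHS]addrAC //.
  have Z0 := Z_rho tau_gt0 rper rd.
  exists rho; split => //; last by move=> t; apply/coker_proj_image.
  by move=> t; have := rd t; rewrite -mulmxA Z0 mulmx0 scaler0 subr0.
move=> rho rhoS; split=> [rho' rho'S|t].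
  apply/funext => t.
  pose x t := rho' t - rho t.
  have Zx r : Z *m x r = 0.
    have := solE _ _ rhoS r; have := solE _ _ rho'S r; rewrite /x.
    move=> h1 h2; rewrite -(subrK z0 (rho' r)) -addrA mulmxDr h1 add0r.
    by rewrite -opprB mulmxN h2 oppr0.
  have xd r : vder x r (- (B *m flux tau x r) - tau *: (expmx (- beta) (E r) *m Z *m x r) + 0).
    have [rd _ _] := rhoS; have [rd' _ _] := rho'S.
    have := vder_sub (rd' r) (rd r); congr vder.
    rewrite addr0 -mulmxA Zx mulmx0 scaler0 subr0 /flux /x !mulmxBr scalerBr mulmxBr.
    by rewrite opprK opprB addrC.
  have xper r : S (r + 1) *m x (r + 1) = S r *m x r.
    by have [_ h1 _] := rhoS; have [_ h2 _] := rho'S; rewrite /x h1 h2 /S E_per.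
  have := @coercive_bound _ _ (A tau) (fun r => S r *m 0) (fun r => S r *m x r) _ 0 th0 Acoer
    _ xper (fun r => vder_S (xd r)) t.
  rewrite mul0r => h1.
  have : S t *m x t = 0.
    apply/eqP; rewrite -normr_le0; apply: norm_le_dot => //.
    rewrite expr0n/=; apply: h1 => r.
    by rewrite mulmx0 /dot big1// => i _; rewrite mxE mulr0.
  move/(congr1 (mulmx (T t))); rewrite mulmxA TS mul1mx mulmx0 => /eqP.
  by rewrite subr_eq0 => /eqP.
pose x t := rho t - rhoB t.
have Zx r : Z *m x r = 0.
  rewrite (_ : x r = (rho r - z0) - (rhoB r - z0)); last by rewrite opprB addrA subrK.
  by rewrite [Z *m (_ - _ - _)]mulmxBr (solE _ _ rhoS) rhoB_image subrr.
have rBd r : vder rhoB r (- (dPi r *m z0)).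
  rewrite -mulNmx; apply: (@vder_mulr _ _ _ _ z0 (fun t => 1%:M - Pi t)).
  by rewrite -[- _]add0r; apply: vder_sub; [exact: vder_cst|exact: vder_Pi].
have xd r : vder x r (- (B *m flux tau x r) - tau *: (expmx (- beta) (E r) *m Z *m x r)
     + dPi r *m z0).
  have [rd _ _] := rhoS.
  have := vder_sub (rd r) (rBd r); congr vder.
  rewrite opprK; congr (_ + _).
  rewrite -mulmxA Zx mulmx0 scaler0 subr0 /flux /x !mulmxBr rhoB_orth.
  by rewrite mulmx0 subr0.
have xper r : S (r + 1) *m x (r + 1) = S r *m x r.
  by have [_ h1 _] := rhoS; rewrite /x /rhoB /S h1 Pi_per E_per.
have := @coercive_bound _ _ (A tau) _ (fun r => S r *m x r) _ F th0 Acoer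
    _ xper (fun r => vder_S (xd r)) t.
move=> h1.
have {}h1 : `|S t *m x t| <= Num.sqrt F / (tau * h).
  apply: norm_le_dot; first by rewrite divr_ge0 ?sqrtr_ge0// ltW.
  rewrite expr_div_n sqr_sqrtr//; apply: h1 => r.
  by rewrite (le_trans (dot_le_norm _))// ler_wpM2l// lerXn2r ?nnegrE.
have -> : rho t - rhoB t = T t *m (S t *m x t) by rewrite mulmxA TS mul1mx.
rewrite (le_trans (mulmx_norm _ _))//.
rewrite (_ : _ / tau = n%:R * d * (Num.sqrt F / (tau * h))).
  by rewrite ler_pM ?mulr_ge0// ler_wpM2l.
by field; rewrite !gt_eqF.
Qed.

Let flux_Psi tau rho t : Psi t *m s *m (B *m flux tau rho t) = flux tau rho t.
Proof.
set J := flux tau rho t.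
have XV : dgmx (fun i => expR (beta * W t i)) *m expmx (- beta) (W t) = 1%:M.
  by rewrite -/(expmx beta _) expmxD subrr expmx0.
have PJ : Psi t *m J = J.
  rewrite mulmxBl mul1mx /wproj -[X in _ - X]mulmxA -(mulmxA _ MK^T) /J /flux.
  rewrite -!scalemxAr (mulmxA (dgmx (fun i => expR (beta * W t i)))) XV mul1mx.
  rewrite (mulmxA MK^T) -trmx_mul BMK trmx0.
  by rewrite mul0mx ?mulmx0 ?scaler0 ?mulmx0 ?scaler0 subr0.
have DJ : dgmx d2 *m J = J.
  rewrite /J /flux -scalemxAr; congr (_ *: _).
  rewrite (mulmxA (dgmx d2)) (_ : dgmx d2 *m _ = expmx (- beta) (W t) *m dgmx d2); last first.
    by rewrite !dgmxM; congr dgmx; apply/funext => i; rewrite mulrC.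
  by rewrite -mulmxA (mulmxA (dgmx d2)) -{1}dgmx_tr -trmx_mul Bd2.
have [C CE] := sBMK.
have : Psi t *m ((1%:M - s *m B) *m J) = 0.
  rewrite -DJ (mulmxA (1%:M - s *m B)) CE !mulmxA [Psi t *m MK]mulmxBl mul1mx.
  by rewrite wproj_id ?subrr ?mul0mx// => i; exact: expR_gt0.
rewrite [(1%:M - s *m B) *m J]mulmxBl mul1mx [Psi t *m (_ - _)]mulmxBr PJ => /eqP; rewrite subr_eq0 => /eqP e.
by rewrite [RHS]e !mulmxA.
Qed.

(* By the preceding identity the current is [- Psi s rho'], so that integrating
   by parts only the uniform distance of [rho] to its limit matters. *)
Theorem flux_average (G : R -> 'cV[R]_m) :
  (forall t, vder G t (Psi t *m s *m dPi t *m z0)) ->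
  exists2 K, 0 <= K & forall tau rho eps, 0 <= eps -> flux_solution tau rho ->
    (forall t, `|rho t - rhoB t| <= eps) ->
    `|\col_a (\int[lebesgue_measure]_(t in `[0, 1]) flux tau rho t a 0) - (G 1 - G 0)|
      <= K * eps.
Proof.
move=> Gd.
have Psi_per t : Psi (t + 1) = Psi t by rewrite /Psi W_per.
have dPsi_cont : vcont dPsi.
  apply: vcont_opp; apply: vcont_scale; apply: vcont_mul; last exact: vder_vcont vder_Psi.
  apply: vcont_mul; last exact: vcont_dgmx.
  by apply: vcont_sub; [exact: vcont_cst|exact: vder_vcont vder_Psi].
have [c c0 hc] : exists2 c, 0 <= c & forall t, `|dPsi t *m s| <= c.
  apply: vcont_bounded; first by apply: vcont_mul => //; exact: vcont_cst.
  by move=> t; rewrite /dPsi Psi_per dW_per.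
exists (n%:R * c); first by rewrite mulr_ge0.
move=> tau rho eps eps0 [rd rper rz0] reps.
have Jc : vcont (flux tau rho).
  apply: vcont_scale; apply: vcont_mul.
    exact: (@vder_vcont _ _ _ _ _ (fun t => vder_dgmx_exp (- beta) t W_der)).
  apply: vcont_mul; first exact: vcont_cst.
  apply: vcont_mul; last exact: vder_vcont rd.
  exact: (@vder_vcont _ _ _ _ _ (fun t => vder_dgmx_exp beta t E_der)).
have /choice[P hP] : forall a, exists P : R -> R,
    forall t, is_derive t (1 : R) P (flux tau rho t a 0).
  by move=> a; apply: (@continuous_primitive R (fun t => flux tau rho t a 0)); exact: Jc.
pose Jp t : 'cV[R]_m := \col_a P a t.
have Jpd t : vder Jp t (flux tau rho t).
  move=> i j; rewrite ord1; under [fun s => _]eq_fun do rewrite mxE.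
  exact: hP.
pose x t := rho t - rhoB t.
have rBd r : vder rhoB r (- (dPi r *m z0)).
  rewrite -mulNmx; apply: (@vder_mulr _ _ _ _ z0 (fun t => 1%:M - Pi t)).
  by rewrite -[- _]add0r; apply: vder_sub; [exact: vder_cst|exact: vder_Pi].
pose M t := Jp t + Psi t *m s *m x t - G t.
have Md t : vder M t (dPsi t *m s *m x t).
  have xd := vder_sub (rd t) (rBd t).
  have := vder_sub (vder_add (Jpd t) (vder_mul (vder_mulr s (vder_Psi t)) xd)) (Gd t).
  congr vder; rewrite opprK mulmxDr mulmxN flux_Psi.
  rewrite -[_ *m dPi t *m z0]mulmxA; move: (_ *m (dPi t *m z0)) (flux _ _ _) => u v.
  by rewrite addrA (addrA v) subrr add0r addrAC subrr add0r.
have -> : \col_a (\int[lebesgue_measure]_(t in `[0, 1]) flux tau rho t a 0) - (G 1 - G 0) =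
    M 1 - M 0.
  have -> : \col_a (\int[lebesgue_measure]_(t in `[0, 1]) flux tau rho t a 0) = Jp 1 - Jp 0.
    apply/colP => a; rewrite !mxE.
    exact: (@integral01_primitive R (fun t => flux tau rho t a 0) (P a) (Jc a 0) (hP a)).
  have x10 : x 1 = x 0.
    by rewrite -[1]add0r /x rper /rhoB /Pi E_per.
  have P10 : Psi 1 = Psi 0 by rewrite -[1]add0r Psi_per.
  rewrite /M x10 P10; move: (Jp 1) (Jp 0) (G 1) (G 0) (_ *m x 0) => a b u v w.
  by apply/colP => i; rewrite !mxE; ring.
apply: mx_norm_le => [|i j]; first by rewrite !mulr_ge0.
have -> : (M 1 - M 0) i j = M 1 i j - M 0 i j.
  by move: (M 1) (M 0) => u v; rewrite !mxE.
have -> : n%:R * c * eps = n%:R * c * eps * (1 - 0) by rewrite subr0 mulr1.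
apply: (@is_derive_lipschitz R (fun t => M t i j) (fun t => (dPsi t *m s *m x t) i j) _ _ _
  ler01 (fun t => Md t i j)) => t _.
rewrite (le_trans (mx_entry_le _ _ _))// (le_trans (mulmx_norm _ _))//.
by rewrite ler_pM ?mulr_ge0 ?ler_wpM2l// reps.
Qed.

End Adiabatic.

(** * The low temperature limit *)

Section LowTemperatureTools.
Variable R : realType.

Lemma segment_chain (P : R -> R -> Prop) :
  (forall a b c, P a b -> P b c -> P a c) ->
  (forall t, exists2 d, 0 < d & forall a b, a <= b -> t - d < a -> b < t + d -> P a b) ->
  P 0 1.
Proof.
move=> Ptr Ploc; pose A := [set x | 0 <= x <= 1 /\ P 0 x].
have A0 : A 0.
  split; first by rewrite lexx ler01.
  by have [d d0] := Ploc 0; apply; rewrite // ?sub0r ?oppr_lt0 ?add0r.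
have hsA : has_sup A by split; [exists 0|exists 1 => x [/andP[_ ?] _]].
have [d d0 Pd] := Ploc (sup A).
have [x Ax xd] := sup_adherent d0 hsA.
have xs : x <= sup A by apply: ub_le_sup => //; exact: hsA.2.
have s1 : sup A <= 1 by apply: ge_sup; [exact: hsA.1|move=> y [/andP[_ ?] _]].
pose y := Num.min 1 (sup A + d / 2).
have sy : sup A <= y by rewrite le_min s1 lerDl divr_ge0// ltW.
have Ay : A y.
  have [/andP[x0 _] Px] := Ax; split.
    by rewrite (le_trans x0 (le_trans xs sy)) ge_min lexx.
  apply: Ptr Px _; apply: Pd => //; first exact: le_trans sy.
  by rewrite gt_min; apply/orP; right; rewrite ltrD2l ltr_pdivrMr// ltr_pMr// ltr1n.
have ys : y <= sup A by apply: ub_le_sup => //; exact: hsA.2.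
suff <- : y = 1 by have [] := Ay.
rewrite /y min_l//; case: lerP => // h; move: ys; rewrite /y (min_r (ltW h)).
by rewrite gerDl leNgt divr_gt0.
Qed.

Lemma beta_exp_le (beta eps : R) : 1 <= beta -> 0 < eps ->
  beta * expR (- (beta * eps)) <= (4 / eps ^+ 2) / beta.
Proof.
move=> b1 e0; have b0 : 0 < beta by exact: lt_le_trans b1.
have h : beta * eps / 2 <= expR (beta * eps / 2).
  by rewrite (le_trans _ (expR_ge1Dx _))// lerDr.
have h2 : (beta * eps / 2) ^+ 2 <= expR (beta * eps).
  rewrite [X in expR X](splitr (beta * eps)) expRD -expr2.
  by rewrite lerXn2r ?nnegrE ?expR_ge0// divr_ge0// mulr_ge0// ltW.
rewrite expRN ler_pdivlMr// mulrAC ler_pdivrMr ?expR_gt0//.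
apply: le_trans (ler_wpM2l _ h2); last by rewrite divr_ge0// sqr_ge0.
by rewrite le_eqVlt; apply/orP; left; apply/eqP; field; rewrite gt_eqF.
Qed.

Lemma exp_le (beta eps : R) : 1 <= beta -> 0 < eps ->
  expR (- (beta * eps)) <= (4 / eps ^+ 2) / beta.
Proof.
move=> b1 e0; apply: le_trans (beta_exp_le b1 e0).
by rewrite ler_peMl// expR_ge0.
Qed.

Variable n : nat.
Implicit Types (J : {set 'I_n}) (f : 'I_n -> R).

Definition energy_rank J f : {ffun 'I_n -> nat} :=
  [ffun i => if i \in J then #|[pred j in J | f j < f i]| else 0%N].

Lemma energy_rank_lt J f i a : i \in J -> a \in J ->
  (energy_rank J f i < energy_rank J f a)%N -> f i < f a.
Proof.
move=> iJ aJ; rewrite !ffunE iJ aJ; apply: contraTT; rewrite -leNgt -leqNgt => ai.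
apply: subset_leq_card; apply/fintype.subsetP => j; rewrite !inE => /andP[-> /=].
by move=> ja; exact: lt_le_trans ai.
Qed.

Lemma energy_rank_inj J f : {in J &, injective f} -> {in J &, injective (energy_rank J f)}.
Proof.
move=> finj i a iJ aJ e; apply: finj => //.
have aux x y : x \in J -> y \in J -> f x < f y ->
    (energy_rank J f x < energy_rank J f y)%N.
  move=> xJ yJ xy; rewrite !ffunE xJ yJ; apply: proper_card; apply/properP; split.
    apply/fintype.subsetP => j; rewrite !inE => /andP[-> /=] jx; exact: lt_trans xy.
  by exists x; rewrite !inE ?xJ ?xy ?ltxx.
by case: (ltgtP (f i) (f a)) => // /aux; rewrite iJ aJ => /(_ isT isT); rewrite e ltnn.
Qed.

Lemma energy_gap J (f : R -> 'I_n -> R) t : (forall i, continuous (f^~ i)) ->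
  {in J &, injective (f t)} ->
  exists2 eps, 0 < eps & exists2 d, 0 < d & forall s, `|t - s| < d ->
    [/\ energy_rank J (f s) = energy_rank J (f t), {in J &, injective (f s)} &
     {in J &, forall i a, (energy_rank J (f t) i < energy_rank J (f t) a)%N ->
       f s i + eps <= f s a}].
Proof.
move=> fc finj.
pose eps := \big[Num.min/(1 : R)]_(p : 'I_n * 'I_n | f t p.1 < f t p.2) ((f t p.2 - f t p.1) / 3).
have eps0 : 0 < eps by apply: lt_bigmin => // p pp; rewrite divr_gt0// subr_gt0.
have epsP i a : f t i < f t a -> eps <= (f t a - f t i) / 3.
  by move=> ia; apply: (@bigmin_le_cond _ _ _ _ (i, a)).
have : \forall s \near t, forall i, `|f t i - f s i| < eps.
  apply: (@filter_forall _ _ (fun i => [set s | `|f t i - f s i| < eps]) _ (nbhs_filter t)) => i.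
  by have /cvgrPdist_lt/(_ _ eps0) := fc i t.
move=> /nbhs_ballP[d d0 hd].
have gap s : `|t - s| < d -> forall i a, f t i < f t a -> f s i + eps <= f s a.
  move=> /hd hs i a ia; have := hs i; have := hs a; have := epsP _ _ ia.
  rewrite !ltr_norml => h /andP[? ?] /andP[? ?]; lra.
exists eps => //; exists d => // s sd.
have lts i a : i \in J -> a \in J -> (f s i < f s a) = (f t i < f t a).
  move=> iJ aJ; apply/idP/idP => [h|h].
    rewrite ltNge; apply/negP => ai.
    move: ai; rewrite le_eqVlt => /orP[/eqP/finj|/(gap _ sd) h'].
      by move=> /(_ aJ iJ) e; rewrite e ltxx in h.
    by move: h' h; lra.
  by rewrite (lt_le_trans _ (gap _ sd _ _ h))// ltrDl.
split.
- apply/ffunP => i; rewrite !ffunE; case: ifP => // iJ; apply: eq_card => j.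
  by rewrite !inE; case: (boolP (j \in J)) => //= jJ; exact: lts.
- move=> i a iJ aJ e; apply: finj => //; apply/eqP; rewrite eq_le !leNgt.
  by rewrite -!lts// e ltxx.
- by move=> i a iJ aJ /(energy_rank_lt iJ aJ) ia; exact: gap.
Qed.

End LowTemperatureTools.

Lemma leading_projection_map (F F' : fieldType) (phi : {rmorphism F -> F'}) n m
    (M : 'M[F]_(n, m)) k S P : leading_projection M k S P ->
  leading_projection (map_mx phi M) k S (map_mx phi P).
Proof.
move=> [[C PC] PM P0 P1 lead]; split.
- by exists (map_mx phi C); rewrite PC map_mxM.
- by rewrite -map_mxM PM.
- by move=> i j jS; rewrite mxE P0// rmorph0.
- by move=> i j iS; rewrite mxE P1// rmorph_nat.
move=> a /lead[y ya yi]; exists (map_mx phi y); first by rewrite -map_mxM mxE ya rmorph1.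
by move=> i; rewrite -map_mxM mxE fmorph_eq0; exact: yi.
Qed.

Lemma leading_projection_diag (F : fieldType) n m (M : 'M[F]_(n, m)) k S P (D : 'M[F]_n) :
  leading_projection M k S P -> (forall i j, i != j -> D i j = 0) ->
  P *m D *m (1%:M - P) = 0.
Proof.
move=> [_ _ P0 P1 _] D0; apply/matrixP => i j; rewrite mxE [RHS]mxE big1// => a _.
rewrite mxE (bigD1 a)//= big1 ?addr0; last by move=> b /D0 ->; rewrite mulr0.
have [aS|aS] := boolP (a \in S); first by rewrite P0// !mul0r.
by rewrite (_ : (1%:M - P) a j = 0) ?mulr0// !mxE P1// subrr.
Qed.

Section LowTemperature.
Variables (R : realType) (n m p : nat).
Variables (B : 'M[rat]_(n, m)) (MK : 'M[rat]_(m, p)) (J1 : {set 'I_n}) (J2 : {set 'I_m}).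
Hypothesis BJ1 : forall i j, i \notin J1 -> B i j = 0.
Hypothesis MKJ2 : forall i j, i \notin J2 -> MK i j = 0.
Local Notation "A ^R" := (map_mx (ratr : rat -> R) A) (at level 2, format "A ^R").
Variables (s : 'M[R]_(m, n)) (z0 : 'cV[R]_n).

Variables (E dE : R -> 'I_n -> R) (W dW : R -> 'I_m -> R).
Hypothesis E_der : forall i t, is_derive t (1 : R) (E^~ i) (dE t i).
Hypothesis W_der : forall i t, is_derive t (1 : R) (W^~ i) (dW t i).
Hypothesis dE_cont : forall i, continuous (dE^~ i).
Hypothesis E_per : forall t, E (t + 1) = E t.
Hypothesis W_per : forall t, W (t + 1) = W t.
Hypothesis dE_per : forall t, dE (t + 1) = dE t.
Hypothesis goodEW : forall t,
  {in J1 &, injective (E t)} \/ {in J2 &, injective (W t)}.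

Variable lat : set 'cV[R]_m.
Hypothesis lat0 : lat 0.
Hypothesis latD : forall x y, lat x -> lat y -> lat (x + y).
Hypothesis latN : forall x, lat x -> lat (- x).
Hypothesis lat_proj : forall k1 S1 P1 k2 S2 P2,
  leading_projection B k1 S1 P1 -> leading_projection MK k2 S2 P2 ->
  lat ((1%:M - P2^R) *m s *m (P1^R *m z0)).

Variable G : R -> R -> 'cV[R]_m.
Hypothesis G_der : forall beta t, 0 < beta ->
  vder (G beta) t (Psi MK^R W beta t *m s *m dPi B^R E dE beta t *m z0).

Let Pib := Pi B^R E.
Let Psib := Psi MK^R W.
Let dPib := dPi B^R E dE.

Let E_cont i : continuous (E^~ i).
Proof. by move=> t; exact: is_derive_continuous (E_der i t). Qed.

Let W_cont i : continuous (W^~ i).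
Proof. by move=> t; exact: is_derive_continuous (W_der i t). Qed.

Let BRJ1 i j : i \notin J1 -> B^R i j = 0.
Proof. by move=> iJ; rewrite mxE BJ1// rmorph0. Qed.

Let MKRJ2 i j : i \notin J2 -> MK^R i j = 0.
Proof. by move=> iJ; rewrite mxE MKJ2// rmorph0. Qed.

Let norm1 k : `|1%:M : 'M[R]_k| <= 1.
Proof. by apply: mx_norm_le => // i j; rewrite mxE; case: eqP; rewrite ?normr1 ?normr0. Qed.

Let bound : exists2 c, 0 <= c & forall beta t,
  [/\ `|Pib beta t| <= c, `|1%:M - Pib beta t| <= c, `|Psib beta t *m s| <= c
    & `|dgmx (dE t)| <= c].
Proof.
have [c1 c10 h1] := wproj_bounded B^R; have [c2 c20 h2] := wproj_bounded MK^R.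
have [|t|d d0 hd] := @vcont_bounded R n n (fun t => dgmx (dE t)).
- exact: vcont_dgmx.
- by rewrite dE_per.
pose c3 := m%:R * c2 * `|s|.
have c30 : 0 <= c3 by rewrite !mulr_ge0.
exists (1 + c1 + c3 + d); first by rewrite !addr_ge0.
move=> beta t; have pos k (f : 'I_k -> R) i : 0 < expR (beta * f i) by exact: expR_gt0.
have hP : `|1%:M - Pib beta t| <= c1 by apply: h1 => i; exact: pos.
split.
- rewrite (_ : Pib beta t = 1%:M - (1%:M - Pib beta t)); last by rewrite opprB addrC subrK.
  by rewrite (le_trans (ler_normB _ _))// (le_trans (lerD (norm1 _) hP))// -addrA lerDl addr_ge0.
- by rewrite (le_trans hP)// -addrA addrAC lerDr !addr_ge0.
- rewrite (le_trans (mulmx_norm _ _))//.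
  rewrite (@le_trans _ _ c3)//; last by rewrite addrAC lerDr !addr_ge0.
  rewrite /c3 ler_wpM2r// ler_wpM2l//; apply: h2 => i; exact: pos.
- by rewrite (le_trans (hd t))// lerDr !addr_ge0.
Qed.

Let dPi_bound : exists2 c, 0 <= c & forall beta t, 1 <= beta ->
  `|dPib beta t *m z0| <= c * beta.
Proof.
have [c c0 hc] := bound.
exists (n%:R * (n%:R * (n%:R * c * c) * c) * `|z0|); first by rewrite !mulr_ge0.
move=> beta t b1; have b0 : 0 <= beta by exact: le_trans b1.
have [h1 h2 _ h4] := hc beta t.
rewrite /dPib /dPi -scalemxAl normrZ ger0_norm// mulrC ler_wpM2r//.
rewrite (le_trans (mulmx_norm _ _))// ler_wpM2r// ler_wpM2l//.
rewrite (le_trans (mulmx_norm _ _))// ler_pM ?mulr_ge0// ler_wpM2l//.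
by rewrite (le_trans (mulmx_norm _ _))// ler_pM ?mulr_ge0// ler_wpM2l.
Qed.

Let exists_P2 : exists P2 : {ffun 'I_m -> nat} -> 'M[rat]_m, forall k : {ffun 'I_m -> nat},
  {in J2 &, injective k} -> exists S, leading_projection MK k S (P2 k).
Proof.
have /choice[P2 h] : forall k : {ffun 'I_m -> nat}, exists P,
    {in J2 &, injective k} -> exists S, leading_projection MK k S P.
  move=> k; have [kinj|h] := pselect {in J2 &, injective k}; last by exists 0.
  by have [S [P SP]] := leading_projectionP MKJ2 kinj; exists P => _; exists S.
by exists P2.
Qed.

Let P2 := sval (cid exists_P2).
Let P2P : forall k : {ffun 'I_m -> nat}, {in J2 &, injective k} ->
  exists S, leading_projection MK k S (P2 k) := svalP (cid exists_P2).

Let Kf t : 'M[R]_(m, n) := if `[< {in J2 &, injective (W t)} >]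
  then (1%:M - (P2 (energy_rank J2 (W t)))^R) *m s else 0.

Let Kf_lat t k1 S1 P1 : leading_projection B k1 S1 P1 -> lat (Kf t *m (P1^R *m z0)).
Proof.
move=> h1; rewrite /Kf; case: asboolP => [/energy_rank_inj/P2P[S2 h2]|_].
  exact: lat_proj h1 h2.
by rewrite mul0mx.
Qed.

(* Subtracting the boundary terms makes the increments of [G] converge on every
   short interval, whichever of [E] and [W] is one-to-one there. *)
Let Phi beta t := G beta t - Kf t *m (Pib beta t *m z0).

Let approx a b := exists2 q, lat q & exists C, forall beta, 1 <= beta ->
  `|Phi beta b - Phi beta a - q| <= C / beta.

Let approx_trans a b c : approx a b -> approx b c -> approx a c.
Proof.
move=> [q lq [C hC]] [r lr [D hD]]; exists (q + r); first exact: latD.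
exists (C + D) => beta b1.
rewrite (_ : _ - _ = (Phi beta b - Phi beta a - q) + (Phi beta c - Phi beta b - r)).
  rewrite (le_trans (ler_normD _ _))// mulrDl.
  by apply: lerD; [exact: hC|exact: hD].
move: (Phi beta a) (Phi beta b) (Phi beta c) => u v w.
by apply/colP => i; rewrite !mxE; ring.
Qed.

Let mean (F dF : R -> 'cV[R]_m) a b c : a <= b -> 0 <= c ->
  (forall t, vder F t (dF t)) -> (forall t, a <= t <= b -> `|dF t| <= c) ->
  `|F b - F a| <= c * (b - a).
Proof.
move=> ab c0 Fd dFc; apply: mx_norm_le => [|i j]; first by rewrite mulr_ge0// subr_ge0.
have -> : (F b - F a) i j = F b i j - F a i j.
  by move: (F b) (F a) => u v; rewrite !mxE.
apply: (@is_derive_lipschitz R (fun t => F t i j) (fun t => dF t i j) _ _ _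
  ab (fun t => Fd t i j)) => t tab.
by rewrite (le_trans (mx_entry_le _ _ _))// dFc.
Qed.

Let near_dist (t a b d u : R) : t - d < a -> b < t + d -> a <= u <= b -> `|t - u| < d.
Proof. by move=> h1 h2 /andP[h3 h4]; rewrite ltr_norml; apply/andP; split; lra. Qed.

Let approx_W t : {in J2 &, injective (W t)} ->
  exists2 d, 0 < d & forall a b, a <= b -> t - d < a -> b < t + d -> approx a b.
Proof.
move=> Winj; have [eps eps0 [d d0 hd]] := energy_gap W_cont Winj.
exists d => // a b ab ta tb.
have [C C0 hC] : exists2 C, 0 <= C & forall u beta, a <= u <= b -> 1 <= beta ->
    `|Psib beta u *m s - Kf u| <= C * expR (- (beta * eps)).
  have [S2 h2] := P2P (energy_rank_inj Winj).
  have [C C0 hC] := wproj_leading MKRJ2 (leading_projection_map ratr h2).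
  exists (m%:R * C * `|s|); first by rewrite !mulr_ge0.
  move=> u beta uab b1; have [ru iu gu] := hd _ (near_dist ta tb uab).
  rewrite /Kf asboolT// ru -mulmxBl (le_trans (mulmx_norm _ _))//.
  rewrite [leRHS]mulrAC ler_wpM2r// -mulrA ler_wpM2l//.
  rewrite /Psib /Psi opprB addrCA [X in _ + X]addrC addKr.
  rewrite distrC hC ?expR_ge0// => [i|i j iJ jJ ij]; first exact: expR_gt0.
  rewrite -expRD ler_expR mulrC -mulrN -mulrDr addrC.
  by rewrite mulrC ler_wpM2l ?(le_trans _ b1)// lerBrDr gu.
have KE u : a <= u <= b -> Kf u = Kf a.
  move=> uab; have [ru iu _] := hd _ (near_dist ta tb uab).
  have aab : a <= a <= b by rewrite lexx.
  have [ra ia _] := hd _ (near_dist ta tb aab).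
  by rewrite /Kf !asboolT// ru ra.
exists 0 => //; have [D D0 hD] := dPi_bound.
exists (n%:R * C * D * (b - a) * (4 / eps ^+ 2)) => beta b1; rewrite subr0.
have b0 : 0 < beta by exact: lt_le_trans b1.
pose H u := G beta u - Kf a *m (Pib beta u *m z0).
have -> : Phi beta b - Phi beta a = H b - H a.
  by rewrite /Phi /H KE// lexx ab.
have Hd u : vder H u ((Psib beta u *m s - Kf a) *m (dPib beta u *m z0)).
  rewrite mulmxBl (mulmxA _ (dPib beta u)); apply: vder_sub; first exact: G_der.
  by apply: vder_mull; apply: vder_mulr; exact: (@vder_Pi R n m B^R E dE E_der).
rewrite (le_trans (mean (c := n%:R * C * D * (beta * expR (- (beta * eps)))) ab _ Hd _))//.
- by rewrite !mulr_ge0 ?expR_ge0// ltW.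
- move=> u uab; rewrite (le_trans (mulmx_norm _ _))//.
  rewrite (_ : _ * _ * _ * _ = n%:R * (C * expR (- (beta * eps))) * (D * beta)); last by ring.
  by rewrite ler_pM ?mulr_ge0// ?hD// ler_wpM2l// -(KE u uab) hC.
- rewrite [leLHS]mulrAC -[leRHS]mulrA ler_wpM2l ?beta_exp_le//.
  by rewrite !mulr_ge0// subr_ge0.
Qed.

Let approx_E t : {in J1 &, injective (E t)} ->
  exists2 d, 0 < d & forall a b, a <= b -> t - d < a -> b < t + d -> approx a b.
Proof.
move=> Einj; have [eps eps0 [d d0 hd]] := energy_gap E_cont Einj.
exists d => // a b ab ta tb.
have [S1 [P1 h1]] := leading_projectionP BJ1 (energy_rank_inj Einj).
have h1R := leading_projection_map (ratr : {rmorphism rat -> R}) h1.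
have [C C0 hC] : exists2 C, 0 <= C & forall u beta, a <= u <= b -> 1 <= beta ->
    `|Pib beta u - P1^R| <= C * expR (- (beta * eps)).
  have [C C0 hC] := wproj_leading BRJ1 h1R.
  exists C => // u beta uab b1; have [ru iu gu] := hd _ (near_dist ta tb uab).
  rewrite hC ?expR_ge0// => [i|i j iJ jJ ij]; first exact: expR_gt0.
  rewrite -expRD ler_expR mulrC -mulrN -mulrDr addrC.
  by rewrite mulrC ler_wpM2l ?(le_trans _ b1)// lerBrDr gu.
have [c c0 hc] := bound.
pose L := (Kf b - Kf a) *m (P1^R *m z0).
exists (- L).
  by apply: latN; rewrite /L mulmxBl; apply: latD; [|apply: latN]; exact: Kf_lat h1.
pose c1 := n%:R * (n%:R * C * c) * c + n%:R * (n%:R * `|P1^R| * c) * C.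
have c10 : 0 <= c1 by rewrite addr_ge0// !mulr_ge0.
pose c2 := n%:R * c * (n%:R * c1 * `|z0|) * (b - a).
have c20 : 0 <= c2 by rewrite !mulr_ge0// subr_ge0.
pose c3 k := n%:R * `|Kf k| * (n%:R * C * `|z0|).
exists ((c2 + c3 b + c3 a) * (4 / eps ^+ 2)) => beta b1.
have b0 : 0 < beta by exact: lt_le_trans b1.
have dPE u : a <= u <= b -> `|dPib beta u| <= beta * (c1 * expR (- (beta * eps))).
  move=> uab; rewrite /dPib /dPi normrZ gtr0_norm// ler_pM2l//.
  have := hC u beta uab b1; have [g1 g2 _ g4] := hc beta u.
  rewrite -/(Pib beta u); move: (Pib beta u) g1 g2 => Q g1 g2 QP.
  have -> : Q *m dgmx (dE u) *m (1%:M - Q) = (Q - P1^R) *m dgmx (dE u) *m (1%:M - Q)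
      - P1^R *m dgmx (dE u) *m (Q - P1^R).
    have e0 : P1^R *m dgmx (dE u) *m (1%:M - P1^R) = 0.
      by apply: leading_projection_diag h1R _ => i j ij; rewrite !mxE (negPf ij) mulr0n.
    have e1 : P1^R *m dgmx (dE u) *m (1%:M - Q) = - (P1^R *m dgmx (dE u) *m (Q - P1^R)).
      by apply/eqP; rewrite -addr_eq0 -mulmxDr addrA subrK e0.
    by rewrite [(Q - P1^R) *m _]mulmxBl [(_ - _) *m (1%:M - Q)]mulmxBl e1 opprK addrK.
  rewrite (le_trans (ler_normB _ _))// /c1 mulrDl lerD//.
    rewrite (le_trans (mulmx_norm _ _))//.
    rewrite (_ : _ * expR _ = n%:R * (n%:R * (C * expR (- (beta * eps))) * c) * c); last by ring.
    rewrite ler_pM ?mulr_ge0// ler_wpM2l//.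
    by rewrite (le_trans (mulmx_norm _ _))// ler_pM ?mulr_ge0// ler_wpM2l.
  rewrite (le_trans (mulmx_norm _ _))// -[leRHS]mulrA ler_pM ?mulr_ge0// ler_wpM2l//.
  by rewrite (le_trans (mulmx_norm _ _))// ler_pM ?mulr_ge0// ler_wpM2l.
have GE : `|G beta b - G beta a| <= c2 * (beta * expR (- (beta * eps))).
  pose c4 := n%:R * c * (n%:R * (beta * (c1 * expR (- (beta * eps)))) * `|z0|).
  have c40 : 0 <= c4 by rewrite !mulr_ge0 ?expR_ge0// ltW.
  apply: le_trans (mean (c := c4) ab c40 (fun u => G_der u b0) _) _.
    move=> u uab; rewrite -mulmxA (le_trans (mulmx_norm _ _))//.
    have [_ _ g3 _] := hc beta u.
    rewrite ler_pM ?mulr_ge0 ?ler_wpM2l//.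
    by rewrite (le_trans (mulmx_norm _ _))// ler_wpM2r// ler_wpM2l// dPE.
  by rewrite le_eqVlt /c4 /c2; apply/orP; left; apply/eqP; ring.
have KPE k u : a <= u <= b ->
    `|Kf k *m (Pib beta u *m z0) - Kf k *m (P1^R *m z0)| <=
      n%:R * `|Kf k| * (n%:R * C * `|z0|) * expR (- (beta * eps)).
  move=> uab; rewrite -mulmxBr -mulmxBl (le_trans (mulmx_norm _ _))//.
  rewrite -[leRHS]mulrA ler_wpM2l ?mulr_ge0// (le_trans (mulmx_norm _ _))//.
  by rewrite [leRHS]mulrAC ler_wpM2r// -mulrA ler_wpM2l// hC.
have eE : expR (- (beta * eps)) <= (4 / eps ^+ 2) / beta by exact: exp_le.
have ebE := beta_exp_le b1 eps0.
rewrite (_ : _ - - L = (G beta b - G beta a)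
  - (Kf b *m (Pib beta b *m z0) - Kf b *m (P1^R *m z0))
  + (Kf a *m (Pib beta a *m z0) - Kf a *m (P1^R *m z0))); last first.
  rewrite /L /Phi mulmxBl.
  move: (G beta b) (G beta a) (Kf b *m _) (Kf b *m _) (Kf a *m _) (Kf a *m _) => u v w x y z.
  by apply/colP => i; rewrite !mxE; ring.
rewrite (le_trans (ler_normD _ _))// -mulrA mulrDl lerD//; last first.
  by rewrite (le_trans (KPE a a _)) ?lexx// ler_wpM2l// !mulr_ge0.
rewrite (le_trans (ler_normB _ _))// mulrDl lerD//.
  by rewrite (le_trans GE)// ler_wpM2l.
by rewrite (le_trans (KPE b b _)) ?lexx ?ab// ler_wpM2l// !mulr_ge0.
Qed.

Theorem low_temperature_limit : exists2 q, lat q & exists C, forall beta, 1 <= beta ->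
  `|G beta 1 - G beta 0 - q| <= C / beta.
Proof.
have [q lq [C hC]] : approx 0 1.
  apply: segment_chain; first exact: approx_trans.
  by move=> t; have [/approx_E|/approx_W] := goodEW t.
exists q => //; exists C => beta b1; have := hC _ b1.
have E10 : E 1 = E 0 by rewrite -[1]add0r E_per.
have W10 : W 1 = W 0 by rewrite -[1]add0r W_per.
rewrite /Phi /Kf W10 /Pib /Pi E10.
move: (G beta 1) (G beta 0) (_ *m (_ *m z0)) => u v w.
by rewrite (_ : u - w - (v - w) = u - v)//; apply/colP => i; rewrite !mxE; ring.
Qed.

End LowTemperature.

(** * Homology of finite complexes with integer coefficients *)

Lemma subcomplex_down_closed (R : realType) (X : cw_complex R) (Y : {set cell X}) :
  (forall a b : cell X, a \in Y -> (cdim b < cdim a)%N -> b \in Y) -> subcomplex Y.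
Proof.
move=> Ydown; rewrite /subcomplex.
have -> : realization Y = \bigcup_(a in [set` Y]) (tagged (char X a) @` cube (tag (char X a))).
  apply/seteqP; split=> x [a /= aY].
    move=> [u ou <-]; exists a => //; exists u => // i.
    by have /andP[? ?] := ou i; rewrite !ltW.
  move=> [u cu <-]; have [ou|nou] := pselect (open_cube (tag (char X a)) u).
    by exists a => //; exists u.
  have [|b /= ba xb] := @char_frontier _ X a (tagged (char X a) u).
    by exists u.
  by exists b => //=; exact: Ydown ba.
apply: closed_bigcup; first exact: finite_finset.
move=> a _; apply: compact_closed; first exact: space_hausdorff.
apply: continuous_compact.
  by apply: continuous_subspaceT; have [] := char_singular a.
rewrite (_ : cube _ = [set v : 'rV[R]_(tag (char X a)) | forall i, `[0, 1]%classic (v ord0 i)]).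
  by apply: (@rV_compact R _ (fun=> `[0, 1]%classic)) => i; exact: segment_compact.
by apply/seteqP; split=> v h i; have := h i; rewrite /= in_itv.
Qed.

(* Adding [z] permutes the finitely many classes, so summing representatives
   before and after shows that the number of classes kills [z]. *)
Lemma class_count (V : zmodType) (Zc Bd Q : set V) :
  let cls z := [set z' | Zc z' /\ Bd (z' - z)] in
  Q `<=` Zc -> (forall x y, Q x -> Q y -> Q (x + y)) ->
  (forall x y, Bd x -> Bd y -> Bd (x - y)) ->
  finite_set (cls @` Q) ->
  forall z, Q z -> Bd 0 -> Bd (z *+ #|` fset_set (cls @` Q)|).
Proof.
move=> cls QZ QD BdB finH z Qz B0.
set H := cls @` Q in finH *; set F := fset_set H.
have BdN x : Bd x -> Bd (- x) by move=> Bx; rewrite -sub0r; exact: BdB.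
have BdD x y : Bd x -> Bd y -> Bd (x + y).
  by move=> Bx By; rewrite -[y]opprK; apply: BdB => //; exact: BdN.
have clsE x y : Q x -> cls x = cls y -> Bd (x - y).
  move=> Qx e; have : cls x x by split; [exact: QZ|rewrite subrr].
  by rewrite e => -[].
have clsB x y : Bd (x - y) -> cls x = cls y.
  move=> xy; apply/seteqP; split=> u [Zu ux]; split=> //.
    by rewrite -(subrKA x); exact: BdD.
  by rewrite -(subrKA y); apply: BdD => //; rewrite -opprB; exact: BdN.
have /choice[r hr] : forall C, exists x, C \in F -> Q x /\ cls x = C.
  move=> C; have [|CF] := boolP (C \in F); last by exists 0.
  by rewrite in_fset_set// inE => -[x Qx <-]; exists x.
pose f C := cls (r C + z).
have fF C : C \in F -> f C \in F.
  move=> /hr[Qr _]; rewrite in_fset_set// inE; exists (r C + z) => //.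
  exact: QD.
have finj : {in F &, injective f}.
  move=> C C' CF C'F /clsE; have [Qr rC] := hr _ CF; have [Qr' rC'] := hr _ C'F.
  by move=> /(_ (QD _ _ Qr Qz)); rewrite opprD addrACA subrr addr0 => /clsB; rewrite rC rC'.
have perm : perm_eq (map f F) F.
  have u : uniq (map f F) by rewrite map_inj_in_uniq// fset_uniq.
  have sub : {subset map f F <= F} by move=> C /mapP[C' C'F ->]; exact: fF.
  apply: uniq_perm => //; first exact: fset_uniq.
  have sz : (size F <= size (map f F))%N by rewrite size_map.
  by have [_ h] := uniq_min_size u sub sz.
have : Bd (\sum_(C <- F) (r (f C) - (r C + z))).
  rewrite big_seq; elim/big_ind : _ => // C CF.
  have [Qr rC] := hr _ (fF _ CF).
  by apply: clsE.
rewrite big_split/= sumrN big_split/=.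
rewrite -(big_map f predT r) (perm_big _ perm)/= opprD addrA subrr sub0r.
by rewrite big_const_seq count_predT iter_addr_0 => /BdN; rewrite opprK.
Qed.

Arguments chains {R X} A Y k _.
Arguments boundaries {R X} A Y L k _.
Arguments homology {R X} A Y L k _.
Arguments incl_homology {R X} A Y k c _.

Section Chains.
Variables (R : realType) (X : cellular_complex R) (A : pzRingType).
Implicit Types (Y L : {set cell X}) (k : int).

Lemma chains0 Y k : chains A Y k 0.
Proof. by move=> a; rewrite mxE eqxx. Qed.

Lemma chainsD Y k c c' : chains A Y k c -> chains A Y k c' -> chains A Y k (c + c').
Proof.
move=> hc hc' a; rewrite mxE; have [->|/hc//] := eqVneq (c a 0) 0.
by rewrite add0r; exact: hc'.
Qed.

Lemma chainsN Y k c : chains A Y k c -> chains A Y k (- c).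
Proof. by move=> hc a; rewrite mxE oppr_eq0; exact: hc. Qed.

Lemma chainsB Y k c c' : chains A Y k c -> chains A Y k c' -> chains A Y k (c - c').
Proof. by move=> hc hc'; apply: chainsD => //; exact: chainsN. Qed.

Lemma chainsMn Y k c n : chains A Y k c -> chains A Y k (c *+ n).
Proof.
by move=> hc; elim: n => [|n IH]; [exact: chains0|rewrite mulrS; exact: chainsD].
Qed.

Lemma chains_sub Y L k c : (forall a, (cdim a)%:Z = k -> a \in Y -> a \in L) ->
  chains A Y k c -> chains A L k c.
Proof. by move=> YL hc a /hc[aY ak]; split => //; exact: YL. Qed.

Lemma chains_no_cell k (c : 'cV[A]_(ncell X)) : chains A no_cell k c <-> c = 0.
Proof.
split=> [hc|->]; last exact: chains0.
apply/colP => a; rewrite mxE; apply/eqP/negPn/negP => /hc[].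
by rewrite finset.inE.
Qed.

Lemma bd_degree a b : bd X A a b != 0 -> cdim b = (cdim a).+1.
Proof.
have [h _ _] := incidenceP X; rewrite mxE => Dab; apply: h.
by apply: contraNneq Dab => ->.
Qed.

Lemma bd_chains Y k w : chains A Y (k + 1) w ->
  forall a, (bd X A *m w) a 0 != 0 -> (cdim a)%:Z = k.
Proof.
move=> hw a /eqP ha; apply: contrapT => ak; apply: ha.
rewrite mxE big1// => b _.
have [->|wb] := eqVneq (w b 0) 0; first by rewrite mulr0.
have [->|/bd_degree ab] := eqVneq (bd X A a b) 0; first by rewrite mul0r.
exfalso; apply: ak; have [_] := hw _ wb; rewrite ab.
by lia.
Qed.

Lemma bd_chains_in Y L k w : (forall a, (cdim a)%:Z = k -> a \in L) ->
  chains A Y (k + 1) w -> chains A L k (bd X A *m w).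
Proof. by move=> hL /bd_chains hw a /hw ak; split => //; exact: hL. Qed.

Lemma bd_bd : bd X A *m bd X A = 0.
Proof.
by have [_ _ DD] := incidenceP X; rewrite /bd -map_mxM DD map_mx0.
Qed.

Lemma boundariesB Y L k z z' : boundaries A Y L k z -> boundaries A Y L k z' ->
  boundaries A Y L k (z - z').
Proof.
move=> [hz [w hw hl]] [hz' [w' hw' hl']]; split; first exact: chainsB.
exists (w - w'); first exact: chainsB.
rewrite (_ : _ - _ = (z - bd X A *m w) - (z' - bd X A *m w')); first exact: chainsB.
by rewrite mulmxBr !opprB addrACA [RHS]addrACA (addrC (- z')).
Qed.

Lemma boundaries0 Y L k : boundaries A Y L k 0.
Proof.
split; first exact: chains0.
by exists 0; [exact: chains0|rewrite mulmx0 subr0; exact: chains0].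
Qed.

Lemma hclass_eq Y L k z z' : boundaries A Y L k (z - z') ->
  hclass A Y L k z = hclass A Y L k z'.
Proof.
move=> zz'; apply/seteqP; split=> u [cu bu]; split=> //.
  rewrite (_ : u - z' = (u - z) - (0 - (z - z'))).
    by apply: boundariesB => //; apply: boundariesB => //; exact: boundaries0.
  by rewrite sub0r opprK addrA subrK.
rewrite (_ : u - z = (u - z') - (z - z')); first exact: boundariesB.
by rewrite opprB addrA subrK.
Qed.

End Chains.

Section FiniteQuotients.
Variables (R : realType) (X : cellular_complex R).
Implicit Types (Y L : {set cell X}) (k : int).

Lemma finite_box (N M : nat) : finite_set [set z : 'cV[int]_N | forall a, `|z a 0| <= M%:Z].
Proof.
pose f (g : {ffun 'I_N -> 'I_(2 * M).+1}) : 'cV[int]_N := \col_a ((g a : nat)%:Z - M%:Z).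
apply: (@sub_finite_set _ _ (f @` setT)); last exact/finite_image/finite_finset.
move=> z hz; exists [ffun a => inord (absz (z a 0 + M%:Z)%R)] => //.
apply/colP => a; rewrite !mxE ffunE inordK; have := hz a; rewrite ler_norml => /andP[? ?]; lia.
Qed.

Variables (Y L : {set cell X}) (k : int) (Q : set 'cV[int]_(ncell X)).
Hypothesis Yk : forall a, (cdim a)%:Z = k -> a \in Y.
Hypothesis Qcycles : Q `<=` cycles int Y L k.
Hypothesis Qtors : forall z, Q z -> exists2 n, (0 < n)%N & boundaries int Y L k (z *+ n).

(* If [n z = bd w + l], dividing [w] and [l] by [n] with remainder gives a
   representative of the class of [z] bounded independently of [n]. *)
Lemma finite_quotient : finite_set (hclass int Y L k @` Q).
Proof.
pose D := bd X int; pose M := (\sum_a \sum_b `|D a b| + 1)%N.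
apply: (@sub_finite_set _ (hclass int Y L k @` Q)
    (hclass int Y L k @` [set z : 'cV[int]_(ncell X) | forall a, `|z a 0| <= M%:Z])).
  move=> _ [z Qz <-]; have [n n0 [hzn [w hw hl]]] := Qtors Qz.
  set l := z *+ n - bd X int *m w in hl.
  pose dv (v : 'cV[int]_(ncell X)) : 'cV[int]_(ncell X) := map_mx (fun x => (x %/ n%:Z)%Z) v.
  pose md (v : 'cV[int]_(ncell X)) : 'cV[int]_(ncell X) := map_mx (fun x => (x %% n%:Z)%Z) v.
  have dvmd v : v = dv v *+ n + md v.
    by apply/colP => a; rewrite !mxE mulmxnE mxE -mulr_natr natz -divz_eq.
  have chains_dv Y' k' v : chains int Y' k' v -> chains int Y' k' (dv v).
    by move=> hv a; rewrite mxE => va; apply: hv; apply: contraNneq va => ->; rewrite div0z.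
  have mdn v a : `|md v a 0| <= n%:Z.
    by rewrite mxE ger0_norm ?modz_ge0 ?ltW ?ltz_pmod//; lia.
  pose z' := z - (D *m dv w + dv l).
  have z'n : z' *+ n = D *m md w + md l.
    have -> : z' *+ n = z *+ n - (D *m (dv w *+ n) + dv l *+ n).
      by rewrite mulrnBl mulrnDl -!scaler_nat -scalemxAr.
    have -> : z *+ n = D *m w + l by rewrite /l addrC subrK.
    have e1 : D *m w = D *m (dv w *+ n) + D *m md w by rewrite -mulmxDr -dvmd.
    by rewrite e1 [X in _ + X - _]dvmd addrACA [LHS]addrAC subrr add0r.
  exists z'.
    move=> a /=; have : `|(z' *+ n) a 0| <= M%:Z * n%:Z.
      rewrite z'n mxE (le_trans (ler_normD _ _))// /M PoszD mulrDl mul1r lerD ?mdn//.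
      rewrite mxE (le_trans (ler_norm_sum _ _ _))//.
      apply: (@le_trans _ _ (\sum_b `|D a b| * n%:Z)).
        by apply: ler_sum => b _; rewrite normrM ler_wpM2l.
      rewrite -mulr_suml ler_wpM2r// [X in _ <= Posz X](bigD1 a)//= PoszD.
      rewrite -[leLHS]addr0 lerD// (big_morph _ PoszD (erefl _)) le_eqVlt; apply/orP; left.
      by apply/eqP; apply: eq_bigr => b _; rewrite abszE.
    by rewrite mulmxnE -mulr_natr normrM natz ler_pM2r// ltz_nat.
  apply/esym/hclass_eq; rewrite /z' opprB addrCA subrr addr0.
  split.
    apply: chainsD; first exact: bd_chains_in (chains_dv _ _ _ hw).
    by apply: chains_sub (chains_dv _ _ _ hl) => a ak _; exact: Yk.
  by exists (dv w); [exact: chains_dv|rewrite addrAC subrr add0r; exact: chains_dv].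
exact/finite_image/finite_box.
Qed.

Hypothesis Q0 : Q 0.
Hypothesis QD : forall x y, Q x -> Q y -> Q (x + y).

Lemma card_quotient_gt0 : (0 < #|` fset_set (hclass int Y L k @` Q)|)%N.
Proof.
rewrite cardfs_gt0; apply/fset0Pn; exists (hclass int Y L k 0).
by rewrite in_fset_set ?inE; [exists 0|exact: finite_quotient].
Qed.

Lemma card_quotient_kills z : Q z ->
  boundaries int Y L k (z *+ #|` fset_set (hclass int Y L k @` Q)|).
Proof.
move=> Qz; apply: (@class_count _ (cycles int Y L k)) => //.
- by move=> x y; exact: boundariesB.
- exact: finite_quotient.
- exact: boundaries0.
Qed.

End FiniteQuotients.

Section Restriction.
Variables (F : fieldType) (N : nat).

Definition restr (J : {set 'I_N}) : 'M[F]_N := diag_mx (\row_a (a \in J)%:R).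

Lemma restrE J n (A : 'M[F]_(N, n)) i j : (restr J *m A) i j = (i \in J)%:R * A i j.
Proof. by rewrite mul_diag_mx !mxE. Qed.

Lemma restrEr J n (A : 'M[F]_(n, N)) i j : (A *m restr J) i j = A i j * (j \in J)%:R.
Proof. by rewrite mul_mx_diag !mxE. Qed.

Lemma restr_idem J : restr J *m restr J = restr J.
Proof.
apply/matrixP => i j; rewrite restrE !mxE; case: eqP => [->|_]; last by rewrite !mulr0n mulr0.
by rewrite !mulr1n; case: (_ \in _); rewrite ?mulr1 ?mulr0.
Qed.

Lemma restr_id (J : {set 'I_N}) n (A : 'M[F]_(N, n)) : (forall i j, i \notin J -> A i j = 0) ->
  restr J *m A = A.
Proof.
move=> AJ; apply/matrixP => i j; rewrite restrE.
by have [_|/AJ->] := boolP (i \in J); rewrite ?mul1r// mulr0.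
Qed.

Lemma restr_tr J : (restr J)^T = restr J.
Proof. exact: tr_diag_mx. Qed.

Variables (J : {set 'I_N}) (B : 'M[F]_N).
Hypothesis BJ : B *m restr J = B.

Definition kernel_in : 'M[F]_N := restr J *m (kermx B^T)^T.
Definition section_in : 'M[F]_N := restr J *m (pinvmx B^T)^T.

Lemma mul_kernel_in : B *m kernel_in = 0.
Proof.
by rewrite mulmxA BJ; apply: trmx_inj; rewrite trmx_mul trmxK mulmx_ker trmx0.
Qed.

Lemma kernel_in0 i j : i \notin J -> kernel_in i j = 0.
Proof. by move=> iJ; rewrite restrE (negPf iJ) mul0r. Qed.

Lemma kernel_inP n (A : 'M[F]_(N, n)) : restr J *m A = A -> B *m A = 0 ->
  exists C, A = kernel_in *m C.
Proof.
move=> AJ BA; have /sub_kermxP/submxP[C CE] : A^T *m B^T = 0.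
  by rewrite -trmx_mul BA trmx0.
by exists C^T; rewrite -mulmxA -trmx_mul -CE trmxK AJ.
Qed.

Lemma section_inP : B *m section_in *m B = B.
Proof.
rewrite /section_in (mulmxA B) BJ; apply: trmx_inj.
have := mulmxKpV (submx_refl B^T); move: (pinvmx _) => p e.
by rewrite !trmx_mul trmxK mulmxA e.
Qed.

Lemma section_in_kernel : exists C, (1%:M - section_in *m B) *m restr J = kernel_in *m C.
Proof.
rewrite mulmxBl mul1mx -mulmxA BJ; apply: kernel_inP.
  by rewrite mulmxBr restr_idem /section_in !mulmxA restr_idem.
by rewrite mulmxBr BJ mulmxA section_inP subrr.
Qed.

End Restriction.

Section ChainSpace.
Variables (R : realType) (X : cellular_complex R).
Implicit Types (Y L : {set cell X}) (k : int).

Lemma chainsZ (A : idomainType) Y k (a : A) c : chains A Y k c -> chains A Y k (a *: c).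
Proof. by move=> hc i; rewrite mxE mulf_eq0 negb_or => /andP[_]; exact: hc. Qed.

Lemma chains_sum (A : pzRingType) Y k (I : Type) (r : seq I) (c : I -> 'cV[A]_(ncell X)) :
  (forall i, chains A Y k (c i)) -> chains A Y k (\sum_(i <- r) c i).
Proof.
by move=> hc; elim/big_ind : _ => //; [exact: chains0|exact: chainsD].
Qed.

Lemma chain_spaceP Y k c : (c \in chain_space Y k) <-> chains rat Y k c.
Proof.
split=> [|hc].
  rewrite /chain_space; set s := [seq _ | a <- _ & _] => hc.
  rewrite (coord_span (X := in_tuple s) hc); apply: chains_sum => i.
  apply: chainsZ => a.
  have /mapP[b] : (in_tuple s)`_i \in s by rewrite mem_nth.
  rewrite mem_filter => /andP[/eqP bk]; rewrite mem_enum => bY ->.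
  by rewrite mxE andbT; case: (eqVneq a b) => [-> _|_]; rewrite ?eqxx.
rewrite (matrix_sum_delta c); apply: memv_suml => a _; rewrite big_ord1 [ord0]ord1.
have [->|ca] := eqVneq (c a 0) 0; first by rewrite scale0r mem0v.
apply: memvZ; apply: memv_span; apply/mapP; exists a => //.
by have [aY ak] := hc _ ca; rewrite mem_filter mem_enum aY ak eqxx.
Qed.

Lemma eq_chain_space Y L k : (forall a, (cdim a)%:Z = k -> (a \in Y) = (a \in L)) ->
  chain_space Y k = chain_space L k.
Proof.
move=> YL; apply/vspaceP => c; apply/idP/idP => /chain_spaceP hc; apply/chain_spaceP;
  apply: chains_sub hc => a /YL ->//.
Qed.

Lemma bd_imgP Y k c : (c \in (linfun (mulmx (bd X rat)) @: chain_space Y k)%VS) <->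
  exists2 w, chains rat Y k w & c = bd X rat *m w.
Proof.
split=> [/memv_imgP[w /chain_spaceP hw ->]|[w hw ->]].
  by exists w; rewrite ?lfunE.
by rewrite -[_ *m _](lfunE (mulmx (bd X rat))) memv_img//; apply/chain_spaceP.
Qed.

Lemma bd_img_cycles Y k :
  (linfun (mulmx (bd X rat)) @: chain_space Y (k + 1) <=
   lker (linfun (mulmx (bd X rat))) :&: chain_space all_cells k)%VS.
Proof.
apply/subvP => c /bd_imgP[w hw ->]; rewrite memv_cap memv_ker lfunE/= mulmxA bd_bd mul0mx eqxx.
by apply/chain_spaceP; apply: bd_chains_in hw => a _; rewrite finset.inE.
Qed.

Lemma clear_denominators N (v : 'cV[rat]_N) : exists2 n, (0 < n)%N &
  exists w : 'cV[int]_N, v *+ n = map_mx intr w /\ forall a, v a 0 = 0 -> w a 0 = 0.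
Proof.
pose D a : nat := absz (denq (v a 0)).
have DE a : (D a)%:R = (denq (v a 0))%:~R :> rat.
  by rewrite -[_%:R]/((D a)%:Z%:~R) /D absz_denq.
exists (\prod_a D a)%N; first by apply/prodn_gt0 => a; rewrite absz_gt0 denq_neq0.
exists (\col_a (numq (v a 0) * (\prod_(b | b != a) D b)%N%:Z)).
split; last by move=> a va; rewrite mxE va.
apply/colP => a; rewrite mulmxnE !mxE -[LHS]mulr_natr (bigD1 a)//= natrM.
rewrite [in LHS]mulrA rmorphM/=; congr (_ * _).
by rewrite DE -{1}[v a 0]divq_num_den divfK// intr_eq0 denq_neq0.
Qed.

End ChainSpace.

(** * Spanning trees and co-trees *)

Section Spanning.
Variables (R : realType) (X : cellular_complex R) (d : nat).
Implicit Types (Y L T S : {set cell X}).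

Definition cells_of (k : int) : {set cell X} := finset (fun a => (cdim a)%:Z == k).

Local Notation J1 := (cells_of (d%:Z - 1)).
Local Notation J2 := (cells_of d%:Z).
Local Notation ratv := (map_mx (intr : int -> rat)).

Definition top_bd : 'M[rat]_(ncell X) := bd X rat *m restr rat J2.

Lemma in_cells_of k a : (a \in cells_of k) = ((cdim a)%:Z == k).
Proof. by rewrite finset.inE. Qed.

Lemma top_bd_restr : top_bd *m restr rat J2 = top_bd.
Proof. by rewrite -mulmxA restr_idem. Qed.

Lemma top_bd0 i j : i \notin J1 -> top_bd i j = 0.
Proof.
move=> iJ; rewrite restrEr in_cells_of; case: eqP => [jd|_]; last by rewrite mulr0.
rewrite mulr1; apply/eqP/negPn/negP => /bd_degree ij; move: iJ; rewrite in_cells_of.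
by move=> /eqP; apply; rewrite -jd ij; lia.
Qed.

Lemma restr_chains (A : fieldType) Y k c : chains A Y k c -> restr A (cells_of k) *m c = c.
Proof.
move=> hc; apply: restr_id => i j; rewrite ord1 in_cells_of; apply: contraNeq => /hc[_ ->].
exact: eqxx.
Qed.

Lemma top_bd_chains Y c : chains rat Y d%:Z c -> top_bd *m c = bd X rat *m c.
Proof. by move=> hc; rewrite -mulmxA (restr_chains hc). Qed.

Lemma restr_in_chains k (c : 'cV[rat]_(ncell X)) : chains rat all_cells k (restr rat (cells_of k) *m c).
Proof.
move=> a; rewrite restrE mulf_eq0 negb_or in_cells_of => /andP[+ _].
by rewrite finset.inE; case: (eqVneq (cdim a)%:Z k) => [-> _|_]; rewrite ?eqxx.
Qed.

Lemma chains_restr k (c : 'cV[rat]_(ncell X)) : restr rat (cells_of k) *m c = c ->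
  chains rat all_cells k c.
Proof. by move=> <-; exact: restr_in_chains. Qed.

Lemma chains_ratv Y k (w : 'cV[int]_(ncell X)) : chains rat Y k (ratv w) <-> chains int Y k w.
Proof. by split=> hw a; have := hw a; rewrite mxE intr_eq0. Qed.

Lemma ratv_bd (w : 'cV[int]_(ncell X)) : ratv (bd X int *m w) = bd X rat *m ratv w.
Proof.
rewrite map_mxM; congr (_ *m _); apply/matrixP => i j.
by rewrite !mxE intz.
Qed.

Lemma ratvMn (w : 'cV[int]_(ncell X)) n : ratv (w *+ n) = ratv w *+ n.
Proof. by rewrite raddfMn. Qed.

Lemma ratv_inj : injective (ratv : 'cV[int]_(ncell X) -> 'cV[rat]_(ncell X)).
Proof.
move=> v w /matrixP vw; apply/matrixP => i j; have := vw i j; rewrite !mxE.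
by move/intr_inj.
Qed.

Section Cotree.
Variables (k : cell X -> nat) (S : {set cell X}) (P : 'M[rat]_(ncell X)).
Hypothesis SP : leading_projection top_bd k S P.

Definition cotree_of : {set cell X} :=
  finset (fun a => ((cdim a)%:Z <= d%:Z - 2) || (a \in J1) && (a \in S)).

Lemma proj_bd Y w : chains rat Y d%:Z w -> P *m (bd X rat *m w) = bd X rat *m w.
Proof. by move=> hw; rewrite -(top_bd_chains hw) mulmxA (lp_id SP). Qed.

Lemma proj_cotree c : chains rat cotree_of (d%:Z - 1) c -> P *m c = 0.
Proof.
move=> hc; apply/colP => i; rewrite mxE [RHS]mxE big1// => a _.
have [->|/hc[]] := eqVneq (c a 0) 0; first by rewrite mulr0.
rewrite finset.inE => /orP[h ak|/andP[_ aS] _]; first by rewrite ak in h; lia.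
by rewrite (lp_coord0 SP)// mul0r.
Qed.

Lemma coproj_cotree c : chains rat all_cells (d%:Z - 1) c ->
  chains rat cotree_of (d%:Z - 1) (c - P *m c).
Proof.
move=> hc a; have [aS|aS] := boolP (a \in S); last first.
  rewrite (_ : (c - P *m c) a 0 = 0) ?eqxx//.
  rewrite !mxE (bigD1 a)//= (lp_coord1 SP)// eqxx mul1r big1 ?addr0 ?subrr//.
  by move=> j ja; rewrite (lp_coord1 SP)// eq_sym (negPf ja) mul0r.
move=> ca; rewrite finset.inE in_cells_of aS andbT.
suff /eqP -> : (cdim a)%:Z == d%:Z - 1 by rewrite eqxx orbT.
move: ca; apply: contraNT => ak.
have ca0 : c a 0 = 0 by apply/eqP/negPn/negP => /hc[_ /eqP]; rewrite (negPf ak).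
have Pc0 : (P *m c) a 0 = 0.
  have [C ->] := lp_image SP; rewrite -mulmxA mxE big1// => j _.
  by rewrite top_bd0 ?mul0r// in_cells_of.
by rewrite mxE ca0 add0r mxE Pc0 oppr0.
Qed.

Lemma proj_bdP c : exists2 w, chains rat all_cells d%:Z w & P *m c = bd X rat *m w.
Proof.
have [C ->] := lp_image SP; exists (restr rat J2 *m (C *m c)); first exact: restr_in_chains.
by rewrite -!mulmxA.
Qed.

Lemma cotree_of_spanning : spanning_cotree d%:Z cotree_of.
Proof.
have bdk a b : chains rat a (d%:Z - 1 + 1) b -> chains rat a d%:Z b by rewrite subrK.
have coc c : chains rat all_cells (d%:Z - 1) c -> bd X rat *m (c - P *m c) = bd X rat *m c.
  by move=> _; have [w _ ->] := proj_bdP c; rewrite mulmxBr mulmxA bd_bd mul0mx subr0.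
have no_top w : chains rat cotree_of (d%:Z - 1 + 1) w -> w = 0.
  move=> hw; apply/colP => a; rewrite mxE; apply/eqP/negPn/negP => /hw[].
  by rewrite !finset.inE => /orP[h ak|/andP[/eqP h _] ak]; lia.
have inclE z : cycles rat cotree_of no_cell (d%:Z - 1) z ->
    incl_homology rat all_cells (d%:Z - 1) (hclass rat cotree_of no_cell (d%:Z - 1) z) =
    hclass rat all_cells no_cell (d%:Z - 1) z.
  move=> cz; apply/seteqP; split=> u; last first.
    move=> uz; exists z => //; split => //; rewrite subrr; exact: boundaries0.
  move=> [z' [cz' bz'] uz']; rewrite (_ : z = z')//.
  have [_ [w /no_top ->]] := bz'; rewrite mulmx0 subr0 => /chains_no_cell/eqP.
  by rewrite subr_eq0 => /eqP.
have toall c : chains rat cotree_of (d%:Z - 1) c -> chains rat all_cells (d%:Z - 1) c.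
  by apply: chains_sub => a _ _; rewrite finset.inE.
split.
- apply: subcomplex_down_closed => a b; rewrite !finset.inE.
  by move=> /orP[h|/andP[/eqP h _]] ab; apply/orP; left; lia.
- apply/andP; split; apply/fintype.subsetP => a; rewrite !finset.inE.
    by move=> ->.
  by move=> /orP[h|/andP[/eqP h _]]; lia.
- split.
  + move=> _ [z cz <-]; rewrite inclE//; exists z => //.
    by have [hz hb] := cz; split => //; exact: toall.
  + move=> C C'; rewrite !inE => -[z cz <-] [z' cz' <-]; rewrite !inclE// => e.
    have : hclass rat all_cells no_cell (d%:Z - 1) z z.
      split; last by rewrite subrr; exact: boundaries0.
      by have [hz hb] := cz; split => //; exact: toall.
    rewrite e => -[_ [_ [w /bdk hw /chains_no_cell/eqP]]]; rewrite subr_eq0 => /eqP zz'.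
    have : P *m (z - z') = 0 by apply: proj_cotree; apply: chainsB; [case: cz|case: cz'].
    by rewrite zz' (proj_bd hw) -zz' => /eqP; rewrite subr_eq0 => /eqP ->.
  + move=> _ [z [cz zb] <-]; have hz := coproj_cotree cz.
    have cyc : cycles rat cotree_of no_cell (d%:Z - 1) (z - P *m z).
      by split => //; rewrite coc.
    exists (hclass rat cotree_of no_cell (d%:Z - 1) (z - P *m z)); first by exists (z - P *m z).
    rewrite inclE//; apply: hclass_eq; rewrite addrAC subrr sub0r.
    have [w hw ->] := proj_bdP z; split.
      apply: chainsN; apply: (@bd_chains_in _ _ _ all_cells) => [a _|].
        by rewrite finset.inE.
      by rewrite subrK.
    exists (- w); first by rewrite subrK; exact: chainsN.
    by rewrite mulmxN subrr; exact: chains0.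
- rewrite /betti (eq_chain_space (L := all_cells)); last first.
    by move=> a ak; rewrite !finset.inE ak lexx.
  congr (_ - \dim _)%N; apply/vspaceP => c.
  have dd : d%:Z - 2 + 1 = d%:Z - 1 by lia.
  rewrite dd; apply/idP/idP => /bd_imgP[w hw ->]; apply/bd_imgP.
    by exists w => //; exact: toall.
  by exists (w - P *m w); [exact: coproj_cotree|rewrite coc].
Qed.

End Cotree.

Section Tree.
Variables (k : cell X -> nat) (S : {set cell X}) (P : 'M[rat]_(ncell X)).
Hypothesis SP : leading_projection (kernel_in J2 top_bd) k S P.

Definition tree_of : {set cell X} :=
  finset (fun a => ((cdim a)%:Z <= d%:Z - 1) || (a \in J2) && (a \in S)).

Lemma proj_kernel c : chains rat all_cells d%:Z c -> bd X rat *m c = 0 -> P *m c = c.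
Proof.
move=> hc bc; have [C ->] : exists C, c = kernel_in J2 top_bd *m C.
  by apply: kernel_inP; [exact: restr_chains hc|rewrite (top_bd_chains hc)].
by rewrite mulmxA (lp_id SP).
Qed.

Lemma proj_tree c : chains rat tree_of d%:Z c -> P *m c = 0.
Proof.
move=> hc; apply/colP => i; rewrite mxE [RHS]mxE big1// => a _.
have [->|/hc[]] := eqVneq (c a 0) 0; first by rewrite mulr0.
rewrite finset.inE => /orP[h ak|/andP[_ aS] _]; first by rewrite ak in h; lia.
by rewrite (lp_coord0 SP)// mul0r.
Qed.

Lemma proj_in_kernel c : chains rat all_cells d%:Z (P *m c) /\ bd X rat *m (P *m c) = 0.
Proof.
have [C ->] := lp_image SP; split.
  by apply: chains_restr; rewrite /kernel_in -!mulmxA (mulmxA (restr _ _)) restr_idem.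
have h : bd X rat *m kernel_in J2 top_bd = 0.
  have := mul_kernel_in top_bd_restr.
  by rewrite {1}/top_bd -mulmxA /kernel_in (mulmxA (restr _ _)) restr_idem.
by move: h; move: (kernel_in _ _) => K h; rewrite !mulmxA h !mul0mx.
Qed.

Lemma coproj_tree c : chains rat all_cells d%:Z c -> chains rat tree_of d%:Z (c - P *m c).
Proof.
move=> hc; have hd : chains rat all_cells d%:Z (c - P *m c).
  by apply: chainsB => //; have [] := proj_in_kernel c.
move=> a ca; have [_ ad] := hd _ ca; split => //.
rewrite finset.inE in_cells_of ad eqxx /=; apply/orP; right.
move: ca; apply: contraNT => aS; apply/eqP.
rewrite !mxE (bigD1 a)//= (lp_coord1 SP)// eqxx mul1r big1 ?addr0 ?subrr//.
by move=> j ja; rewrite (lp_coord1 SP)// eq_sym (negPf ja) mul0r.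
Qed.

Lemma bd_coproj (c : 'cV[rat]_(ncell X)) : bd X rat *m (c - P *m c) = bd X rat *m c.
Proof. by rewrite mulmxBr (proj_in_kernel c).2 subr0. Qed.

Lemma tree_of_spanning : spanning_tree d%:Z tree_of.
Proof.
have toall c : chains rat tree_of d%:Z c -> chains rat all_cells d%:Z c.
  by apply: chains_sub => a _ _; rewrite finset.inE.
split.
- apply: subcomplex_down_closed => a b; rewrite !finset.inE.
  by move=> /orP[h|/andP[/eqP h _]] ab; apply/orP; left; lia.
- by apply/fintype.subsetP => a; rewrite !finset.inE => ->.
- have cyc0 z : cycles int tree_of no_cell d%:Z z -> z = 0.
    move=> [/chains_ratv hz /chains_no_cell bz]; apply: ratv_inj.
    have b0 : bd X rat *m ratv z = 0 by rewrite -ratv_bd bz map_mx0.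
    by rewrite -(proj_kernel (toall _ hz) b0) (proj_tree hz) map_mx0.
  apply/seteqP; split=> [_ [z /cyc0 -> <-]//|_ ->]; exists 0 => //.
  by split; [exact: chains0|rewrite mulmx0; exact: chains0].
- rewrite /betti (eq_chain_space (L := all_cells)); last first.
    by move=> a ak; rewrite !finset.inE ak lexx.
  congr (_ - \dim _)%N; apply/vspaceP => c.
  rewrite subrK; apply/idP/idP => /bd_imgP[w hw ->]; apply/bd_imgP.
    by exists w => //; exact: toall.
  by exists (w - P *m w); [exact: coproj_tree|rewrite bd_coproj].
Qed.

End Tree.

Lemma cotree_torsion L z : spanning_cotree d%:Z L ->
  cycles int all_cells L (d%:Z - 1) z ->
  exists2 n, (0 < n)%N & boundaries int all_cells L (d%:Z - 1) (z *+ n).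
Proof.
move=> [_ /andP[skL Lsk] [incl_fun _ incl_surj] bettiL] [hz _].
have dd : d%:Z - 2 + 1 = d%:Z - 1 by lia.
have chE : chain_space L (d%:Z - 2) = chain_space all_cells (d%:Z - 2).
  apply: eq_chain_space => a ak; rewrite finset.inE; apply: (fintype.subsetP skL).
  by rewrite finset.inE ak.
have imgE : (linfun (mulmx (bd X rat)) @: chain_space L (d%:Z - 1) =
    linfun (mulmx (bd X rat)) @: chain_space all_cells (d%:Z - 1))%VS.
  have sub : (linfun (mulmx (bd X rat)) @: chain_space L (d%:Z - 1) <=
      linfun (mulmx (bd X rat)) @: chain_space all_cells (d%:Z - 1))%VS.
    apply: limgS; apply/subvP => c /chain_spaceP hc; apply/chain_spaceP.
    by apply: chains_sub hc => a _ _; rewrite finset.inE.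
  apply/eqP; rewrite eqEdim sub /=.
  have := dimvS (@bd_img_cycles R X all_cells (d%:Z - 2)).
  have := dimvS sub.
  by move: bettiL; rewrite /betti dd chE; lia.
have /chains_ratv hzq := hz.
have [l hl bl] : exists2 l, chains rat L (d%:Z - 1) l & bd X rat *m ratv z = bd X rat *m l.
  apply/bd_imgP; rewrite imgE; apply/bd_imgP.
  by exists (ratv z).
have toall c : chains rat L (d%:Z - 1) c -> chains rat all_cells (d%:Z - 1) c.
  by apply: chains_sub => a _ _; rewrite finset.inE.
have cyc : cycles rat all_cells no_cell (d%:Z - 1) (ratv z - l).
  split; first by apply: chainsB => //; exact: toall.
  by rewrite mulmxBr bl subrr; exact: chains0.
have [_ [l' [hl' bl'] <-] e] := incl_surj (hclass rat all_cells no_cell (d%:Z - 1) (ratv z - l))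
  (ex_intro2 _ _ _ cyc erefl).
have : incl_homology rat all_cells (d%:Z - 1) (hclass rat L no_cell (d%:Z - 1) l') l'.
  exists l'; split => //; try by rewrite subrr; exact: boundaries0.
  by split => //; exact: toall.
rewrite e => -[_ [_ [w hw /chains_no_cell/eqP]]].
rewrite subr_eq0 => /eqP e'.
have zE : ratv z = (l + l') - bd X rat *m w.
  by rewrite -e'; move: (ratv z) => u; apply/colP => i; rewrite !mxE; ring.
have [n1 n10 [wi [wE w0]]] := clear_denominators w.
have [n2 n20 [li [lE l0]]] := clear_denominators (l + l').
exists (n1 * n2)%N; first by rewrite muln_gt0 n10.
split; first exact: chainsMn.
exists (- (wi *+ n2)).
  apply: chainsN; apply: chainsMn => a wa; apply: hw; apply: contraNneq wa => wa.
  by rewrite w0.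
rewrite (_ : _ - _ = li *+ n1).
  apply: chainsMn => a la; apply: (chainsD hl hl').
  by apply: contraNneq la => la; rewrite l0.
apply: ratv_inj; rewrite ratvMn -lE mulmxN opprK raddfD/= ratv_bd !ratvMn -wE zE.
rewrite -!scaler_nat -!scalemxAr !scalerA -!natrM (mulnC n2 n1).
by rewrite scalerBr subrK.
Qed.

Definition torsion_cycles T (k : int) : set 'cV[int]_(ncell X) :=
  [set z | cycles int T no_cell k z /\ exists2 n, (0 < n)%N & boundaries int T no_cell k (z *+ n)].

Lemma cyclesD (A : pzRingType) Y L k z z' : cycles A Y L k z -> cycles A Y L k z' ->
  cycles A Y L k (z + z').
Proof.
move=> [hz bz] [hz' bz']; split; first exact: chainsD.
by rewrite mulmxDr; exact: chainsD.
Qed.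

Lemma cycles0 (A : pzRingType) Y L k : cycles A Y L k 0.
Proof. by split; rewrite ?mulmx0; exact: chains0. Qed.

Lemma torsion_cycles0 T k : torsion_cycles T k 0.
Proof.
split; first exact: cycles0.
by exists 1%N => //; rewrite mulr1n; exact: boundaries0.
Qed.

Lemma boundariesD (A : pzRingType) Y L k z z' : boundaries A Y L k z -> boundaries A Y L k z' ->
  boundaries A Y L k (z + z').
Proof.
move=> hz hz'; rewrite -[z']opprK -[- z']sub0r; apply: boundariesB => //.
by apply: boundariesB => //; exact: boundaries0.
Qed.

Lemma boundariesMn (A : pzRingType) Y L k z n : boundaries A Y L k z ->
  boundaries A Y L k (z *+ n).
Proof.
by move=> hz; elim: n => [|n IH]; [exact: boundaries0|rewrite mulrS; exact: boundariesD].
Qed.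

Lemma torsion_cyclesD T k z z' : torsion_cycles T k z -> torsion_cycles T k z' ->
  torsion_cycles T k (z + z').
Proof.
move=> [cz [n n0 bz]] [cz' [n' n'0 bz']]; split; first exact: cyclesD.
exists (n * n')%N; first by rewrite muln_gt0 n0.
rewrite mulrnDl; apply: boundariesD; first by rewrite mulrnA; exact: boundariesMn.
by rewrite mulnC mulrnA; exact: boundariesMn.
Qed.

Lemma tree_cells T : spanning_tree d%:Z T -> forall a, (cdim a)%:Z = d%:Z - 1 -> a \in T.
Proof.
by move=> [_ /fintype.subsetP skT _ _] a ak; apply: skT; rewrite finset.inE ak.
Qed.

Lemma tree_torsion_gt0 T : spanning_tree d%:Z T -> (0 < tree_torsion d%:Z T)%N.
Proof.
move=> /tree_cells hT.
have c2 z : torsion_cycles T (d%:Z - 1) z ->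
  exists2 n, (0 < n)%N & boundaries int T no_cell (d%:Z - 1) (z *+ n) by case.
exact: card_quotient_gt0 hT c2 (torsion_cycles0 T _).
Qed.

Lemma cotree_index_gt0 L : spanning_cotree d%:Z L -> (0 < cotree_index d%:Z L)%N.
Proof.
move=> hL; have hall (a : cell X) : (cdim a)%:Z = d%:Z - 1 -> a \in all_cells by rewrite finset.inE.
have tors z : cycles int all_cells L (d%:Z - 1) z -> _ := cotree_torsion hL.
exact: card_quotient_gt0 hall tors (cycles0 int all_cells L _).
Qed.

Lemma cotree_all_cycles L z : spanning_cotree d%:Z L ->
  chains int all_cells (d%:Z - 1) z -> cycles int all_cells L (d%:Z - 1) z.
Proof.
move=> [_ /andP[/fintype.subsetP skL _] _ _] hz; split => //.
apply: (@bd_chains_in _ _ _ all_cells) => [a ak|]; last by rewrite subrK.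
by apply: skL; rewrite finset.inE ak; lia.
Qed.

Lemma cotree_kills k S P z : leading_projection top_bd k S P ->
  chains int all_cells (d%:Z - 1) z ->
  exists2 w, chains int all_cells d%:Z w &
    P *m ratv z *+ cotree_index d%:Z (cotree_of S) = bd X rat *m ratv w.
Proof.
move=> SP hz; have hL := cotree_of_spanning SP.
have hall (a : cell X) : (cdim a)%:Z = d%:Z - 1 -> a \in all_cells by rewrite finset.inE.
have tors u : cycles int all_cells (cotree_of S) (d%:Z - 1) u -> _ := cotree_torsion hL.
have [_ [w hw hl]] := card_quotient_kills hall (@subset_refl _ _)
  tors (@cyclesD int all_cells _ _) (cotree_all_cycles hL hz).
move: hw; rewrite subrK => hw; exists w => //.
move/chains_ratv : hl; rewrite raddfB/= ratvMn ratv_bd => /(proj_cotree SP).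
move/chains_ratv in hw.
rewrite mulmxBr (proj_bd SP hw) => /eqP; rewrite subr_eq0 => /eqP <-.
by rewrite -!scaler_nat -scalemxAr.
Qed.

Lemma tree_kills k S P w : leading_projection (kernel_in J2 top_bd) k S P ->
  chains int all_cells d%:Z w ->
  exists y : 'cV[int]_(ncell X),
    (ratv w - P *m ratv w) *+ tree_torsion d%:Z (tree_of S) = ratv y.
Proof.
move=> SP /[dup] hw /chains_ratv hwq; have hT := tree_of_spanning SP.
have hwT := coproj_tree SP hwq.
have [n n0 [y [yE y0]]] := clear_denominators (ratv w - P *m ratv w).
have toall c : chains rat (tree_of S) d%:Z c -> chains rat all_cells d%:Z c.
  by apply: chains_sub => a _ _; rewrite finset.inE.
have tors : torsion_cycles (tree_of S) (d%:Z - 1) (bd X int *m w).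
  split.
    split; last by rewrite mulmxA bd_bd mul0mx; exact: chains0.
    by apply: bd_chains_in; [exact: tree_cells hT|rewrite subrK; exact: hw].
  exists n => //; split.
    by apply: chainsMn; apply: bd_chains_in; [exact: tree_cells hT|rewrite subrK; exact: hw].
  exists y.
    by rewrite subrK => a ya; apply: hwT; apply: contraNneq ya => ya; rewrite y0.
  apply/chains_no_cell/eqP; rewrite subr_eq0; apply/eqP/ratv_inj.
  rewrite ratvMn !ratv_bd -yE -!scaler_nat -scalemxAr; congr (_ *: _).
  by rewrite (bd_coproj SP).
have c1 : torsion_cycles (tree_of S) (d%:Z - 1) `<=`
  cycles int (tree_of S) no_cell (d%:Z - 1) by move=> z [].
have c2 z : torsion_cycles (tree_of S) (d%:Z - 1) z ->
  exists2 n, (0 < n)%N & boundaries int (tree_of S) no_cell (d%:Z - 1) (z *+ n) by case.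
have [_ [y' hy' /chains_no_cell/eqP]] := card_quotient_kills (tree_cells hT) c1 c2
  (@torsion_cyclesD _ _) tors.
rewrite -/(tree_torsion d%:Z (tree_of S)) subr_eq0 => /eqP e.
move: hy'; rewrite subrK => /chains_ratv hy'; exists y'.
have ker : bd X rat *m (ratv w *+ tree_torsion d%:Z (tree_of S) - ratv y') = 0.
  rewrite mulmxBr -!ratv_bd -e; apply/eqP; rewrite subr_eq0; apply/eqP.
  by rewrite ratvMn ratv_bd -!scaler_nat -scalemxAr.
have ch : chains rat all_cells d%:Z (ratv w *+ tree_torsion d%:Z (tree_of S) - ratv y').
  by apply: chainsB; [exact: chainsMn|exact: toall].
have := proj_kernel SP ch ker.
rewrite mulmxBr (proj_tree SP hy') subr0 => h.
rewrite -[RHS](subKr (ratv w *+ tree_torsion d%:Z (tree_of S))) -h.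
by rewrite -!scaler_nat -scalemxAr scalerBr.
Qed.

End Spanning.

Section Lattice.
Variables (R : realType) (X : cellular_complex R) (d : nat).
Local Notation J2 := (cells_of X d%:Z).
Local Notation ratv := (map_mx (intr : int -> rat)).
Local Notation real := (map_mx (ratr : rat -> R)).

Definition fractions (m : nat) : set 'cV[R]_(ncell X) :=
  [set q | forall a, exists (p : int) (n : nat), q a 0 = p%:~R / m%:R ^+ n].

Lemma fractions0 m : fractions m 0.
Proof. by move=> a; exists 0, 0%N; rewrite mxE mul0r. Qed.

Lemma fractionsN m q : fractions m q -> fractions m (- q).
Proof.
by move=> hq a; have [p [n e]] := hq a; exists (- p), n; rewrite mxE e rmorphN/= mulNr.
Qed.

Lemma fractionsD m q q' : (0 < m)%N -> fractions m q -> fractions m q' -> fractions m (q + q').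
Proof.
move=> m0 hq hq' a; have [p [n e]] := hq a; have [p' [n' e']] := hq' a.
exists (p * m%:Z ^+ n' + p' * m%:Z ^+ n), (n + n')%N.
have m0' : m%:R != 0 :> R by rewrite pnatr_eq0 -lt0n.
rewrite mxE e e' rmorphD/= !rmorphM/= !rmorphXn/= exprD.
by rewrite -!pmulrn; field; rewrite !expf_neq0.
Qed.

Lemma delta_gt0 : (0 < delta X d%:Z)%N.
Proof.
apply/prodn_cond_gt0 => L /asboolP hL; apply/prodn_cond_gt0 => T /asboolP hT.
by rewrite muln_gt0 cotree_index_gt0// tree_torsion_gt0.
Qed.

Lemma dvdn_delta (L T : {set cell X}) : spanning_cotree d%:Z L -> spanning_tree d%:Z T ->
  (cotree_index d%:Z L * tree_torsion d%:Z T %| delta X d%:Z)%N.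
Proof.
move=> hL hT; rewrite /delta (bigD1 L) ?asboolT//=; apply: dvdn_mulr.
by rewrite (bigD1 T) ?asboolT//= dvdn_mulr.
Qed.

Definition top_kernel := kernel_in J2 (top_bd X d).
Definition top_section := section_in J2 (top_bd X d).

Lemma projections_fraction k1 S1 P1 k2 S2 P2 (z : 'cV[int]_(ncell X)) :
  leading_projection (top_bd X d) k1 S1 P1 -> leading_projection top_kernel k2 S2 P2 ->
  chains int all_cells (d%:Z - 1) z ->
  fractions (delta X d%:Z)
    ((1%:M - real P2) *m real top_section *m (real P1 *m map_mx intr z)).
Proof.
move=> h1 h2 hz.
have hL := cotree_of_spanning h1; have hT := tree_of_spanning h2.
have [w hw e1] := cotree_kills h1 hz; have [y e2] := tree_kills h2 hw.
set al := cotree_index _ _ in e1 *; set th := tree_torsion _ _ in e2 *.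
have /chains_ratv hwq := hw.
pose v := (1%:M - P2) *m top_section *m (P1 *m ratv z).
have ve : v *+ (al * th) = ratv y.
  rewrite -e2 mulrnA; congr (_ *+ _).
  rewrite /v -scaler_nat scalemxAr scaler_nat e1 -(top_bd_chains hwq).
  have [C CE] := section_in_kernel (@top_bd_restr R X d).
  have : (1%:M - P2) *m ((1%:M - top_section *m top_bd X d) *m ratv w) = 0.
    rewrite -{1}(restr_chains hwq) (mulmxA (1%:M - top_section *m _)) CE.
    rewrite mulmxBl mul1mx -/top_kernel; move: (lp_id h2); move: top_kernel => K e.
    by rewrite (mulmxA P2) (mulmxA P2) e subrr.
  rewrite [(1%:M - top_section *m _) *m _]mulmxBl mul1mx mulmxBr => /eqP.
  rewrite subr_eq0 => /eqP e; rewrite -!mulmxA in e *; rewrite -e mulmxBl mul1mx//.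
have -> : (1%:M - real P2) *m real top_section *m (real P1 *m map_mx intr z) = real v.
  rewrite /v !map_mxM map_mxB map_mx1; congr (_ *m (_ *m _)).
  by apply/matrixP => i j; rewrite !mxE /= ratr_int.
move=> a.
have m0 : (0 < al * th)%N by rewrite muln_gt0 cotree_index_gt0// tree_torsion_gt0.
have /dvdnP[c dE] := dvdn_delta hL hT.
exists (y a 0 * c%:Z), 1%N.
have c0 : (0 < c)%N by have := delta_gt0; rewrite dE muln_gt0 => /andP[].
rewrite expr1 dE.
have := congr1 (fun u : 'cV[rat]_(ncell X) => ratr (u a 0) : R) ve.
rewrite mulmxnE [ratv y a 0]mxE ratr_int raddfMn/= -[LHS]mulr_natr => e.
rewrite mxE rmorphM/= -e natrM -/al -/th -!pmulrn.
by field; rewrite !pnatr_eq0 -!lt0n c0 andbT andbC -muln_gt0.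
Qed.

End Lattice.

(** * The average current *)

Section Bridge.
Variables (R : realType) (X : cellular_complex R) (d : nat).
Variables (z0 : 'cV[int]_(ncell X)) (gamma : R -> params X d%:Z).
Hypothesis z0_cycle : cycles int all_cells no_cell (d%:Z - 1) z0.
Hypothesis gamma_smooth : smooth_params gamma.
Hypothesis gamma_periodic : forall t, gamma (t + 1) = gamma t.
Hypothesis gamma_good : forall t, good (gamma t).

Local Notation N := (ncell X).
Local Notation J1 := (cells_of X (d%:Z - 1)).
Local Notation J2 := (cells_of X d%:Z).
Local Notation real := (map_mx (ratr : rat -> R)).

Definition extend k (f : cells X k -> R) (a : cell X) : R :=
  if insub a is Some j then f j else 0.

Let E t := extend (gamma t).1.
Let W t := extend (gamma t).2.
Let dE t := extend (fun j => derive1 (fun u => (gamma u).1 j) t).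
Let dW t := extend (fun j => derive1 (fun u => (gamma u).2 j) t).
Let B := real (top_bd X d).
Let MK := real (top_kernel X d).
Let s := real (top_section X d).
Let z0R : 'cV[R]_N := map_mx intr z0.

Lemma extend_in k (f : cells X k -> R) a (ak : (cdim a)%:Z == k) :
  extend f a = f (exist _ a ak).
Proof. by rewrite /extend insubT; congr f; exact: val_inj. Qed.

Lemma extend_injective k (f : cells X k -> R) : injective f ->
  {in cells_of X k &, injective (extend f)}.
Proof.
move=> finj a b; rewrite !in_cells_of => ak bk.
by rewrite (extend_in _ ak) (extend_in _ bk) => /finj [].
Qed.

Lemma extend_derive k (f : R -> cells X k -> R) : (forall j, smooth (f^~ j)) ->
  forall a t, is_derive t (1 : R) (fun t => extend (f t) a)
    (extend (fun j => derive1 (f^~ j) t) a).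
Proof.
move=> fs a t; rewrite /extend; case: insubP => [j _ _|_]; last first.
  exact: (is_derive_cst (0 : R) t (1 : R)).
by rewrite derive1E; exact: (derivableP (fs j 0%N t)).
Qed.

Lemma extend_derive_continuous k (f : R -> cells X k -> R) : (forall j, smooth (f^~ j)) ->
  forall a, continuous (fun t => extend (fun j => derive1 (f^~ j) t) a).
Proof.
move=> fs a t; rewrite /extend; case: insubP => [j _ _|_]; last first.
  exact: cvg_cst.
exact: (is_derive_continuous (derivableP (fs j 1%N t))).
Qed.

Lemma derive1_periodic (f : R -> R) : (forall t, f (t + 1) = f t) ->
  forall t, derive1 f (t + 1) = derive1 f t.
Proof.
move=> fper t; rewrite /derive1.
rewrite (_ : (fun h => h^-1 *: (f (h + (t + 1)) - f (t + 1))) =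
  (fun h => h^-1 *: (f (h + t) - f t)))//.
by apply/funext => h; rewrite addrA !fper.
Qed.

Let E_der a t : is_derive t (1 : R) (E^~ a) (dE t a).
Proof. exact: extend_derive gamma_smooth.1 _ _. Qed.

Let W_der a t : is_derive t (1 : R) (W^~ a) (dW t a).
Proof. exact: extend_derive gamma_smooth.2 _ _. Qed.

Let dE_cont a : continuous (dE^~ a).
Proof. exact: extend_derive_continuous gamma_smooth.1 _. Qed.

Let dW_cont a : continuous (dW^~ a).
Proof. exact: extend_derive_continuous gamma_smooth.2 _. Qed.

Let E_per t : E (t + 1) = E t.
Proof. by rewrite /E gamma_periodic. Qed.

Let W_per t : W (t + 1) = W t.
Proof. by rewrite /W gamma_periodic. Qed.

Let dE_per t : dE (t + 1) = dE t.
Proof.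
congr extend; apply/funext => j; apply: derive1_periodic => u.
by rewrite gamma_periodic.
Qed.

Let dW_per t : dW (t + 1) = dW t.
Proof.
congr extend; apply/funext => j; apply: derive1_periodic => u.
by rewrite gamma_periodic.
Qed.

Lemma expop_extend k c (f : cells X k -> R) :
  expop c f = expmx c (extend f) *m restr R (cells_of X k).
Proof.
apply/matrixP => a b; rewrite dgmxEl !mxE.
case: (a == b); last by rewrite !mulr0n mulr0.
rewrite !mulr1n in_cells_of /extend; case: insubP => [j -> _|/negbTE ->].
  by rewrite mulr1.
by rewrite mulr0.
Qed.

Lemma expmx_restr c (f : 'I_N -> R) (J : {set cell X}) :
  expmx c f *m restr R J = restr R J *m expmx c f.
Proof.
apply/matrixP => a b; rewrite dgmxEl restrE !mxE.
by case: eqP => [->|_]; rewrite ?mulr1n ?mulr0n ?mulr0// mulrC.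
Qed.

Lemma real_restr (J : {set cell X}) : real (restr rat J) = restr R J.
Proof.
apply/matrixP => a b; rewrite !mxE; case: eqP => _; rewrite ?mulr0n ?rmorph0//.
by rewrite !mulr1n rmorph_nat.
Qed.

Lemma real_bd : real (bd X rat) = bd X R.
Proof. by apply/matrixP => a b; rewrite !mxE /= ratr_int. Qed.

Lemma real_top_bd : B = bd X R *m restr R J2.
Proof. by rewrite /B /top_bd map_mxM real_bd real_restr. Qed.

Lemma top_bd_tr_restr : B^T *m restr R J1 = B^T.
Proof.
apply/matrixP => i j; rewrite restrEr [RHS]mxE [X in X * _]mxE.
have [_|jJ] := boolP (j \in J1); first by rewrite mulr1.
by rewrite mxE top_bd0// rmorph0 mul0r.
Qed.

Lemma current_flux tau beta rho t :
  current gamma tau beta rho t = flux B E W beta tau rho t.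
Proof.
rewrite /current /flux !expop_extend -/(E t) -/(W t); congr (_ *: _).
rewrite -!mulmxA; congr (_ *m _).
rewrite [expmx beta _ *m (_ *m _)]mulmxA expmx_restr -mulmxA.
rewrite -[in RHS]top_bd_tr_restr real_top_bd trmx_mul restr_tr.
by rewrite !mulmxA.
Qed.

Let Bd2 : B *m dgmx (fun a => (a \in J2)%:R) = B.
Proof. by rewrite -[dgmx _]/(restr R J2) -real_restr -map_mxM top_bd_restr. Qed.

Let BsB : B *m s *m B = B.
Proof. by rewrite -!map_mxM section_inP// top_bd_restr. Qed.

Let BMK : B *m MK = 0.
Proof. by rewrite -map_mxM mul_kernel_in ?map_mx0// top_bd_restr. Qed.

Let sBMK : exists C, (1%:M - s *m B) *m dgmx (fun a => (a \in J2)%:R) = MK *m C.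
Proof.
have [C CE] := section_in_kernel (@top_bd_restr R X d).
exists (real C); rewrite -[MK *m _]map_mxM -CE -[dgmx _]/(restr R J2) -real_restr.
by rewrite map_mxM map_mxB map_mx1 map_mxM.
Qed.

Lemma restr_flux tau beta rho t :
  restr R J2 *m flux B E W beta tau rho t = flux B E W beta tau rho t.
Proof.
have rB : restr R J2 *m B^T = B^T.
  by rewrite real_top_bd trmx_mul restr_tr mulmxA restr_idem.
rewrite /flux -scalemxAr (mulmxA (restr R J2)) -expmx_restr.
by rewrite -(mulmxA (expmx _ _)) (mulmxA (restr R J2)) rB.
Qed.

Lemma chains_restrR k (c : 'cV[R]_N) : restr R (cells_of X k) *m c = c -> chains R all_cells k c.
Proof.
move=> <- a; rewrite restrE mulf_eq0 negb_or in_cells_of => /andP[+ _].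
by rewrite finset.inE; case: (eqVneq (cdim a)%:Z k) => [-> _|_]; rewrite ?eqxx.
Qed.

Lemma chains_z0 : chains R all_cells (d%:Z - 1) z0R.
Proof. by have [hz _] := z0_cycle => a; have := hz a; rewrite mxE intr_eq0. Qed.

Lemma bd_z0 : bd X R *m z0R = 0.
Proof.
have [_ /chains_no_cell bz] := z0_cycle.
have -> : bd X R = map_mx intr (bd X int) by apply/matrixP => i j; rewrite !mxE intz.
by rewrite -map_mxM bz map_mx0.
Qed.

Lemma periodic_solutionE tau beta rho : periodic_solution gamma z0 tau beta rho <->
  flux_solution B E W beta z0R tau rho.
Proof.
have bdB t : bd X R *m current gamma tau beta rho t = B *m flux B E W beta tau rho t.
  by rewrite current_flux -{1}restr_flux mulmxA -real_top_bd.
split=> [[rd rper rcyc rcls]|[rd rper rz]].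
  split=> // t; first by apply/vderP; rewrite -bdB; exact: rd.
  have : hclass R all_cells no_cell (d%:Z - 1) (rho t) (rho t).
    by split => //; rewrite subrr; exact: boundaries0.
  rewrite rcls => -[_ [_ [w hw /chains_no_cell/eqP]]]; rewrite subr_eq0 => /eqP ->.
  by exists w; rewrite real_top_bd -mulmxA; move: hw; rewrite subrK => /restr_chains ->.
have bdw w : chains R all_cells d%:Z (restr R J2 *m w).
  by apply: chains_restrR; rewrite mulmxA restr_idem.
have bnd t : boundaries R all_cells no_cell (d%:Z - 1) (rho t - z0R).
  have [w ->] := rz t; rewrite real_top_bd -mulmxA; split.
    apply: (@bd_chains_in _ _ _ all_cells) => [a _|]; first by rewrite finset.inE.
    by rewrite subrK.
  by exists (restr R J2 *m w); rewrite ?subrK// subrr; exact: chains0.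
split=> // t; first by rewrite bdB; apply/vderP; exact: rd.
  have [hz _] := bnd t; split.
    by rewrite -[rho t](subrK z0R); apply: chainsD => //; exact: chains_z0.
  rewrite -[rho t](subrK z0R) mulmxDr bd_z0 addr0.
  have [w ->] := rz t; rewrite real_top_bd -mulmxA (mulmxA (bd X R) (bd X R)) bd_bd mul0mx.
  exact: chains0.
exact: hclass_eq.
Qed.

Let adiabatic beta : 0 < beta -> _ := @flux_solution_adiabatic R N N B E dE W dW
  E_der W_der dE_cont E_per W_per dE_per beta z0R.

Lemma eventually_unique_solution beta : 0 < beta ->
  \forall tau \near +oo, exists! rho, periodic_solution gamma z0 tau beta rho.
Proof.
move=> /adiabatic[tau0 tau00 [K K0 h]]; exists tau0; split; first exact: num_real.
move=> tau /ltW t0; have [[rho hrho] hu] := h _ t0; exists rho; split.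
  exact/periodic_solutionE.
by move=> rho' /periodic_solutionE h'; have [e _] := hu _ h'; exact: e.
Qed.

Lemma adiabatic_limit : exists Q : R -> 'cV[R]_N,
  [/\ forall beta, 0 < beta -> avg_current gamma z0 tau beta @[tau --> +oo] --> Q beta,
      forall beta, 0 < beta -> restr R J2 *m Q beta = Q beta,
      forall beta, 0 < beta -> B *m Q beta = 0
    & exists2 q : 'cV[R]_N, fractions (delta X d%:Z) q & exists C, forall beta, 1 <= beta ->
        `|Q beta - q| <= C / beta].
Proof.
have /choice[G hG] : forall beta, exists G : R -> 'cV[R]_N, 0 < beta ->
    forall t, vder G t (Psi MK W beta t *m s *m dPi B E dE beta t *m z0R).
  move=> beta; have [b0|b0] := pselect (0 < beta); last by exists (fun=> 0).
  pose g t := Psi MK W beta t *m s *m dPi B E dE beta t *m z0R.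
  have gc : vcont g.
    apply: vcont_mul; last exact: vcont_cst.
    apply: vcont_mul.
      apply: vcont_mul; last exact: vcont_cst.
      exact: vder_vcont (vder_Psi MK W_der beta).
    apply: vcont_scale; apply: vcont_mul; first apply: vcont_mul.
    - exact: vder_vcont (vder_Pi B E_der beta).
    - exact: vcont_dgmx.
    - by apply: vcont_sub; [exact: vcont_cst|exact: vder_vcont (vder_Pi B E_der beta)].
  have /choice[P hP] : forall a, exists P : R -> R,
      forall t, is_derive t (1 : R) P (g t a 0).
    by move=> a; apply: (@continuous_primitive R (fun t => g t a 0)); exact: gc.
  exists (fun t => \col_a P a t) => _ t i j; rewrite ord1.
  by under [fun s => _]eq_fun do rewrite mxE; exact: hP.
pose Q beta := G beta 1 - G beta 0.
have avg_cvg beta : 0 < beta -> avg_current gamma z0 tau beta @[tau --> +oo] --> Q beta.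
  move=> b0; have [tau0 tau00 [K K0 hK]] := adiabatic b0.
  have [C C0 hC] := flux_average Bd2 BMK sBMK E_der W_der dW_cont E_per W_per dW_per (hG _ b0).
  apply/cvgrPdist_le => e e0; exists (Num.max tau0 (C * K / e)); split; first exact: num_real.
  move=> tau; rewrite gt_max => /andP[/ltW t0 te].
  have tau_gt0 : 0 < tau by exact: lt_le_trans t0.
  have [[rho hrho] hu] := hK _ t0.
  rewrite /avg_current.
  have hx : periodic_solution gamma z0 tau beta
      (xget (fun=> 0) [set rho | periodic_solution gamma z0 tau beta rho]).
    by apply: (@xgetPex _ (fun=> 0) [set rho | periodic_solution gamma z0 tau beta rho]);
      exists rho; exact/periodic_solutionE.
  move: (xget _ _) hx => rho' /periodic_solutionE hx.
  under eq_mx do under eq_Rintegral do rewrite current_flux.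
  have [_ hd] := hu _ hx.
  rewrite distrC (le_trans (hC _ _ _ _ hx hd))//.
    by rewrite divr_ge0// ltW.
  by rewrite mulrA ler_pdivrMr// [leRHS]mulrC -ler_pdivrMr// ltW.
have const (A : 'M[R]_N) (F : R -> 'cV[R]_N) beta : 0 < beta -> (forall t, F (t + 1) = F t) ->
    (forall t, vder (fun t => A *m G beta t - F t) t 0) -> A *m Q beta = 0.
  move=> b0 Fper Fd; rewrite /Q mulmxBr.
  have -> : A *m G beta 1 - A *m G beta 0 =
      (A *m G beta 1 - F 1) - (A *m G beta 0 - F 0).
    by rewrite -[in F 1](add0r 1) Fper opprB addrA subrK.
  apply/eqP; rewrite subr_eq0; apply/eqP/matrixP => i j.
  by apply: (@is_derive_0_is_cst R (fun t => (A *m G beta t - F t) i j)) => t;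
    have := Fd t i j; rewrite mxE.
exists Q; split=> //.
- move=> beta b0; apply/eqP; rewrite -subr_eq0 -{2}[Q beta]mul1mx -mulmxBl; apply/eqP.
  apply: (const _ (fun=> 0)) => // t.
  have := vder_sub (vder_mull (restr R J2 - 1%:M) (hG _ b0 t)) (vder_cst (0 : 'cV[R]_N) t).
  rewrite subr0 (_ : (restr R J2 - 1%:M) *m _ = 0)//.
  have sJ : (restr R J2 - 1%:M) *m s = 0.
    rewrite mulmxBl mul1mx -real_restr -map_mxM /top_section /section_in mulmxA.
    by rewrite restr_idem subrr.
  have KJ : (restr R J2 - 1%:M) *m MK = 0.
    rewrite mulmxBl mul1mx -real_restr -map_mxM /top_kernel /kernel_in mulmxA.
    by rewrite restr_idem subrr.
  rewrite !mulmxA (_ : _ *m Psi MK W beta t *m s = 0) ?mul0mx//.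
  rewrite /Psi mulmxBr mulmx1 mulmxBl sJ sub0r.
  by have [D ->] := wproj_image MK (fun i => expR (beta * W t i)); rewrite mulmxA KJ !mul0mx oppr0.
- move=> beta b0; apply: (const _ (fun t => Pi B E beta t *m z0R)) => // [t|t].
    by rewrite /Pi E_per.
  have := vder_sub (vder_mull B (hG _ b0 t)) (vder_mulr z0R (vder_Pi B E_der beta t)).
  rewrite (_ : B *m _ - _ = 0)//.
  have BPsi : B *m Psi MK W beta t = B.
    rewrite mulmxBr mulmx1.
    by have [D ->] := wproj_image MK (fun i => expR (beta * W t i)); rewrite mulmxA BMK mul0mx subr0.
  apply/eqP; rewrite subr_eq0 !mulmxA BPsi; apply/eqP; congr (_ *m _).
  rewrite /dPi -scalemxAr; congr (_ *: _).
  have PE : B *m s *m Pi B E beta t = Pi B E beta t.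
    by rewrite /Pi; have [D ->] := wproj_image B (fun i => expR (beta * E t i)); rewrite mulmxA BsB.
  by move: (Pi _ _ _ _) PE => P PE; rewrite !mulmxA PE.
- apply: (@low_temperature_limit R N N N (top_bd X d) (top_kernel X d) J1 J2 _ _ s z0R E dE W dW).
  + by move=> i j; exact: top_bd0.
  + by move=> i j; exact: kernel_in0.
  + exact: E_der.
  + exact: W_der.
  + exact: dE_cont.
  + exact: E_per.
  + exact: W_per.
  + exact: dE_per.
  + by move=> t; have [/extend_injective|/extend_injective] := gamma_good t; [left|right].
  + exact: fractions0.
  + by move=> x y; apply: fractionsD; exact: delta_gt0.
  + by move=> x; exact: fractionsN.
  + move=> k1 S1 P1 k2 S2 P2 h1 h2; apply: projections_fraction h1 h2 _.
    by have [] := z0_cycle.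
  + by move=> beta t b0; exact: hG.
Qed.

End Bridge.

Theorem theorem3 (R : realType) (X : cellular_complex R) (d : nat)
    (X_connected : connected [set: X])
    (d_ge1 : (1 <= d)%N) (dimX : has_dim X d)
    (z0 : 'cV[int]_(ncell X))
    (z0_cycle : cycles int all_cells no_cell (d%:Z - 1) z0)
    (gamma : R -> params X d%:Z)
    (gamma_smooth : smooth_params gamma)
    (gamma_periodic : forall t, gamma (t + 1) = gamma t)
    (gamma_good : forall t, good (gamma t)) :
  [/\ forall beta : R, 0 < beta ->
        \forall tau \near +oo,
          exists! rho, periodic_solution gamma z0 tau beta rho,
      forall beta : R, 0 < beta ->
        cvg (avg_current gamma z0 tau beta @[tau --> +oo]),
      cvg (adiabatic_current gamma z0 beta @[beta --> +oo])
    & fractional_lattice d%:Z (delta X d%:Z)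
        (lim (adiabatic_current gamma z0 beta @[beta --> +oo]))].
Proof.
have [Q [avgQ QJ BQ [q fq [C hC]]]] := adiabatic_limit z0_cycle gamma_smooth gamma_periodic gamma_good.
have Q_cvg : Q beta @[beta --> +oo] --> q.
  apply/cvgrPdist_le => e e0; exists (Num.max 1 (C / e)); split; first exact: num_real.
  move=> beta; rewrite gt_max => /andP[/ltW b1 be].
  rewrite distrC (le_trans (hC _ b1))//.
  by rewrite ler_pdivrMr ?(lt_le_trans _ b1)// [leRHS]mulrC -ler_pdivrMr// ltW.
have ad_cvg : adiabatic_current gamma z0 beta @[beta --> +oo] --> q.
  apply: cvg_trans Q_cvg; apply: near_eq_cvg; exists 0; split; first exact: num_real.
  by move=> beta b0; apply/esym/cvg_lim => //; exact: avgQ.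
have kernel_closed (A : 'M[R]_(ncell X)) :
    (forall beta, 0 < beta -> A *m Q beta = 0) -> A *m q = 0.
  move=> AQ; apply/eqP; rewrite -normr_le0; apply/ler_addgt0Pl => e e0; rewrite addr0.
  have C0 : 0 <= C by have := le_trans (normr_ge0 _) (hC 1 (lexx _)); rewrite divr1.
  pose K := (ncell X)%:R * `|A| * C.
  have K0 : 0 <= K by rewrite !mulr_ge0.
  pose beta := Num.max 1 (K / e).
  have b1 : 1 <= beta by rewrite le_max lexx.
  have b0 : 0 < beta by exact: lt_le_trans b1.
  rewrite (_ : A *m q = - (A *m (Q beta - q))); last by rewrite mulmxBr AQ// sub0r opprK.
  rewrite normrN (le_trans (mulmx_norm _ _))//.
  rewrite (le_trans (ler_wpM2l _ (hC _ b1)))// ?mulr_ge0//.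
  rewrite mulrA -/K ler_pdivrMr// [leRHS]mulrC -ler_pdivrMr//.
  by rewrite le_max lexx orbT.
split.
- by move=> beta; exact: eventually_unique_solution.
- by move=> beta b0; apply/cvg_ex; exists (Q beta); exact: avgQ.
- by apply/cvg_ex; exists q.
rewrite (cvg_lim _ ad_cvg)//.
have qJ : restr R (cells_of X d%:Z) *m q = q.
  apply/eqP; rewrite -subr_eq0 -{2}[q]mul1mx -mulmxBl; apply/eqP.
  by apply: kernel_closed => beta b0; rewrite mulmxBl mul1mx QJ// subrr.
split=> //; split; first exact: chains_restrR.
by apply/chains_no_cell; rewrite -qJ mulmxA -real_top_bd; exact: kernel_closed.
Qed.
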